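(* Let $k$ be an algebraically closed field with $\mathrm{char}(k)=0$, let $\Gamma$ be a (connected) Brauer graph with vertices $x_1,\dots,x_r$ of multiplicities $m_1,\dots,m_r$, numbered so that $m_i>1$ for $1\le i\le r'$ and $m_i=1$ for $r'<i\le r$, and let $A=A_\Gamma$ be its Brauer graph algebra. If $\Gamma$ is not multiplicity-free (i.e. $r'\ge 1$), then there is an isomorphism of $k$-algebras $$Z^{\mathrm{st}}(A)/\mathrm{soc}(Z^{\mathrm{st}}(A))\cong k[X_1,X_2,\dots,X_{r'}]/\big(X_i^{m_i-1}\ (1\le i\le r'),\ X_iX_j\ (i\neq j)\big).$$ Otherwise (if all multiplicities equal $1$), $Z^{\mathrm{st}}(A)/\mathrm{soc}(Z^{\mathrm{st}}(A))\cong k$ or $Z^{\mathrm{st}}(A)/\mathrm{soc}(Z^{\mathrm{st}}(A))=0$.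
   Context: Brauer graphs. A ribbon graph is a tuple $\Gamma=(V,H,r,\iota,\rho)$ with $V$ (vertices) and $H$ (half-edges) finite sets, $r:H\to V$ a function, $\iota:H\to H$ an involution without fixed points, and $\rho:H\to H$ a permutation whose cycles are exactly the sets $H_v=r^{-1}(v)$, $v\in V$. Its edges are the $\iota$-orbits $\bar h=\{h,\iota(h)\}$, with $\bar h$ incident to $r(h)$ and $r(\iota(h))$; the underlying graph is assumed connected. The valency of $v$ is $val(v)=|H_v|$. A Brauer graph is a ribbon graph together with a multiplicity function $m:V\to\mathbb{Z}_{>0}$. A vertex $v$ is truncated if $m(v)\,val(v)=1$. A Brauer graph is multiplicity-free if $m$ is constantly $1$. Brauer graph algebras. Paths are written from right to left; $s(p),t(p)$ denote source and terminus of a path. If $\Gamma$ is a single edge with two truncated vertices, then $A_\Gamma=k[\alpha]/(\alpha^2)$. Otherwise $A_\Gamma=kQ_\Gamma/I_\Gamma$, where the vertices of $Q_\Gamma$ are the edges of $\Gamma$, and for each $h\in H$ with $r(h)$ not truncated there is an arrow $\alpha_h:\bar h\to\overline{\rho(h)}$. Put $\sigma(\alpha_h)=\alpha_{\rho^{-1}(h)}$, $C_\alpha=\alpha\sigma(\alpha)\cdots\sigma^{l}(\alpha)$ where $l+1$ is the size of the $\sigma$-orbit of $\alpha$, and $m(C_{\alpha_h})=m(r(h))$. $I_\Gamma$ is generated by: (a) $C_\alpha^{m(C_\alpha)}-C_\beta^{m(C_\beta)}$ for arrows with $t(\alpha)=t(\beta)$; (b) $\alpha C_{\sigma(\alpha)}^{m(C_\alpha)}$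 for all arrows $\alpha$; (c) $\alpha\beta$ for composable arrows with $\beta\neq\sigma(\alpha)$. Centers. $Z(A)\cong\operatorname{End}_{A^e}(A)$ is the center, $A^e=A\otimes_kA^{op}$; the projective center $Z^{\mathrm{pr}}(A)$ is the ideal of $Z(A)$ corresponding to those $A^e$-endomorphisms of $A$ that factor through a projective $A^e$-module; the stable center is $Z^{\mathrm{st}}(A)=Z(A)/Z^{\mathrm{pr}}(A)$. $\mathrm{soc}$ denotes the socle. *)

(* Defs.v *)
From HB Require Import structures.
From mathcomp Require Import all_boot all_order all_algebra perm.
From mathcomp Require Import finmap.
From mathcomp Require Import boolp.
From mathcomp Require Import monalg.

Set Implicit Arguments.
Unset Strict Implicit.
Unset Printing Implicit Defensive.

Import GRing.Theory.
Local Open Scope ring_scope.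

(* MathComp's [algType] excludes the zero algebra, but stable centers and
   their quotients can be zero.  [pzAlgType k] is the type of k-algebras, i.e.
   rings A (1 = 0 allowed) with a ring morphism [kcst] from k to the center
   of A. *)
HB.mixin Record PzRing_isPzAlgebra (k : pzRingType) A of GRing.PzRing A := {
  kcst : k -> A;
  kcst_is_zmod_morphism : zmod_morphism kcst;
  kcst_is_monoid_morphism : monoid_morphism kcst;
  kcstC : forall c x, kcst c * x = x * kcst c
}.

#[short(type="pzAlgType")]
HB.structure Definition PzAlgebra (k : pzRingType) :=
  {A of GRing.PzRing A & PzRing_isPzAlgebra k A}.

HB.instance Definition _ (k : pzRingType) (A : pzAlgType k) :=
  GRing.isZmodMorphism.Build k A (@kcst k A) kcst_is_zmod_morphism.
HB.instance Definition _ (k : pzRingType) (A : pzAlgType k) :=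
  GRing.isMonoidMorphism.Build k A (@kcst k A) kcst_is_monoid_morphism.

HB.instance Definition _ (k : comNzRingType) :=
  PzRing_isPzAlgebra.Build k k^o
    (fun _ _ => erefl) (conj erefl (fun _ _ => erefl)) (@mulrC k).
HB.instance Definition _ (k : comNzRingType) :=
  PzRing_isPzAlgebra.Build k {poly k}
    (raddfB polyC) (conj (rmorph1 polyC) (rmorphM polyC))
    (fun c p => mulrC c%:P p).
Lemma kcstM_op (k : comNzRingType) (A : pzAlgType k) :
  monoid_morphism (kcst : k -> A^c).
Proof.
split; first exact: (rmorph1 (@kcst k A)).
by move=> c d; rewrite (rmorphM (@kcst k A)) kcstC.
Qed.
HB.instance Definition _ (k : comNzRingType) (A : pzAlgType k) :=
  PzRing_isPzAlgebra.Build k A^c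
    (@kcst_is_zmod_morphism k A) (@kcstM_op k A)
    (fun c x => esym (@kcstC k A c x)).

Definition alg_iso (k : pzRingType) (A B : pzAlgType k) : Prop :=
  exists f : {rmorphism A -> B}, (forall c, f (kcst c) = kcst c) /\ bijective f.

Section Quotient.
Context (k : pzRingType) (B : pzAlgType k).

Record ideal := Ideal {
  ideal_pred :> B -> Prop;
  ideal0 : ideal_pred 0;
  idealD : forall x y, ideal_pred x -> ideal_pred y -> ideal_pred (x + y);
  idealMl : forall a x, ideal_pred x -> ideal_pred (a * x);
  idealMr : forall a x, ideal_pred x -> ideal_pred (x * a)
}.

Section GenIdeal.
Variable S : B -> Prop.
Definition gen_ideal_pred (x : B) : Prop :=
  forall J : ideal, (forall s, S s -> J s) -> J x.
Lemma gen_ideal0 : gen_ideal_pred 0.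
Proof. by move=> J _; apply: (ideal0 J). Qed.
Lemma gen_idealD x y :
  gen_ideal_pred x -> gen_ideal_pred y -> gen_ideal_pred (x + y).
Proof. by move=> Hx Hy J HJ; apply: (@idealD J); [apply: Hx | apply: Hy]. Qed.
Lemma gen_idealMl a x : gen_ideal_pred x -> gen_ideal_pred (a * x).
Proof. by move=> Hx J HJ; apply: (@idealMl J); apply: Hx. Qed.
Lemma gen_idealMr a x : gen_ideal_pred x -> gen_ideal_pred (x * a).
Proof. by move=> Hx J HJ; apply: (@idealMr J); apply: Hx. Qed.
Definition gen_ideal : ideal :=
  Ideal gen_ideal0 gen_idealD gen_idealMl gen_idealMr.
End GenIdeal.

Variable I : ideal.

Lemma idealN x : I x -> I (- x).
Proof. by rewrite -mulN1r; apply: idealMl. Qed.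

Lemma idealB x y : I x -> I y -> I (x - y).
Proof. by move=> Hx Hy; apply: idealD => //; apply: idealN. Qed.

Definition ideal_eqv (x y : B) : bool := `[< I (x - y) >].

Lemma ideal_eqv_refl : reflexive ideal_eqv.
Proof. by move=> x; apply/asboolP; rewrite subrr; apply: ideal0. Qed.

Lemma ideal_eqv_sym : symmetric ideal_eqv.
Proof.
by move=> x y; apply/asboolP/asboolP => /idealN; rewrite opprB.
Qed.

Lemma ideal_eqv_trans : transitive ideal_eqv.
Proof.
move=> y x z /asboolP Hxy /asboolP Hyz; apply/asboolP.
by have := idealD Hxy Hyz; rewrite addrA subrK.
Qed.

Canonical ideal_equiv :=
  EquivRel ideal_eqv ideal_eqv_refl ideal_eqv_sym ideal_eqv_trans.

Definition quot_alg : Type := {eq_quot ideal_equiv}%qT.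

HB.instance Definition _ := Choice.on quot_alg.
HB.instance Definition _ := EqQuotient.on quot_alg.

Definition quot_pi (x : B) : quot_alg := (\pi_quot_alg x)%qT.

Lemma quot_piP x y : quot_pi x = quot_pi y <-> I (x - y).
Proof.
by split=> [/eqquotP/asboolP//|H]; apply/eqquotP/asboolP.
Qed.

Lemma quot_piW (P : quot_alg -> Prop) :
  (forall x, P (quot_pi x)) -> forall u, P u.
Proof. by move=> H; elim/quotW. Qed.

Lemma quot_reprK (u : quot_alg) : quot_pi (repr u)%qT = u.
Proof. exact: reprK. Qed.

Let lift1 (f : B -> B) (u : quot_alg) := quot_pi (f (repr u)%qT).
Let lift2 (f : B -> B -> B) (u v : quot_alg) :=
  quot_pi (f (repr u)%qT (repr v)%qT).

Let reprP x : I ((repr (quot_pi x))%qT - x).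
Proof. by apply/quot_piP; rewrite quot_reprK. Qed.

Let lift1E f x : (forall y z, I (y - z) -> I (f y - f z)) ->
  lift1 f (quot_pi x) = quot_pi (f x).
Proof. by move=> Hf; apply/quot_piP/Hf/reprP. Qed.

Let lift2E f x y :
    (forall y z x, I (y - z) -> I (f y x - f z x)) ->
    (forall x y z, I (y - z) -> I (f x y - f x z)) ->
  lift2 f (quot_pi x) (quot_pi y) = quot_pi (f x y).
Proof.
move=> Hl Hr; apply/quot_piP.
rewrite -(subrK (f x (repr (quot_pi y))%qT) (f _ _)) -addrA.
by apply: idealD; [apply/Hl/reprP | apply/Hr/reprP].
Qed.

Definition quot_add := lift2 +%R.
Definition quot_opp := lift1 -%R.
Definition quot_mul := lift2 *%R.

Lemma quot_addE x y : quot_add (quot_pi x) (quot_pi y) = quot_pi (x + y).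
Proof.
by apply: lift2E => *; rewrite opprD addrACA subrr ?addr0 ?add0r.
Qed.

Lemma quot_oppE x : quot_opp (quot_pi x) = quot_pi (- x).
Proof. by apply: lift1E => y z /idealN; rewrite opprB opprK addrC. Qed.

Lemma quot_mulE x y : quot_mul (quot_pi x) (quot_pi y) = quot_pi (x * y).
Proof.
by apply: lift2E => [y0 z x0|x0 y0 z] H; rewrite -?mulrBl -?mulrBr;
  [apply: idealMr|apply: idealMl].
Qed.

Let qE := (quot_addE, quot_oppE, quot_mulE).

Lemma quot_addA : associative quot_add.
Proof. by do 3!elim/quot_piW=> ?; rewrite !qE addrA. Qed.
Lemma quot_addC : commutative quot_add.
Proof. by do 2!elim/quot_piW=> ?; rewrite !qE addrC. Qed.
Lemma quot_add0 : left_id (quot_pi 0) quot_add.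
Proof. by elim/quot_piW=> ?; rewrite !qE add0r. Qed.
Lemma quot_addN : left_inverse (quot_pi 0) quot_opp quot_add.
Proof. by elim/quot_piW=> ?; rewrite !qE addNr. Qed.
HB.instance Definition _ :=
  GRing.isZmodule.Build quot_alg quot_addA quot_addC quot_add0 quot_addN.

Lemma quot_mulA : associative quot_mul.
Proof. by do 3!elim/quot_piW=> ?; rewrite !qE mulrA. Qed.
Lemma quot_mul1 : left_id (quot_pi 1) quot_mul.
Proof. by elim/quot_piW=> ?; rewrite !qE mul1r. Qed.
Lemma quot_mulr1 : right_id (quot_pi 1) quot_mul.
Proof. by elim/quot_piW=> ?; rewrite !qE mulr1. Qed.
Lemma quot_mulDl : left_distributive quot_mul +%R.
Proof. by do 3!elim/quot_piW=> ?; rewrite /+%R /= !qE mulrDl. Qed.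
Lemma quot_mulDr : right_distributive quot_mul +%R.
Proof. by do 3!elim/quot_piW=> ?; rewrite /+%R /= !qE mulrDr. Qed.
HB.instance Definition _ := GRing.Zmodule_isPzRing.Build quot_alg
  quot_mulA quot_mul1 quot_mulr1 quot_mulDl quot_mulDr.

Lemma quot_kcstB : zmod_morphism (fun c : k => quot_pi (kcst c)).
Proof. by move=> c d; rewrite raddfB /GRing.add/= /GRing.opp/= !qE. Qed.
Lemma quot_kcstM : monoid_morphism (fun c : k => quot_pi (kcst c)).
Proof. by split=> [|c d]; rewrite ?rmorph1// rmorphM /GRing.mul/= !qE. Qed.
Lemma quot_kcstC c (u : quot_alg) : quot_pi (kcst c) * u = u * quot_pi (kcst c).
Proof. by elim/quot_piW: u => x; rewrite /GRing.mul/= !qE kcstC. Qed.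
HB.instance Definition _ :=
  PzRing_isPzAlgebra.Build k quot_alg quot_kcstB quot_kcstM quot_kcstC.

Lemma quot_piB : zmod_morphism quot_pi.
Proof. by move=> x y; rewrite [in RHS]/GRing.add/= [in RHS]/GRing.opp/= !qE. Qed.
Lemma quot_piM : monoid_morphism quot_pi.
Proof. by split=> // x y; rewrite [in RHS]/GRing.mul/= qE. Qed.
HB.instance Definition _ := GRing.isZmodMorphism.Build B quot_alg quot_pi quot_piB.
HB.instance Definition _ :=
  GRing.isMonoidMorphism.Build B quot_alg quot_pi quot_piM.

Definition quotient : pzAlgType k := quot_alg.

End Quotient.

(* [cat_comp f g] is f after g; it is only meaningful (and only constrained)
   when [cat_src f = cat_tgt g]. *)
Record finObCategory := FinObCategory {
  cat_ob : finType;
  cat_hom : choiceType;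
  cat_src : cat_hom -> cat_ob;
  cat_tgt : cat_hom -> cat_ob;
  cat_id : cat_ob -> cat_hom;
  cat_comp : cat_hom -> cat_hom -> cat_hom;
  cat_src_id : forall x, cat_src (cat_id x) = x;
  cat_tgt_id : forall x, cat_tgt (cat_id x) = x;
  cat_src_comp : forall f g,
    cat_src f = cat_tgt g -> cat_src (cat_comp f g) = cat_src g;
  cat_tgt_comp : forall f g,
    cat_src f = cat_tgt g -> cat_tgt (cat_comp f g) = cat_tgt f;
  cat_comp1f : forall f, cat_comp (cat_id (cat_tgt f)) f = f;
  cat_compf1 : forall f, cat_comp f (cat_id (cat_src f)) = f;
  cat_compA : forall f g h, cat_src f = cat_tgt g -> cat_src g = cat_tgt h ->
    cat_comp f (cat_comp g h) = cat_comp (cat_comp f g) h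
}.

Section LinearExtension.
Context (k : fieldType) (K : choiceType) (V : lmodType k).

Definition malg_ext (F : K -> V) (g : {malg k[K]}) : V :=
  \sum_(x <- msupp g) g@_x *: F x.

Lemma malg_extEw (F : K -> V) (g : {malg k[K]}) (d : {fset K}) :
  (msupp g `<=` d)%fset -> malg_ext F g = \sum_(x <- d) g@_x *: F x.
Proof.
move=> le; rewrite /malg_ext (big_fset_incl _ le)// => x _ /mcoeff_outdom->.
by rewrite scale0r.
Qed.

Lemma malg_ext_linear F : linear (malg_ext F).
Proof.
move=> c g h; pose d := (msupp g `|` msupp h `|` msupp (c *: g + h))%fset.
rewrite !(@malg_extEw _ _ d) ?fsubsetUr//;
  [|by rewrite /d -fsetUA fsetUCA fsubsetUl|by rewrite /d -fsetUA fsubsetUl].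
rewrite scaler_sumr -big_split/=; apply: eq_bigr => x _.
by rewrite mcoeffD mcoeffZ scalerDl scalerA.
Qed.
HB.instance Definition _ F :=
  GRing.isLinear.Build k {malg k[K]} V *:%R (malg_ext F) (malg_ext_linear F).

Lemma malg_extU F c x : malg_ext F << c *g x >> = c *: F x.
Proof.
by rewrite (malg_extEw _ (msuppU_le (k := x) (x := c))) big_seq_fset1 mcoeffUU.
Qed.

Lemma eq_malg_ext F G : F =1 G -> malg_ext F =1 malg_ext G.
Proof. by move=> FG g; apply: eq_bigr => x _; rewrite FG. Qed.

Lemma malgZU (c : k) (x : K) : << c *g x >> = c *: << x >> :> {malg k[K]}.
Proof. by apply/malgP => y; rewrite mcoeffZ !mcoeffU mulrnAr mulr1. Qed.

End LinearExtension.

Section CategoryAlgebra.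
Context (k : fieldType) (C : finObCategory).

Definition cat_alg : Type := {malg k[cat_hom C]}.
HB.instance Definition _ := GRing.Lmodule.on cat_alg.

Definition cat_basis (f : cat_hom C) : cat_alg := << f >>.

Definition cat_basis_mul (f g : cat_hom C) : cat_alg :=
  if cat_src f == cat_tgt g then cat_basis (cat_comp f g) else 0.

Definition cat_mul (u v : cat_alg) : cat_alg :=
  malg_ext (fun f => malg_ext (fun g => cat_basis_mul f g) v) u.

Definition cat_one : cat_alg := \sum_(x : cat_ob C) cat_basis (cat_id x).

Lemma cat_mulZDl w : linear (cat_mul^~ w).
Proof. by move=> c u v; rewrite /cat_mul linearP. Qed.

Lemma cat_mulZDr w : linear (cat_mul w).
Proof.
move=> c u v; rewrite /cat_mul.
rewrite (@eq_malg_ext _ _ _ _ (fun f => c *: malg_ext (cat_basis_mul f) u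
   + malg_ext (cat_basis_mul f) v)); last by move=> f; rewrite linearP.
rewrite /malg_ext scaler_sumr -big_split; apply: eq_bigr => f _ /=.
by rewrite scalerDr !scalerA mulrC.
Qed.

Lemma cat_mul_basis f g :
  cat_mul (cat_basis f) (cat_basis g) = cat_basis_mul f g.
Proof. by rewrite /cat_mul !malg_extU !scale1r. Qed.

Lemma cat_alg_ind (P : cat_alg -> Prop) :
    P 0 -> (forall c u v, P u -> P v -> P (c *: u + v)) ->
    (forall f, P (cat_basis f)) -> forall u, P u.
Proof.
move=> P0 PD Pb u; rewrite (monalgE (u : {malg k[cat_hom C]})).
apply: big_ind => [//|x y Px Py|f _].
  by rewrite -[x]scale1r; apply: PD.
by rewrite malgZU -[_ *: _]addr0; apply: PD => //; apply: Pb.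
Qed.

Lemma cat_mul0l u : cat_mul 0 u = 0.
Proof. by have := cat_mulZDl u (-1) 0 0; rewrite scaler0 addr0 scaleN1r addNr. Qed.

Lemma cat_mul0r u : cat_mul u 0 = 0.
Proof. by have := cat_mulZDr u (-1) 0 0; rewrite scaler0 addr0 scaleN1r addNr. Qed.

Lemma cat_mulA : associative cat_mul.
Proof.
elim/cat_alg_ind=> [v w|c u u' IH IH' v w|f]; first by rewrite !cat_mul0l.
  by rewrite !cat_mulZDl IH IH'.
elim/cat_alg_ind=> [w|c u u' IH IH' w|g]; first by rewrite !(cat_mul0l, cat_mul0r).
  by rewrite !(cat_mulZDl, cat_mulZDr) IH IH'.
elim/cat_alg_ind=> [|c u u' IH IH'|h]; first by rewrite !cat_mul0r.
  by rewrite !cat_mulZDr IH IH'.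
rewrite !cat_mul_basis /cat_basis_mul.
case: eqP => gh; case: eqP => fg; rewrite ?(cat_mul0l, cat_mul0r)//.
- rewrite !cat_mul_basis /cat_basis_mul cat_tgt_comp// cat_src_comp// fg gh.
  by rewrite !eqxx cat_compA.
- by rewrite cat_mul_basis /cat_basis_mul cat_tgt_comp//; case: eqP.
- by rewrite cat_mul_basis /cat_basis_mul cat_src_comp//; case: eqP.
Qed.

Lemma cat_mul_suml u I r (P : pred I) (F : I -> cat_alg) :
  cat_mul (\sum_(i <- r | P i) F i) u = \sum_(i <- r | P i) cat_mul (F i) u.
Proof.
apply: (big_morph (cat_mul^~ u)) => [x y|]; last exact: cat_mul0l.
by rewrite -[x]scale1r cat_mulZDl !scale1r.
Qed.

Lemma cat_mul_sumr u I r (P : pred I) (F : I -> cat_alg) :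
  cat_mul u (\sum_(i <- r | P i) F i) = \sum_(i <- r | P i) cat_mul u (F i).
Proof.
apply: (big_morph (cat_mul u)) => [x y|]; last exact: cat_mul0r.
by rewrite -[x]scale1r cat_mulZDr !scale1r.
Qed.

Lemma cat_mul1 : left_id cat_one cat_mul.
Proof.
elim/cat_alg_ind=> [|c u v IH IH'|f]; first exact: cat_mul0r.
  by rewrite cat_mulZDr IH IH'.
rewrite cat_mul_suml (bigD1 (cat_tgt f))//= big1 ?addr0 => [|x xf].
  by rewrite cat_mul_basis /cat_basis_mul cat_src_id eqxx cat_comp1f.
by rewrite cat_mul_basis /cat_basis_mul cat_src_id (negPf xf).
Qed.

Lemma cat_mulr1 : right_id cat_one cat_mul.
Proof.
elim/cat_alg_ind=> [|c u v IH IH'|f]; first exact: cat_mul0l.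
  by rewrite cat_mulZDl IH IH'.
rewrite cat_mul_sumr (bigD1 (cat_src f))//= big1 ?addr0 => [|x xf].
  by rewrite cat_mul_basis /cat_basis_mul cat_tgt_id eqxx cat_compf1.
by rewrite cat_mul_basis /cat_basis_mul cat_tgt_id eq_sym (negPf xf).
Qed.

Lemma cat_mulDl : left_distributive cat_mul +%R.
Proof. by move=> u v w; rewrite -[u]scale1r cat_mulZDl !scale1r. Qed.

Lemma cat_mulDr : right_distributive cat_mul +%R.
Proof. by move=> u v w; rewrite -[v]scale1r cat_mulZDr !scale1r. Qed.

HB.instance Definition _ := GRing.Zmodule_isPzRing.Build cat_alg
  cat_mulA cat_mul1 cat_mulr1 cat_mulDl cat_mulDr.

Lemma cat_scalerAl (c : k) (u v : cat_alg) : c *: (u * v) = (c *: u) * v.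
Proof.
by have := cat_mulZDl v c u 0; rewrite cat_mul0l !addr0 => H; exact: esym H.
Qed.

Lemma cat_scalerAr (c : k) (u v : cat_alg) : c *: (u * v) = u * (c *: v).
Proof.
by have := cat_mulZDr u c v 0; rewrite cat_mul0r !addr0 => H; exact: esym H.
Qed.

Lemma cat_mulPl (c : k) (u v w : cat_alg) :
  (c *: u + v) * w = c *: (u * w : cat_alg) + v * w.
Proof. exact: (cat_mulZDl w c u v). Qed.

Lemma cat_mulPr (c : k) (u v w : cat_alg) :
  w * (c *: u + v) = c *: (w * u : cat_alg) + w * v.
Proof. exact: (cat_mulZDr w c u v). Qed.

Definition cat_kcst (c : k) : cat_alg := c *: (1 : cat_alg).

Lemma cat_kcstB : zmod_morphism cat_kcst.
Proof. by move=> c d; rewrite /cat_kcst scalerBl. Qed.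

Lemma cat_kcstM : monoid_morphism cat_kcst.
Proof.
split=> [|c d]; first by rewrite /cat_kcst scale1r.
by rewrite /cat_kcst -cat_scalerAl mul1r scalerA.
Qed.

Lemma cat_kcstC c (u : cat_alg) : cat_kcst c * u = u * cat_kcst c.
Proof. by rewrite /cat_kcst -cat_scalerAl -cat_scalerAr mul1r mulr1. Qed.

HB.instance Definition _ :=
  PzRing_isPzAlgebra.Build k cat_alg cat_kcstB cat_kcstM cat_kcstC.

End CategoryAlgebra.

Record quiver := Quiver {
  qvertex : finType;
  qarrow : finType;
  qsrc : qarrow -> qvertex;
  qtgt : qarrow -> qvertex
}.

(* Paths are written from right to left: the pair (v, [:: a_n; ...; a_1])
   stands for the path a_n ... a_1 with terminus v, which traverses a_1 first;
   (v, [::]) is the trivial path at v. *)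
Section PathAlgebra.
Context (Q : quiver).

Fixpoint is_walk (v : qvertex Q) (s : seq (qarrow Q)) : bool :=
  if s is a :: s' then (qtgt a == v) && is_walk (qsrc a) s' else true.

Fixpoint walk_src (v : qvertex Q) (s : seq (qarrow Q)) : qvertex Q :=
  if s is a :: s' then walk_src (qsrc a) s' else v.

Definition qpath : Type := {p : qvertex Q * seq (qarrow Q) | is_walk p.1 p.2}.
HB.instance Definition _ := Choice.on qpath.
HB.instance Definition _ := SubType.on qpath.

Definition path_tgt (p : qpath) : qvertex Q := (val p).1.
Definition path_src (p : qpath) : qvertex Q := walk_src (val p).1 (val p).2.
Definition path_id (v : qvertex Q) : qpath := exist _ (v, [::]) isT.
Definition path_comp (p q : qpath) : qpath :=
  insubd p ((val p).1, (val p).2 ++ (val q).2).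

Lemma is_walk_cat v s t :
  is_walk v (s ++ t) = is_walk v s && is_walk (walk_src v s) t.
Proof. by elim: s v => //= a s IH v; rewrite IH andbA. Qed.

Lemma walk_src_cat v s t : walk_src v (s ++ t) = walk_src (walk_src v s) t.
Proof. by elim: s v => /=. Qed.

Lemma val_path_comp p q : path_src p = path_tgt q ->
  val (path_comp p q) = ((val p).1, (val p).2 ++ (val q).2).
Proof.
move=> pq; rewrite val_insubd/= is_walk_cat (valP p)/=.
by move: pq; rewrite /path_src => ->; rewrite (valP q).
Qed.

Lemma path_src_comp p q :
  path_src p = path_tgt q -> path_src (path_comp p q) = path_src q.
Proof.
move=> pq; rewrite {1}/path_src val_path_comp//= walk_src_cat.
by move: pq; rewrite /path_src => ->.
Qed.

Lemma path_tgt_comp p q :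
  path_src p = path_tgt q -> path_tgt (path_comp p q) = path_tgt p.
Proof. by move=> pq; rewrite {1}/path_tgt val_path_comp. Qed.

Lemma path_comp1p p : path_comp (path_id (path_tgt p)) p = p.
Proof. by case: p => -[v s] ws; apply: val_inj; rewrite val_path_comp. Qed.

Lemma path_compp1 p : path_comp p (path_id (path_src p)) = p.
Proof.
by case: p => -[v s] ws; apply: val_inj; rewrite val_path_comp//= cats0.
Qed.

Lemma path_compA p q r : path_src p = path_tgt q -> path_src q = path_tgt r ->
  path_comp p (path_comp q r) = path_comp (path_comp p q) r.
Proof.
move=> pq qr; apply: val_inj.
by rewrite !val_path_comp ?path_src_comp ?path_tgt_comp//= catA.
Qed.

Definition path_category : finObCategory :=
  @FinObCategory (qvertex Q) qpath path_src path_tgt path_id path_comp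
    (fun _ => erefl) (fun _ => erefl) path_src_comp path_tgt_comp
    path_comp1p path_compp1 path_compA.

Variable k : fieldType.

Definition path_algebra : pzAlgType k := cat_alg k path_category.

Lemma is_walk_arrow (a : qarrow Q) : is_walk (qtgt a) [:: a].
Proof. by rewrite /= eqxx. Qed.

Definition arrow_path (a : qarrow Q) : qpath :=
  exist _ (qtgt a, [:: a]) (is_walk_arrow a).

Definition arrow_elt (a : qarrow Q) : path_algebra :=
  @cat_basis k path_category (arrow_path a).

End PathAlgebra.

(* The tensor product of algebras A and B: the algebra of the multiplicative
   monoid A * B (with basis element (a, b) standing for the tensor of a and b)
   modulo the bilinearity relations. *)
Section Tensor.
Context (k : fieldType) (A B : pzAlgType k).

Lemma pair_monoid_compA (p q r : A * B) :
  (p.1 * (q.1 * r.1), p.2 * (q.2 * r.2)) = (p.1 * q.1 * r.1, p.2 * q.2 * r.2).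
Proof. by rewrite !mulrA. Qed.
Lemma pair_monoid_comp1p (p : A * B) : (1 * p.1, 1 * p.2) = p.
Proof. by rewrite !mul1r; case: p. Qed.
Lemma pair_monoid_compp1 (p : A * B) : (p.1 * 1, p.2 * 1) = p.
Proof. by rewrite !mulr1; case: p. Qed.

Definition pair_monoid : finObCategory :=
  @FinObCategory unit (A * B)%type (fun _ => tt) (fun _ => tt)
    (fun _ => (1, 1)) (fun p q => (p.1 * q.1, p.2 * q.2))
    (fun x => let: tt := x in erefl) (fun x => let: tt := x in erefl)
    (fun _ _ _ => erefl) (fun _ _ _ => erefl)
    pair_monoid_comp1p pair_monoid_compp1
    (fun p q r _ _ => pair_monoid_compA p q r).

Definition pure (a : A) (b : B) : cat_alg k pair_monoid :=
  @cat_basis k pair_monoid (a, b).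

Variant tensor_rel : cat_alg k pair_monoid -> Prop :=
| TensorDl a a' b : tensor_rel (pure (a + a') b - (pure a b + pure a' b))
| TensorDr a b b' : tensor_rel (pure a (b + b') - (pure a b + pure a b'))
| TensorZl c a b : tensor_rel (pure (kcst c * a) b - c *: pure a b)
| TensorZr c a b : tensor_rel (pure a (kcst c * b) - c *: pure a b).

Definition tensor_alg : pzAlgType k := quotient (gen_ideal tensor_rel).

End Tensor.

Section EnvelopingAlgebra.
Context (k : fieldType) (A : pzAlgType k).

Definition env_alg : pzAlgType k := tensor_alg A A^c.

(* A with its structure of k-module. *)
Definition scaled_alg : Type := A.
HB.instance Definition _ := GRing.Zmodule.on scaled_alg.

Let kscale (c : k) (x : scaled_alg) : scaled_alg := kcst c * (x : A).

Lemma kscaleA c d x : kscale c (kscale d x) = kscale (c * d) x.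
Proof. by rewrite /kscale mulrA -rmorphM. Qed.
Lemma kscale1 : left_id 1 kscale.
Proof. by move=> x; rewrite /kscale rmorph1 mul1r. Qed.
Lemma kscaleDr : right_distributive kscale +%R.
Proof. by move=> c x y; rewrite /kscale mulrDr. Qed.
Lemma kscaleDl x : {morph kscale^~ x : c d / c + d}.
Proof. by move=> c d; rewrite /kscale raddfD mulrDl. Qed.
HB.instance Definition _ :=
  GRing.Zmodule_isLmodule.Build k scaled_alg kscaleA kscale1 kscaleDr kscaleDl.

(* The element sum_i c_i (a_i, b_i) acts on A by x |-> sum_i c_i a_i x b_i. *)
Definition pre_act (w : cat_alg k (pair_monoid A A^c)) (x : A) : A :=
  malg_ext (fun p : A * A^c => (p.1 * x * (p.2 : A) : scaled_alg)) w.

Let pre_act_lin (x : A) : {linear {malg k[(A * A^c)%type]} -> scaled_alg} :=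
  malg_ext (fun p : A * A^c => (p.1 * x * (p.2 : A) : scaled_alg)).

Lemma pre_actD w w' x : pre_act (w + w') x = pre_act w x + pre_act w' x.
Proof. exact: (raddfD (pre_act_lin x)). Qed.
Lemma pre_actZ c w x : pre_act (c *: w) x = kcst c * pre_act w x.
Proof. exact: (linearZZ (pre_act_lin x)). Qed.
Lemma pre_act0 x : pre_act 0 x = 0.
Proof. exact: (raddf0 (pre_act_lin x)). Qed.
Lemma pre_actB w w' x : pre_act (w - w') x = pre_act w x - pre_act w' x.
Proof. exact: (raddfB (pre_act_lin x)). Qed.
Lemma pre_act_pure a b x : pre_act (pure a b) x = a * x * (b : A).
Proof. by rewrite /pre_act malg_extU scale1r. Qed.

Lemma pre_actDr w x y : pre_act w (x + y) = pre_act w x + pre_act w y.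
Proof.
elim/cat_alg_ind: w => [|c u v IH IH'|[a b]]; first by rewrite !pre_act0 addr0.
  by rewrite !pre_actD !pre_actZ IH IH' mulrDr addrACA.
by rewrite !pre_act_pure mulrDr mulrDl.
Qed.

Lemma pre_actZr w c x : pre_act w (kcst c * x) = kcst c * pre_act w x.
Proof.
elim/cat_alg_ind: w => [|d u v IH IH'|[a b]]; first by rewrite !pre_act0 mulr0.
  rewrite !pre_actD !pre_actZ IH IH' mulrDr; congr (_ + _).
  by rewrite !mulrA kcstC.
by rewrite !pre_act_pure !mulrA kcstC.
Qed.

Lemma pre_act0r w : pre_act w 0 = 0.
Proof. by apply: (addrI (pre_act w 0)); rewrite -pre_actDr !addr0. Qed.

Lemma pre_act1 x : pre_act 1 x = x.
Proof.
rewrite /GRing.one/= /cat_one (big_pred1 tt); last by case.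
by rewrite (pre_act_pure 1 1) mul1r mulr1.
Qed.

Lemma pre_actM w w' x : pre_act (w * w') x = pre_act w (pre_act w' x).
Proof.
elim/cat_alg_ind: w => [|c u v IH IH'|[a b]]; first by rewrite mul0r !pre_act0.
  rewrite cat_mulPl pre_actD pre_actZ [in RHS]pre_actD [in RHS]pre_actZ.
  by congr (_ * _ + _); [apply: IH | apply: IH'].
elim/cat_alg_ind: w' => [|c u v IH IH'|[a' b']].
- by rewrite mulr0 !pre_act0 pre_act0r.
- rewrite cat_mulPr pre_actD pre_actZ [in RHS]pre_actD [in RHS]pre_actZ.
  rewrite [in RHS]pre_actDr [in RHS]pre_actZr.
  by congr (_ * _ + _); [apply: IH | apply: IH'].
rewrite {1}/GRing.mul/= cat_mul_basis /cat_basis_mul eqxx.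
by rewrite (pre_act_pure (a * a') (b * b')) !pre_act_pure !mulrA.
Qed.

Let annihilates w := forall x, pre_act w x = 0.
Let ann0 : annihilates 0. Proof. exact: pre_act0. Qed.
Let annD w w' : annihilates w -> annihilates w' -> annihilates (w + w').
Proof. by move=> H H' x; rewrite pre_actD H H' addr0. Qed.
Let annMl u w : annihilates w -> annihilates (u * w).
Proof. by move=> H x; rewrite pre_actM H pre_act0r. Qed.
Let annMr u w : annihilates w -> annihilates (w * u).
Proof. by move=> H x; rewrite pre_actM H. Qed.

Lemma pre_act_rel w : gen_ideal (@tensor_rel k A A^c) w -> annihilates w.
Proof.
move=> /(_ (Ideal ann0 annD annMl annMr)); apply=> _ [a a' b|a b b'|c a b|c a b] x;
  rewrite /= pre_actB ?pre_actD ?pre_actZ !pre_act_pure.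
- by rewrite !mulrDl subrr.
- by rewrite mulrDr subrr.
- by rewrite !mulrA subrr.
- rewrite [X in _ * _ * X]/GRing.mul/= -(kcstC c (b : A)) !mulrA.
  by rewrite -[a * x * kcst c]kcstC !mulrA subrr.
Qed.

(* A with its structure of (left) A^e-module. *)
Definition regular_bimod : Type := A.
HB.instance Definition _ := GRing.Zmodule.on regular_bimod.

Definition bimod_act (u : env_alg) (x : regular_bimod) : regular_bimod :=
  pre_act (repr u)%qT x.

Lemma bimod_actE w x : bimod_act (quot_pi _ w) x = pre_act w x.
Proof.
apply/eqP; rewrite -subr_eq0 -pre_actB; apply/eqP/pre_act_rel.
by apply/quot_piP; rewrite quot_reprK.
Qed.

Lemma bimod_actA u v x : bimod_act u (bimod_act v x) = bimod_act (u * v) x.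
Proof.
elim/quot_piW: u => u; elim/quot_piW: v => v.
rewrite -(rmorphM (quot_pi _)) [RHS]bimod_actE [RHS]pre_actM.
by rewrite -(bimod_actE v) -bimod_actE.
Qed.
Lemma bimod_act1 : left_id 1 bimod_act.
Proof. by move=> x; rewrite -(rmorph1 (quot_pi _)) bimod_actE pre_act1. Qed.
Lemma bimod_actDr : right_distributive bimod_act +%R.
Proof. by move=> u x y; apply: pre_actDr. Qed.
Lemma bimod_actDl x : {morph bimod_act^~ x : u v / u + v}.
Proof.
move=> u v; elim/quot_piW: u => u; elim/quot_piW: v => v.
by rewrite -(raddfD (quot_pi _)) [LHS]bimod_actE pre_actD -!bimod_actE.
Qed.
HB.instance Definition _ := GRing.Zmodule_isLmodule.Build env_alg regular_bimod
  bimod_actA bimod_act1 bimod_actDr bimod_actDl.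

End EnvelopingAlgebra.

Section Projective.
Context (R : pzRingType).

Definition projective (P : lmodType R) : Prop :=
  forall (M N : lmodType R) (g : {linear M -> N}) (f : {linear P -> N}),
    (forall y, exists x, g x = y) ->
    exists h : {linear P -> M}, forall x, g (h x) = f x.

Definition factors_through_projective (U V : lmodType R) (f : U -> V) : Prop :=
  exists P : lmodType R, projective P /\
  exists (g : {linear U -> P}) (h : {linear P -> V}), forall x, f x = h (g x).

Definition mk_linear (U V : lmodType R) (f : U -> V) (Hf : linear f) :
  {linear U -> V} := HB.pack f (GRing.isLinear.Build R U V *:%R f Hf).

Lemma factors0 (U V : lmodType R) (f : U -> V) :
  (forall x, f x = 0) -> factors_through_projective f.
Proof.
move=> f0; exists 'rV[R]_0; split.
  move=> M N g h _.
  have l0 : linear (fun _ : 'rV[R]_0 => 0 : M).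
    by move=> c x y; rewrite scaler0 addr0.
  by exists (mk_linear l0) => x; rewrite raddf0 [x]thinmx0 raddf0.
have l0 : linear (fun _ : U => 0 : 'rV[R]_0).
  by move=> c x y; rewrite scaler0 addr0.
have l0' : linear (fun _ : 'rV[R]_0 => 0 : V).
  by move=> c x y; rewrite scaler0 addr0.
by exists (mk_linear l0), (mk_linear l0').
Qed.

Lemma factorsD (U V : lmodType R) (f f' : U -> V) :
  factors_through_projective f -> factors_through_projective f' ->
  factors_through_projective (fun x => f x + f' x).
Proof.
move=> [P [pP [g [h fE]]]] [P' [pP' [g' [h' fE']]]].
exists (P * P')%type; split.
  move=> M N s t surj_s.
  have l1 : linear (fun x : P => t (x, 0)).
    move=> c x y; rewrite -linearP; congr (t _).
    by apply: injective_projections => //=; rewrite scaler0 addr0.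
  have l2 : linear (fun x : P' => t (0, x)).
    move=> c x y; rewrite -linearP; congr (t _).
    by apply: injective_projections => //=; rewrite scaler0 addr0.
  have [u1 E1] := pP M N s (mk_linear l1) surj_s.
  have [u2 E2] := pP' M N s (mk_linear l2) surj_s.
  have l3 : linear (fun x : P * P' => u1 x.1 + u2 x.2).
    by move=> c x y /=; rewrite !linearP scalerDr addrACA.
  exists (mk_linear l3) => -[x y].
  transitivity (s (u1 x + u2 y)) => //; rewrite (raddfD s) /= E1 E2.
  transitivity (t (x, 0) + t (0, y)) => //; rewrite -(raddfD t).
  by congr (t _); apply: injective_projections; rewrite /= ?addr0 ?add0r.
have l1 : linear (fun x : U => (g x, g' x)).
  by move=> c x y; rewrite !linearP.
have l2 : linear (fun x : P * P' => h x.1 + h' x.2).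
  by move=> c x y /=; rewrite !linearP scalerDr addrACA.
by exists (mk_linear l1), (mk_linear l2) => x /=; rewrite fE fE'.
Qed.

Lemma factors_compl (U V W : lmodType R) (f : U -> V) (e : V -> W) :
  linear e -> factors_through_projective f ->
  factors_through_projective (fun x => e (f x)).
Proof.
move=> le [P [pP [g [h fE]]]]; exists P; split=> //.
have l1 : linear (fun x : P => e (h x)) by move=> c x y; rewrite linearP le.
by exists g, (mk_linear l1) => x /=; rewrite fE.
Qed.

End Projective.

Section Center.
Context (k : fieldType) (A : pzAlgType k).

Definition central : {pred A} := [pred z | `[< forall x, z * x = x * z >]].

Lemma centralP z : reflect (forall x, z * x = x * z) (z \in central).
Proof. exact: asboolP. Qed.

Lemma central_subring : subring_closed central.
Proof.
split=> [|x y /centralP Hx /centralP Hy|x y /centralP Hx /centralP Hy];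
  apply/centralP => z; first by rewrite mul1r mulr1.
  by rewrite mulrBl mulrBr Hx Hy.
by rewrite -mulrA Hy !mulrA Hx.
Qed.
HB.instance Definition _ := GRing.isSubringClosed.Build A central central_subring.

Definition center : Type := {z : A | z \in central}.
HB.instance Definition _ := SubChoice.on center.
HB.instance Definition _ :=
  GRing.SubChoice_isSubPzRing.Build A central center central_subring.

Lemma kcst_central (c : k) : (kcst c : A) \in central.
Proof. by apply/centralP; apply: kcstC. Qed.

Definition center_kcst (c : k) : center := exist _ (kcst c) (kcst_central c).

Lemma center_kcstB : zmod_morphism center_kcst.
Proof. by move=> c d; apply: val_inj; rewrite raddfB /= raddfB. Qed.
Lemma center_kcstM : monoid_morphism center_kcst.
Proof.
by split=> [|c d]; apply: val_inj; rewrite ?rmorph1 ?rmorphM /= ?rmorph1 ?rmorphM.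
Qed.
Lemma center_mulC : commutative (@GRing.mul center).
Proof.
by move=> x y; apply: val_inj; rewrite !rmorphM/=; apply/centralP/(valP x).
Qed.
HB.instance Definition _ := PzRing_isPzAlgebra.Build k center
  center_kcstB center_kcstM (fun c x => center_mulC (center_kcst c) x).

(* The A^e-endomorphism of A corresponding to z in Z(A). *)
Definition center_endo (z : center) : regular_bimod A -> regular_bimod A :=
  fun x => val z * (x : A).

Lemma center_endo_linear z : linear (center_endo z).
Proof.
move=> u x y; rewrite /center_endo mulrDr; congr (_ + _).
elim/quot_piW: u => w; rewrite /GRing.scale/= !bimod_actE.
elim/cat_alg_ind: w => [|c u v IH IH'|[a b]]; first by rewrite !pre_act0 mulr0.
  by rewrite !pre_actD !pre_actZ mulrDr IH' -IH !mulrA kcstC.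
by rewrite !pre_act_pure !mulrA; congr (_ * _ * _); apply/centralP/(valP z).
Qed.

Definition proj_center_pred (z : center) : Prop :=
  factors_through_projective (center_endo z).

Lemma proj_center0 : proj_center_pred 0.
Proof. by apply: factors0 => x; rewrite /center_endo mul0r. Qed.
Lemma proj_centerD z z' :
  proj_center_pred z -> proj_center_pred z' -> proj_center_pred (z + z').
Proof.
move=> H H'; have := factorsD H H'; congr factors_through_projective.
by apply/funext => x; rewrite /center_endo -mulrDl.
Qed.
Lemma proj_centerMl a z : proj_center_pred z -> proj_center_pred (a * z).
Proof.
move=> /(factors_compl (center_endo_linear a)).
by congr factors_through_projective; apply/funext => x; apply: mulrA.
Qed.
Lemma proj_centerMr a z : proj_center_pred z -> proj_center_pred (z * a).
Proof. by rewrite center_mulC; apply: proj_centerMl. Qed.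

Definition proj_center : ideal center :=
  Ideal proj_center0 proj_centerD proj_centerMl proj_centerMr.

Definition stable_center : pzAlgType k := quotient proj_center.

End Center.

Section Socle.
Context (k : fieldType) (B : pzAlgType k).

Definition left_ideal (L : B -> Prop) : Prop :=
  [/\ L 0, forall x y, L x -> L y -> L (x + y) & forall a x, L x -> L (a * x)].

Definition minimal_left_ideal (L : B -> Prop) : Prop :=
  [/\ left_ideal L, exists2 x, L x & x != 0 &
      forall N : B -> Prop, left_ideal N -> (forall x, N x -> L x) ->
        (forall x, N x -> x = 0) \/ (forall x, L x -> N x)].

(* The sum of the minimal left ideals, i.e. the smallest left ideal containing
   all of them. *)
Definition socle_pred (x : B) : Prop :=
  forall N : B -> Prop, left_ideal N ->
    (forall L, minimal_left_ideal L -> forall y, L y -> N y) -> N x.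

Lemma socle0 : socle_pred 0.
Proof. by move=> N []. Qed.
Lemma socleD x y : socle_pred x -> socle_pred y -> socle_pred (x + y).
Proof.
move=> Hx Hy N HN H; case: (HN) => _ ND _; apply: ND; first exact: Hx.
exact: Hy.
Qed.
Lemma socleMl a x : socle_pred x -> socle_pred (a * x).
Proof.
by move=> Hx N HN H; case: (HN) => _ _ NM; apply: NM; apply: Hx.
Qed.
Lemma socleMr a x : socle_pred x -> socle_pred (x * a).
Proof.
move=> Hx N HN HL; apply: (Hx (fun y => N (y * a))).
  case: HN => N0 ND NM; split=> [|y z|b y]; first by rewrite mul0r.
    by rewrite mulrDl; apply: ND.
  by rewrite -mulrA; apply: NM.
move=> L mL y Ly; have [[L0 LD LM] _ Lmin] := mL.
have lK : left_ideal (fun z => L z /\ z * a = 0).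
  split=> [|u v [Lu ua] [Lv va]|b u [Lu ua]]; first by rewrite mul0r.
    by rewrite mulrDl ua va addr0; split=> //; apply: LD.
  by rewrite -mulrA ua mulr0; split=> //; apply: LM.
have [K0|LK] := Lmin _ lK (fun z => @proj1 _ _); last first.
  by rewrite (LK y Ly).2; case: HN.
have [->|ya0] := eqVneq (y * a) 0; first by case: HN.
apply: (HL (fun z => exists2 u, L u & z = u * a)); last by exists y.
split.
- split=> [|_ _ [u Lu ->] [v Lv ->]|b _ [u Lu ->]].
  + by exists 0; rewrite ?mul0r.
  + by exists (u + v); rewrite ?mulrDl//; apply: LD.
  + by exists (b * u); rewrite ?mulrA//; apply: LM.
- by exists (y * a) => //; exists y.
move=> M [M0 MD MM] ML.
have lP : left_ideal (fun u => L u /\ M (u * a)).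
  split=> [|u v [Lu Mu] [Lv Mv]|b u [Lu Mu]]; first by rewrite mul0r.
    by rewrite mulrDl; split; [apply: LD | apply: MD].
  by rewrite -mulrA; split; [apply: LM | apply: MM].
have [P0|LP] := Lmin _ lP (fun z => @proj1 _ _); [left|right].
  by move=> z Mz; have [u Lu zE] := ML z Mz; rewrite zE (P0 u) ?mul0r -?zE.
by move=> _ [u Lu ->]; case: (LP u Lu).
Qed.

Definition socle : ideal B := Ideal socle0 socleD socleMl socleMr.

End Socle.

Record ribbonGraph := RibbonGraph {
  rg_vertex : finType;
  rg_half : finType;
  rg_root : rg_half -> rg_vertex;
  rg_iota : rg_half -> rg_half;
  rg_rho : {perm rg_half};
  rg_iotaK : involutive rg_iota;
  rg_iota_neq : forall h, rg_iota h != h;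
  rg_rho_cycles :
    porbits rg_rho = [set rg_root @^-1: [set v] | v : rg_vertex];
  rg_connected : forall v w,
    connect (fun v w => [exists h, (rg_root h == v) &&
                                   (rg_root (rg_iota h) == w)]) v w
}.

Record brauerGraph := BrauerGraph {
  bg_ribbon :> ribbonGraph;
  bg_mult : rg_vertex bg_ribbon -> nat;
  bg_mult_gt0 : forall v, (0 < bg_mult v)%N
}.

Section BrauerGraphAlgebra.
Context (G : brauerGraph).
Notation V := (rg_vertex G).
Notation H := (rg_half G).

Definition valency (v : V) : nat := #|[set h : H | rg_root h == v]|.
Definition truncated (v : V) : bool := (bg_mult v * valency v == 1)%N.
Definition multiplicity_free : Prop := forall v : V, bg_mult v = 1%N.

Definition is_edge (e : {set H}) : bool :=
  [exists h : H, e == [set h; rg_iota h]].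
Definition bg_edge : Type := {e : {set H} | is_edge e}.
HB.instance Definition _ := Finite.on bg_edge.

Lemma is_edge_of (h : H) : is_edge [set h; rg_iota h].
Proof. by apply/existsP; exists h. Qed.
Definition edge_of (h : H) : bg_edge := exist _ [set h; rg_iota h] (is_edge_of h).

(* The half-edge h stands for the arrow alpha_h. *)
Definition bg_arrow : Type := {h : H | ~~ truncated (rg_root h)}.
HB.instance Definition _ := Finite.on bg_arrow.

Definition bg_quiver : quiver :=
  @Quiver bg_edge bg_arrow
    (fun a => edge_of (sval a)) (fun a => edge_of (rg_rho G (sval a))).

Lemma rg_root_rhoV (h : H) : rg_root ((rg_rho G)^-1%g h) = rg_root h.
Proof.
have : porbit (rg_rho G) h \in porbits (rg_rho G) by apply: imset_f.
rewrite rg_rho_cycles => /imsetP[v _ hv].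
have rE g : g \in porbit (rg_rho G) h -> rg_root g = v.
  by rewrite hv !inE => /eqP.
rewrite !rE ?porbit_id//.
by rewrite -(porbitV (rg_rho G)); apply: (mem_porbit _ 1).
Qed.

Lemma bg_sigma_subproof (a : bg_arrow) :
  ~~ truncated (rg_root ((rg_rho G)^-1%g (sval a))).
Proof. by rewrite rg_root_rhoV; apply: (valP a). Qed.

Definition bg_sigma (a : bg_arrow) : bg_arrow :=
  exist _ ((rg_rho G)^-1%g (sval a)) (bg_sigma_subproof a).

Definition bg_amult (a : bg_arrow) : nat := bg_mult (rg_root (sval a)).

Variable k : fieldType.
Notation kQ := (path_algebra bg_quiver k).

Definition bg_elt (a : bg_arrow) : kQ := @arrow_elt bg_quiver k a.

(* [orbit bg_sigma a] lists a, sigma(a), ..., sigma^l(a) in this order, where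
   l + 1 is the size of the sigma-orbit of a. *)
Definition bg_cycle (a : bg_arrow) : kQ :=
  \prod_(b <- orbit bg_sigma a) bg_elt b.

Variant bg_rel : kQ -> Prop :=
| BgRelA (a b : bg_arrow) :
    qtgt (q := bg_quiver) a = qtgt (q := bg_quiver) b ->
    bg_rel (bg_cycle a ^+ bg_amult a - bg_cycle b ^+ bg_amult b)
| BgRelB (a : bg_arrow) :
    bg_rel (bg_elt a * bg_cycle (bg_sigma a) ^+ bg_amult a)
| BgRelC (a b : bg_arrow) :
    qsrc (q := bg_quiver) a = qtgt (q := bg_quiver) b -> b != bg_sigma a ->
    bg_rel (bg_elt a * bg_elt b).

Definition single_truncated_edge : bool :=
  [&& #|H| == 2, #|V| == 2 & [forall v, truncated v]].

Variant dual_number_rel : {poly k} -> Prop :=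
| DualNumberRel : dual_number_rel 'X^2.

Definition brauer_graph_algebra : pzAlgType k :=
  if single_truncated_edge
  then quotient (gen_ideal dual_number_rel)
  else quotient (gen_ideal bg_rel).

End BrauerGraphAlgebra.

From mathcomp Require Import mpoly.

(* monalg binds the same notation to a monoid algebra. *)
Notation "{ 'mpoly' T [ n ] }" := (mpoly n T) : type_scope.

HB.instance Definition _ (k : comNzRingType) (n : nat) :=
  PzRing_isPzAlgebra.Build k {mpoly k[n]}
    (raddfB (@mpolyC n k)) (conj (rmorph1 (@mpolyC n k)) (rmorphM (@mpolyC n k)))
    (fun c p => mulrC (@mpolyC n k c) p).

Section TruncatedPolynomials.
Context (k : fieldType) (n : nat) (m : 'I_n -> nat).

Variant fan_rel : {mpoly k[n]} -> Prop :=
| FanPow (i : 'I_n) : fan_rel ('X_i ^+ (m i - 1))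
| FanMul (i j : 'I_n) : i != j -> fan_rel ('X_i * 'X_j).

Definition fan_alg : pzAlgType k := quotient (gen_ideal fan_rel).

End TruncatedPolynomials.

(* Main.v *)
Require Import Defs.
From HB Require Import structures.
From mathcomp Require Import all_boot all_order all_algebra perm.
From mathcomp Require Import boolp zify mpoly.
Set Implicit Arguments.
Unset Strict Implicit.
Unset Printing Implicit Defensive.
Import Order.TTheory GRing.Theory Num.Theory.
Local Open Scope ring_scope.

(* Write N(h) = m(r h) val(r h) for a half-edge h.  The algebra A has a basis made
   of the idempotents of the edges, the paths of length 0 < l < N(h) following rho
   from h, and one socle element per edge; products are convolutions along the
   rho-orbits, and the sum t of the socle coordinates is a symmetrizing form.  For
   such an algebra with dual families (b_j), (b'_j), the projective center consists
   of the elements sum_j b_j d b'_j.  In the present case it lies in the socle, and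
   its elements have the socle coordinates D(v) + D(w) at an edge with ends v, w,
   where D(v) = m_v * (sum of c over the half-edges at v) for some function c on
   edges.  By positivity of m, in characteristic 0 every function of the form
   f(v) + f(w) is of this form, so that the projective center contains X_v^(m_v),
   where X_v is the sum of the cycles C_alpha around v.  The center is spanned by 1,
   the powers X_v^j with 0 < j < m_v, the socle, and closed paths of length N(h) - 1.
   Modulo the projective center, the elements X_v^(m_v - 1) (m_v > 1), the socle of A
   and these closed paths are killed by the radical, while the powers X_v^j with
   0 < j < m_v - 1 remain linearly independent after multiplication by the X_v;
   hence the stable center modulo its socle is generated by the X_v, subject to
   X_v^(m_v - 1) = 0 and X_v X_w = 0. *)

(** The relations only show that the listed elements span A; their independence is obtained dually.
    On the path algebra the coefficients of the paths following [rho] multiply by convolution. The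
    ideal of relations is exactly the set where all those of length below N vanish and the two
    full-length ones at the ends of each edge add up to 0. After that, every statement about A is a
    comparison of coordinates, uniform in loops, truncated vertices and the single edge. The price
    is that each edge is seen from both of its half-edges, whence the many factors 1/2.

    That the named classes are killed by the radical needs no explicit preimage d. If z is such an
    element and u is central without constant term, then zu lies in the socle, and its coordinate at
    an edge is the sum of two convolutions, one for each end. After symmetrization in z and u, each
    of them is constant around its vertex, so the coordinate has the form f(v) + f(w), which already
    places zu in the projective center. *)

Section Constants.
Variable k : fieldType.

Lemma kcst0 (B : pzAlgType k) : kcst 0 = 0 :> B.
Proof. exact: (raddf0 (@kcst k B)). Qed.

Lemma kcst1 (B : pzAlgType k) : kcst 1 = 1 :> B.
Proof. exact: (rmorph1 (@kcst k B)). Qed.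

Lemma kcstD (B : pzAlgType k) c d : kcst (c + d) = kcst c + kcst d :> B.
Proof. exact: (raddfD (@kcst k B)). Qed.

Lemma kcstM (B : pzAlgType k) c d : kcst (c * d) = kcst c * kcst d :> B.
Proof. exact: (rmorphM (@kcst k B)). Qed.

Lemma kcst_cat (C : finObCategory) c (u : cat_alg k C) : kcst c * u = c *: u.
Proof. by rewrite -cat_scalerAl mul1r. Qed.

End Constants.

(** * Half-edges *)

Section HalfEdges.
Variable G : brauerGraph.
Notation H := (rg_half G).
Notation iota_ := (@rg_iota G).
Notation rho := (rg_rho G).
Notation root := (@rg_root G).
Implicit Types g h : H.

Definition half_val h : nat := valency (root h).
Definition half_len h : nat := bg_mult (root h) * half_val h.

Lemma half_lenE h : half_len h = (bg_mult (root h) * half_val h)%N.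
Proof. by []. Qed.

Lemma eq_half_val g h : root g = root h -> half_val g = half_val h.
Proof. by rewrite /half_val => ->. Qed.

Lemma porbit_root h : porbit rho h = [set g | root g == root h].
Proof.
have : porbit rho h \in porbits rho by apply: imset_f.
rewrite rg_rho_cycles => /imsetP[v _ hv].
have : h \in porbit rho h by apply: porbit_id.
by rewrite hv !inE => /eqP <-; apply/setP => g; rewrite !inE.
Qed.

Lemma card_porbit_root h : #|porbit rho h| = half_val h.
Proof. by rewrite porbit_root. Qed.

Lemma root_iter l h : root (iter l rho h) = root h.
Proof.
have : iter l rho h \in porbit rho h by rewrite -permX mem_porbit.
by rewrite porbit_root inE => /eqP.
Qed.

Lemma root_rho h : root (rho h) = root h.
Proof. exact: (root_iter 1). Qed.

Lemma half_val_iter l h : half_val (iter l rho h) = half_val h.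
Proof. by rewrite /half_val root_iter. Qed.

Lemma half_len_iter l h : half_len (iter l rho h) = half_len h.
Proof. by rewrite /half_len /half_val root_iter. Qed.

Lemma half_val_gt0 h : (0 < half_val h)%N.
Proof. by rewrite -card_porbit_root; apply/card_gt0P; exists h; apply: porbit_id. Qed.

Lemma half_len_gt0 h : (0 < half_len h)%N.
Proof. by rewrite muln_gt0 bg_mult_gt0 half_val_gt0. Qed.

Lemma iter_mul_val j h : iter (j * half_val h) rho h = h.
Proof.
by elim: j => [//|j IH]; rewrite mulSn iterD IH -card_porbit_root iter_porbit.
Qed.

Lemma iter_val h : iter (half_val h) rho h = h.
Proof. by have := iter_mul_val 1 h; rewrite mul1n. Qed.

Lemma iter_len h : iter (half_len h) rho h = h.
Proof. exact: iter_mul_val. Qed.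

Lemma iter_rho_eq l h : (iter l rho h == h) = (half_val h %| l)%N.
Proof.
apply/eqP/idP => [|/dvdnP[j ->]]; last exact: iter_mul_val.
rewrite {1}(divn_eq l (half_val h)) addnC iterD iter_mul_val => e.
have ln : (l %% half_val h < half_val h)%N by rewrite ltn_mod half_val_gt0.
have := uniq_traject_porbit rho h; rewrite card_porbit_root => u.
have := nth_uniq h _ _ u; rewrite size_traject => /(_ 0%N (l %% half_val h)%N).
rewrite !nth_traject ?half_val_gt0 //= => /(_ isT ln).
by rewrite e eqxx eq_sym; apply: esym.
Qed.

Lemma iter_rho_inj_lt h i j : (i < half_val h)%N -> (j < half_val h)%N ->
  iter i rho h = iter j rho h -> i = j.
Proof.
move=> ih jh e; have u := uniq_traject_porbit rho h.
have := nth_uniq h _ _ u; rewrite size_traject card_porbit_root => /(_ i j ih jh).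
by rewrite !nth_traject// e eqxx => /esym/eqP.
Qed.

(** Every fibre of [root] is a [rho]-orbit, hence nonempty: a ribbon graph in this sense has no
    isolated vertices. *)
Lemma root_surj v : exists h, root h = v.
Proof.
have : root @^-1: [set v] \in porbits rho.
  by rewrite rg_rho_cycles; apply: imset_f.
case/imsetP=> h _ hv; exists h; apply/eqP.
by have := porbit_id rho h; rewrite -hv !inE.
Qed.

Lemma root_eqP g h : reflect (exists2 l, (l < half_val h)%N & g = iter l rho h)
                             (root g == root h).
Proof.
apply: (iffP eqP) => [e|[l _ ->]]; last exact: root_iter.
have : g \in porbit rho h by rewrite porbit_root inE e.
rewrite porbit_traject => /trajectP[l]; rewrite card_porbit_root.
by exists l.
Qed.

Lemma iota_inj : injective iota_.
Proof. exact: inv_inj (@rg_iotaK G). Qed.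

Lemma edge_of_iota h : edge_of (iota_ h) = edge_of h.
Proof. by apply: val_inj; rewrite /= rg_iotaK setUC. Qed.

Lemma edge_of_eq g h : (edge_of g == edge_of h) = (g == h) || (g == iota_ h).
Proof.
apply/idP/idP => [/eqP/(congr1 val)/= e|/orP[]/eqP->//]; last by rewrite edge_of_iota.
by have := set21 g (iota_ g); rewrite e !inE.
Qed.

(** Connectedness in the form used later: [iota] and [rho] together act transitively on half-edges.
    Each step of a walk is a rotation at a vertex followed by a passage to the other end of an
    edge. *)
Lemma half_const (T : eqType) (f : H -> T) :
  (forall h, f (iota_ h) = f h) -> (forall h, f (rho h) = f h) ->
  forall g h, f g = f h.
Proof.
move=> fi fr.
have fit l h : f (iter l rho h) = f h by elim: l => //= l <-.
have froot g h : root g = root h -> f g = f h.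
  by move/eqP/root_eqP => [l _ ->].
move=> g h; have := rg_connected (root h) (root g).
case/connectP => p; elim: p h => [|w p IH] h /= => [_ e|/andP[]].
  exact: froot.
case/existsP=> h' /andP[/eqP e1 /eqP e2] pw e.
rewrite -e2 in pw e; rewrite (IH (iota_ h') pw e) fi; exact: froot.
Qed.

Lemma truncated_len h : truncated (root h) = (half_len h == 1)%N.
Proof. by []. Qed.

(** Then [rho] fixes h and [iota h], so this pair is stable under both maps and is everything by
    [half_const]. Outside the single edge case, every edge therefore has an end that carries
    arrows. *)
Lemma both_truncated h :
  truncated (root h) -> truncated (root (iota_ h)) -> single_truncated_edge G.
Proof.
rewrite !truncated_len => th ti.
have val1 g : half_len g == 1%N -> half_val g = 1%N.
  by rewrite /half_len muln_eq1 => /andP[_ /eqP].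
have rho1 g : half_len g == 1%N -> rho g = g.
  by move/val1 => e; apply/eqP; rewrite (iter_rho_eq 1) e.
have H2 g : (g == h) || (g == iota_ h).
  have /= := @half_const _ (fun g => (g == h) || (g == iota_ h)) _ _ g h.
  rewrite eqxx; apply=> {}g.
    by rewrite (inv_eq (@rg_iotaK G)) (inj_eq iota_inj) orbC.
  apply/idP/idP => /orP[]/eqP e.
  - by rewrite -(rho1 h th) in e; rewrite (perm_inj e) eqxx.
  - by rewrite -(rho1 _ ti) in e; rewrite (perm_inj e) eqxx orbT.
  - by rewrite e (rho1 h th) eqxx.
  - by rewrite e (rho1 _ ti) eqxx orbT.
have HE : [set: H] = [set h; iota_ h] by apply/setP => g; rewrite !inE H2.
have cH : #|H| = 2 by rewrite -cardsT HE cards2 eq_sym rg_iota_neq.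
have rneq : root h != root (iota_ h).
  apply/eqP => e; have := rg_iota_neq h.
  have /eqP/root_eqP[l _ ->] := esym e; rewrite iter_rho_eq.
  by rewrite (val1 _ th) dvd1n.
apply/and3P; split; first by rewrite cH.
  rewrite -cardsT (_ : [set: _] = [set root h; root (iota_ h)]) ?cards2 ?rneq//.
  apply/setP => v; rewrite !inE; have [g <-] := root_surj v.
  by case/orP: (H2 g) => /eqP->; rewrite eqxx ?orbT.
by apply/forallP => v; have [g <-] := root_surj v; case/orP: (H2 g) => /eqP->.
Qed.

Lemma single_edge_half : single_truncated_edge G ->
  (forall g h, (g == h) || (g == iota_ h)) /\ (forall h, half_len h = 1%N).
Proof.
case/and3P=> /eqP cH _ /forallP tr; split=> [g h|h]; last exact/eqP/tr.
have : [set h; iota_ h] == setT.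
  by rewrite eqEcard subsetT cardsT cH cards2 eq_sym rg_iota_neq.
by move/eqP/setP/(_ g); rewrite !inE.
Qed.

End HalfEdges.
(* Otherwise unification may try to evaluate the cardinality defining a valency. *)
Global Opaque half_len half_val.

(** * Coordinates of Brauer graph algebras *)

Section PathCoordinates.
Variables (G : brauerGraph) (k : fieldType).
Notation H := (rg_half G).
Notation iota_ := (@rg_iota G).
Notation rho := (rg_rho G).
Notation root := (@rg_root G).
Notation Q := (bg_quiver G).
Notation kQ := (cat_alg k (path_category (bg_quiver G))).
Implicit Types (g h : H) (l j : nat) (x y : kQ).

(** The last half-edge comes first, in accordance with paths being written from right to left. *)
Fixpoint rho_run h l : seq H :=
  if l is l'.+1 then iter l' rho h :: rho_run h l' else [::].

Lemma size_rho_run h l : size (rho_run h l) = l.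
Proof. by elim: l => //= l ->. Qed.

Lemma rho_run_cat h a b :
  rho_run h (b + a) = rho_run (iter a rho h) b ++ rho_run h a.
Proof. by elim: b => //= b ->; rewrite iterD. Qed.

(** The terminus is tested separately because for l = 0 the list of arrows is empty; the trivial
    path of an edge thus runs along both of its half-edges. *)
Definition runs_along h l (p : qpath Q) : bool :=
  ((val p).1 == edge_of (iter l rho h)) &&
  ([seq sval a | a <- (val p).2] == rho_run h l).

Lemma walk_src_run h l (v : bg_edge G) (s : seq (bg_arrow G)) :
  v = edge_of (iter l rho h) -> [seq sval a | a <- s] = rho_run h l ->
  walk_src (Q := Q) v s = edge_of h.
Proof.
elim: s v l => [|a s IH] v [|l] //= _ [ea es].
by apply: (IH _ l) => //; rewrite ea.
Qed.

Definition run_coef h l x : k :=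
  malg_ext (fun p : qpath Q => (runs_along h l p)%:R : k^o) x.

Lemma run_coefP h l c x y :
  run_coef h l (c *: x + y) = c * run_coef h l x + run_coef h l y.
Proof. by rewrite /run_coef linearP. Qed.

Lemma run_coef0 h l : run_coef h l 0 = 0.
Proof. by have := run_coefP h l (-1) 0 0; rewrite scaler0 addr0 mulN1r addNr. Qed.

Lemma run_coefD h l x y : run_coef h l (x + y) = run_coef h l x + run_coef h l y.
Proof. by have := run_coefP h l 1 x y; rewrite scale1r mul1r. Qed.

Lemma run_coefB h l x y : run_coef h l (x - y) = run_coef h l x - run_coef h l y.
Proof.
by rewrite addrC -scaleN1r run_coefP mulN1r addrC.
Qed.

Lemma run_coefZ h l c x : run_coef h l (kcst c * x) = c * run_coef h l x.
Proof. by rewrite kcst_cat -[_ *: _]addr0 run_coefP run_coef0 addr0. Qed.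

Lemma run_coef_basis h l (p : qpath Q) :
  run_coef h l (@Defs.cat_basis k (path_category Q) p) = (runs_along h l p)%:R.
Proof. by rewrite /run_coef malg_extU scale1r. Qed.

(** A composite path follows [rho] from h exactly if both factors do, the left one starting where
    the right one stops; the index a is the length of the right factor. *)
Lemma run_coefM h l x y : run_coef h l (x * y) =
  \sum_(a < l.+1) run_coef (iter a rho h) (l - a) x * run_coef h a y.
Proof.
elim/cat_alg_ind: x => [|c u v IH IH'|p].
- by rewrite mul0r run_coef0 big1// => a _; rewrite run_coef0 mul0r.
- rewrite cat_mulPl [LHS]run_coefP.
  transitivity (c * (\sum_(a < l.+1) run_coef (iter a rho h) (l - a) u * run_coef h a y)
    + \sum_(a < l.+1) run_coef (iter a rho h) (l - a) v * run_coef h a y).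
    by congr (_ * _ + _); [apply: IH | apply: IH'].
  rewrite big_distrr -big_split; apply: eq_bigr => a _.
  by rewrite /= run_coefP mulrDl mulrA.
set p' := Defs.cat_basis k p.
elim/cat_alg_ind: y => [|c u v IH IH'|q].
- by rewrite mulr0 run_coef0 big1// => a _; rewrite run_coef0 mulr0.
- rewrite cat_mulPr [LHS]run_coefP.
  transitivity (c * (\sum_(a < l.+1) run_coef (iter a rho h) (l - a) p' * run_coef h a u)
    + \sum_(a < l.+1) run_coef (iter a rho h) (l - a) p' * run_coef h a v).
    by congr (_ * _ + _); [apply: IH | apply: IH'].
  rewrite big_distrr -big_split; apply: eq_bigr => a _.
  by rewrite /= run_coefP mulrDr mulrCA.
under eq_bigr do rewrite !run_coef_basis -natrM mulnb.
rewrite {1}/GRing.mul/= cat_mul_basis /cat_basis_mul.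
set n := size (val q).2.
have runq a : runs_along h a q -> a = n.
  by case/andP=> _ /eqP/(congr1 size); rewrite size_map size_rho_run.
have src a : (a <= l)%N -> runs_along (iter a rho h) (l - a) p ->
    runs_along h a q -> path_src p = path_tgt q.
  move=> al /andP[/eqP e1 /eqP e2] /andP[/eqP e3 _].
  by rewrite /path_src /path_tgt e3; apply: walk_src_run e2.
rewrite /=; case: eqP => [pq|npq]; last first.
  rewrite run_coef0 big1// => a _; case: (boolP (_ && _)) => // /andP[rp rq].
  by case: npq; apply: src rp rq; rewrite -ltnS.
rewrite run_coef_basis {1}/runs_along val_path_comp//= map_cat.
have [nl|ln] := leqP n l; last first.
  rewrite big1 => [|a _]; last first.
    case: (boolP (_ && _)) => // /andP[_ /runq e].
    by move: (ltn_ord a); rewrite e ltnS leqNgt ln.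
  case: (boolP (_ && _)) => // /andP[_ /eqP/(congr1 size)].
  rewrite size_cat !size_map size_rho_run => e; move: ln.
  by rewrite -e ltnNge leq_addl.
rewrite (bigD1 (Ordinal (nl : (n < l.+1)%N)))//= big1 ?addr0 => [|a an]; last first.
  case: (boolP (_ && _)) => // /andP[_ /runq e].
  by case/eqP: an; apply: val_inj.
congr (nat_of_bool _)%:R; rewrite {1}/runs_along -iterD subnK//.
rewrite -{2}(subnK nl) rho_run_cat.
have [e1|] := eqVneq (val p).1 _ => //=.
apply/idP/andP => [|[/eqP-> /andP[_ /eqP->]]//].
have [sp|sp] := eqVneq (size (val p).2) (l - n)%N; last first.
  move=> /eqP/(congr1 size); rewrite !size_cat !size_map !size_rho_run => e.
  by case/eqP: sp; rewrite -(addnK n (size _)) e addnK.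
rewrite eqseq_cat; last by rewrite size_map size_rho_run.
case/andP=> /eqP e2 e3; rewrite e2 eqxx /runs_along e3 andbT; split=> //.
change (path_tgt q == edge_of (iter n rho h)); rewrite -pq /path_src.
by apply/eqP; apply: walk_src_run e2; rewrite -iterD subnK.
Qed.

Lemma run_coef_id h l (v : qvertex Q) :
  run_coef h l (@Defs.cat_basis k (path_category Q) (path_id v)) =
  ((l == 0%N) && (v == edge_of h))%:R.
Proof.
rewrite run_coef_basis /runs_along /=; congr (nat_of_bool _)%:R.
by case: l => [|l] /=; rewrite ?andbT ?andbF.
Qed.

Lemma run_coef1 h l : run_coef h l 1 = (l == 0%N)%:R.
Proof.
transitivity (\sum_(v : qvertex Q)
    run_coef h l (@Defs.cat_basis k (path_category Q) (path_id v))).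
  exact: (big_morph _ (@run_coefD h l) (run_coef0 h l)).
rewrite (bigD1 (edge_of h))//= big1 => [|v vh]; rewrite run_coef_id.
  by rewrite eqxx andbT addr0.
by rewrite (negPf vh) andbF.
Qed.

Lemma run_coef_iota h x : run_coef (iota_ h) 0 x = run_coef h 0 x.
Proof.
elim/cat_alg_ind: x => [|c u v IH IH'|p]; first by rewrite !run_coef0.
  by rewrite !run_coefP IH IH'.
by rewrite !run_coef_basis /runs_along /= edge_of_iota.
Qed.

Lemma run_coef_elt h l (a : bg_arrow G) :
  run_coef h l (bg_elt k a) = ((l == 1%N) && (h == sval a))%:R.
Proof.
rewrite /bg_elt /arrow_elt run_coef_basis /runs_along /=.
congr (nat_of_bool _)%:R; case: l => [|[|l]] /=; rewrite ?andbF//; last first.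
  by apply/negP => /andP[_ /eqP].
apply/andP/eqP => [[_ /eqP[]] //|->]; by rewrite !eqxx.
Qed.

Lemma run_coef_eltM h l (a : bg_arrow G) x :
  run_coef h l (bg_elt k a * x) =
  if l is l'.+1 then (iter l' rho h == sval a)%:R * run_coef h l' x else 0.
Proof.
rewrite run_coefM; case: l => [|l].
  by rewrite big_ord1 run_coef_elt /= mul0r.
rewrite big_ord_recr /= subnn run_coef_elt /= mul0r addr0.
rewrite big_ord_recr /= subSnn run_coef_elt /= big1 ?add0r// => i _.
rewrite run_coef_elt; case: eqP => [|_]; last by rewrite mul0r.
move/eqP; rewrite -(eqn_add2r i) subnK; last exact: leqW (ltnW (ltn_ord i)).
by rewrite add1n eqSS eqn_leq [(l <= i)%N]leqNgt (ltn_ord i).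
Qed.

End PathCoordinates.

(** * The ideal of relations described by coefficients *)

Section IdealCoordinates.
Variables (G : brauerGraph) (k : fieldType).
Notation H := (rg_half G).
Notation iota_ := (@rg_iota G).
Notation rho := (rg_rho G).
Notation root := (@rg_root G).
Notation Q := (bg_quiver G).
Notation kQ := (cat_alg k (path_category (bg_quiver G))).
Notation elt := (bg_elt k).
Notation I := (gen_ideal (@bg_rel G k)).
Implicit Types (g h : H) (l j : nat) (x y : kQ) (a b : bg_arrow G).

(** The second condition reflects relation (a): the difference of the full cycles at the two ends of
    an edge has opposite coefficients there. At a truncated end there is no arrow, the coefficient
    is 0, and the condition concerns the other end alone. *)
Definition coef_vanish x : Prop :=
  (forall h l, (l < half_len h)%N -> run_coef h l x = 0) /\
  (forall h, run_coef h (half_len h) x +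
             run_coef (iota_ h) (half_len (iota_ h)) x = 0).

Lemma coef_vanish0 : coef_vanish 0.
Proof. by split=> *; rewrite ?run_coef0 ?addr0. Qed.

Lemma coef_vanishD x y : coef_vanish x -> coef_vanish y -> coef_vanish (x + y).
Proof.
move=> [x0 x1] [y0 y1]; split=> [h l lh|h]; rewrite !run_coefD.
  by rewrite x0 ?y0 ?addr0.
by rewrite addrACA x1 y1 addr0.
Qed.

(** At full length only the term with the idempotent coefficient of x survives, and that coefficient
    is the same at both ends of an edge. *)
Lemma coef_vanishMl x y : coef_vanish y -> coef_vanish (x * y).
Proof.
move=> [y0 y1]; split=> [h l lh|h]; rewrite !run_coefM.
  by rewrite big1// => a _; rewrite y0 ?mulr0// (leq_trans _ lh)// ltnS -ltnS.
have e g : \sum_(a < (half_len g).+1) run_coef (iter a rho g) (half_len g - a) x *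
    run_coef g a y = run_coef g 0 x * run_coef g (half_len g) y.
  by rewrite big_ord_recr /= subnn iter_len big1 ?add0r// => a _; rewrite y0 ?mulr0.
by rewrite !e (run_coef_iota h) -mulrDr y1 mulr0.
Qed.

Lemma coef_vanishMr x y : coef_vanish y -> coef_vanish (y * x).
Proof.
move=> [y0 y1]; split=> [h l lh|h]; rewrite !run_coefM.
  rewrite big1// => a _; rewrite y0 ?mul0r// half_len_iter.
  by rewrite (leq_ltn_trans (leq_subr _ _)).
have e g : \sum_(a < (half_len g).+1) run_coef (iter a rho g) (half_len g - a) y *
    run_coef g a x = run_coef g (half_len g) y * run_coef g 0 x.
  rewrite big_ord_recl subn0 big1 => [|a _]; first by rewrite /= addr0.
  rewrite y0 ?mul0r//.
  by rewrite half_len_iter lift0 ltn_subrL half_len_gt0.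
by rewrite !e (run_coef_iota h) -mulrDl y1 mul0r.
Qed.

Definition vanish_ideal : ideal (kQ : pzAlgType k) :=
  Ideal coef_vanish0 coef_vanishD coef_vanishMl coef_vanishMr.

Definition sigma_prod a j : kQ := \prod_(b <- traject (@bg_sigma G) a j) elt b.

Lemma sval_sigma a : rho (sval (bg_sigma a)) = sval a.
Proof. by rewrite /= permKV. Qed.

Lemma bg_sigma_inj : injective (@bg_sigma G).
Proof. by move=> a b e; apply: val_inj; rewrite /= -(sval_sigma a) -(sval_sigma b) e. Qed.

Lemma iter_sigma j a : iter j rho (sval (iter j (@bg_sigma G) a)) = sval a.
Proof. by elim: j => // j IH; rewrite iterSr iterS sval_sigma. Qed.

Lemma order_sigma a : order (@bg_sigma G) a = half_val (sval a).
Proof.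
apply/eqP; rewrite eqn_leq; apply/andP; split; last first.
  apply: dvdn_leq; first exact: order_gt0.
  rewrite -iter_rho_eq -{2}(iter_sigma (order (@bg_sigma G) a) a).
  by rewrite (iter_order bg_sigma_inj).
rewrite -size_orbit -(size_map val) -card_porbit_root cardE.
apply: uniq_leq_size; first by rewrite map_inj_uniq ?orbit_uniq //; exact: val_inj.
move=> _ /mapP[b /trajectP[i _ ->] ->]; rewrite mem_enum porbit_root inE.
by rewrite -(root_iter i) iter_sigma.
Qed.

Lemma sigma_prodD a i j :
  sigma_prod a (i + j) = sigma_prod a i * sigma_prod (iter i (@bg_sigma G) a) j.
Proof. by rewrite /sigma_prod trajectD big_cat. Qed.

Lemma sigma_prodS a j : sigma_prod a j.+1 = elt a * sigma_prod (bg_sigma a) j.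
Proof. by rewrite /sigma_prod /= big_cons. Qed.

Lemma bg_cycle_exp a : bg_cycle k a ^+ bg_amult a = sigma_prod a (half_len (sval a)).
Proof.
rewrite half_lenE -order_sigma -/(bg_amult a).
elim: (bg_amult a) => [|m IH]; first by rewrite mul0n /sigma_prod big_nil.
by rewrite exprS IH mulSn sigma_prodD (iter_order bg_sigma_inj).
Qed.

Lemma run_coef_sigma h l a j : run_coef h l (sigma_prod a j.+1) =
  ((l == j.+1) && (iter l rho h == rho (sval a)))%:R.
Proof.
elim: j a h l => [|j IH] a h l; rewrite sigma_prodS.
  rewrite /sigma_prod big_nil mulr1 run_coef_elt; case: l => [|[|l]] //=.
  by rewrite (inj_eq perm_inj).
rewrite run_coef_eltM; case: l => [//|l]; rewrite IH sval_sigma /= -natrM mulnb.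
by rewrite (inj_eq perm_inj) eqSS andbC -andbA andbb.
Qed.

(** In (a), both full cycles contribute 1 to the sum at the same edge. In (b), the path has length N
    + 1, beyond every tested coefficient. In (c), the path does not follow [rho] at all. *)
Lemma bg_rel_vanish x : bg_rel x -> coef_vanish x.
Proof.
have len a : half_len (sval a) = (half_len (sval a)).-1.+1.
  by rewrite prednK ?half_len_gt0.
case=> [a b ab|a|a b _ ab].
- split=> [h l lh|h]; rewrite !bg_cycle_exp.
    suff c0 c : run_coef h l (sigma_prod c (half_len (sval c))) = 0.
      by rewrite run_coefB !c0 subr0.
    rewrite (len c) run_coef_sigma; case: eqP => //= el.
    case: eqP => //= ec; move: lh; rewrite {1}el -len.
    by rewrite -(half_len_iter 1 (sval c)) /= -ec half_len_iter ltnn.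
  have c1 c g : run_coef g (half_len g) (sigma_prod c (half_len (sval c))) =
      (g == rho (sval c))%:R.
    rewrite (len c) run_coef_sigma -len iter_len; case: (g =P _) => [->|_].
      by rewrite (half_len_iter 1) eqxx.
    by rewrite andbF.
  have c2 c : run_coef h (half_len h) (sigma_prod c (half_len (sval c))) +
      run_coef (iota_ h) (half_len (iota_ h)) (sigma_prod c (half_len (sval c)))
      = (edge_of h == edge_of (rho (sval c)))%:R.
    rewrite !c1 edge_of_eq (inv_eq (@rg_iotaK G)); case: (h =P _) => [->|//].
      by rewrite eq_sym (negPf (rg_iota_neq _)) addr0.
    by rewrite add0r.
  rewrite !run_coefB addrACA -opprD !c2.
  by move: ab => /= ->; rewrite subrr.
- have e : elt a * bg_cycle k (bg_sigma a) ^+ bg_amult a =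
      sigma_prod a (half_len (sval a)).+1.
    rewrite sigma_prodS; congr (_ * _).
    have -> : bg_amult a = bg_amult (bg_sigma a).
      by rewrite /bg_amult -[in LHS]sval_sigma root_rho.
    rewrite bg_cycle_exp; congr sigma_prod.
    by rewrite -[in RHS]sval_sigma (half_len_iter 1).
  have z h l : (l <= half_len h)%N ->
      run_coef h l (sigma_prod a (half_len (sval a)).+1) = 0.
    rewrite run_coef_sigma; case: eqP => // el; case: eqP => // ec.
    rewrite {1}el -(half_len_iter 1 (sval a)) /= -ec half_len_iter.
    by rewrite ltnn.
  split=> [h l lh|h]; rewrite e !z ?addr0//; exact: ltnW.
- have z h l : run_coef h l (elt a * elt b) = 0.
    rewrite run_coef_eltM; case: l => // l; rewrite run_coef_elt -natrM mulnb.
    case: eqP => //= e1; case: eqP => //= e2; case: eqP => //= e3.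
    case/eqP: ab; apply: val_inj; apply: (@perm_inj _ rho).
    by rewrite e2 e3 in e1; rewrite sval_sigma -e1.
  by split=> *; rewrite !z ?addr0.
Qed.

Lemma gen_ideal_vanish x : I x -> coef_vanish x.
Proof. by move/(_ vanish_ideal); apply; apply: bg_rel_vanish. Qed.

(** The default 0 at truncated vertices makes [run_elt] total; paths of positive length there are
    0. *)
Definition half_elt h : kQ := if insub h is Some a then elt a else 0.

Fixpoint run_elt h l : kQ :=
  if l is l'.+1 then half_elt (iter l' rho h) * run_elt h l'
  else @Defs.cat_basis k (path_category Q) (path_id (edge_of h : qvertex Q)).

Lemma half_elt_sval a : half_elt (sval a) = elt a.
Proof. by rewrite /half_elt (valK a). Qed.

Lemma half_elt_trunc h : truncated (root h) -> half_elt h = 0.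
Proof. by move=> th; rewrite /half_elt insubN ?negbK. Qed.

Lemma run_elt_trunc h l : truncated (root h) -> (0 < l)%N -> run_elt h l = 0.
Proof. by case: l => //= l th _; rewrite half_elt_trunc ?mul0r ?root_iter. Qed.

Lemma run_coef_run_elt0 h g j :
  run_coef g j (run_elt h 0) = ((j == 0%N) && ((g == h) || (g == iota_ h)))%:R.
Proof. by rewrite run_coef_id -edge_of_eq; congr (nat_of_bool (_ && _))%:R; apply: eq_sym. Qed.

Lemma run_coef_run_elt h l g j : ~~ truncated (root h) -> (0 < l)%N ->
  run_coef g j (run_elt h l) = ((j == l) && (g == h))%:R.
Proof.
move=> th; case: l => // l _; elim: l g j => [|l IH] g j.
  rewrite /run_elt -/(run_elt h 0) /half_elt insubT run_coef_eltM.
  case: j => //= j; rewrite run_coef_run_elt0 -natrM mulnb eqSS.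
  by case: j => [|j] /=; rewrite ?andbF//; case: (g == h).
have -> : run_elt h l.+2 = half_elt (iter l.+1 rho h) * run_elt h l.+1 by [].
have th' : ~~ truncated (root (iter l.+1 rho h)) by rewrite root_iter.
rewrite /half_elt (insubT (fun h => ~~ truncated (root h)) th') run_coef_eltM.
case: j => // j; rewrite IH -natrM mulnb eqSS /=.
by have [->|] := eqVneq j l.+1; have [->|] := eqVneq g h; rewrite ?eqxx ?andbF.
Qed.

Lemma arrow_basis a (v : qvertex Q) (s : seq (bg_arrow G))
    (w : is_walk v (a :: s)) (w' : is_walk (qsrc (q := Q) a) s) :
  @Defs.cat_basis k (path_category Q) (exist _ (v, a :: s) w) =
  elt a * @Defs.cat_basis k (path_category Q) (exist _ (qsrc (q := Q) a, s) w').
Proof.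
rewrite /GRing.mul/= /bg_elt /arrow_elt cat_mul_basis /cat_basis_mul eqxx.
congr Defs.cat_basis; apply: val_inj; rewrite val_path_comp//=.
by case/andP: (w) => /eqP /= <-.
Qed.

Lemma basis_run h l (p : qpath Q) : runs_along h l p ->
  @Defs.cat_basis k (path_category Q) p = run_elt h l.
Proof.
elim: l p => [|l IH] [[v s] w] /andP[/= /eqP ev /eqP es].
  case: s w es => [w _|a s w es]; last by discriminate es.
  have -> : exist _ (v, [::]) w = path_id (edge_of h : qvertex Q).
    by apply: val_inj; rewrite /= ev.
  by [].
case: s w es => [w es|a s w [ea es]]; first by discriminate es.
have w' : is_walk (Q := Q) (qsrc (q := Q) a) s by case/andP: (w).
rewrite (arrow_basis w w') -ea half_elt_sval; congr (_ * _); apply: IH.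
by rewrite /runs_along /= es -ea !eqxx.
Qed.

Local Notation pi := (quot_pi I).

Lemma piM x y : pi (x * y) = pi x * pi y.
Proof. exact: (rmorphM (quot_pi I)). Qed.

Lemma piD x y : pi (x + y) = pi x + pi y.
Proof. exact: (raddfD (quot_pi I)). Qed.

Lemma pi_zero : pi 0 = 0.
Proof. exact: (raddf0 (quot_pi I)). Qed.

Lemma pi0 x : pi x = 0 <-> I x.
Proof. by rewrite -{2}[x]subr0 -quot_piP raddf0. Qed.

Lemma pi_relC a b : qsrc (q := Q) a = qtgt (q := Q) b -> b != bg_sigma a ->
  pi (elt a * elt b) = 0.
Proof. by move=> ab nb; apply/pi0 => J; apply; apply: BgRelC. Qed.

Lemma sigma_prod_run h j : ~~ truncated (root h) ->
  forall a, sval a = iter j rho h -> sigma_prod a j.+1 = run_elt h j.+1.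
Proof.
move=> th; elim: j => [|j IH] a ea; rewrite sigma_prodS.
  change (sval a = h) in ea.
  rewrite /sigma_prod big_nil mulr1 [RHS]/= -ea half_elt_sval.
  rewrite /GRing.mul /= /bg_elt /arrow_elt cat_mul_basis /cat_basis_mul /=.
  rewrite eqxx; congr Defs.cat_basis.
  by rewrite -[LHS](path_compp1 (arrow_path (Q := Q) a)).
rewrite [RHS]/= -iterS -ea half_elt_sval; congr (_ * _); apply: IH.
by apply: (@perm_inj _ rho); rewrite sval_sigma.
Qed.

Lemma run_elt_len h (th : ~~ truncated (root h)) :
  run_elt h (half_len h) = bg_cycle k (bg_sigma (Sub h th)) ^+ bg_amult (bg_sigma (Sub h th)).
Proof.
rewrite bg_cycle_exp; set a := bg_sigma _.
have ra : rho (sval a) = h by rewrite sval_sigma.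
rewrite -(half_len_iter 1 (sval a)) /= ra -(prednK (half_len_gt0 h)).
rewrite (@sigma_prod_run h)//; apply: (@perm_inj _ rho); rewrite ra -iterS.
by rewrite prednK ?half_len_gt0 ?iter_len.
Qed.

Lemma pi_run_len h : ~~ truncated (root h) -> ~~ truncated (root (iota_ h)) ->
  pi (run_elt h (half_len h)) = pi (run_elt (iota_ h) (half_len (iota_ h))).
Proof.
move=> th ti; apply/quot_piP; rewrite !run_elt_len => J; apply; apply: BgRelA.
by rewrite /qtgt /bg_quiver !sval_sigma /= edge_of_iota.
Qed.

(** Length N + 1 is relation (b), and longer runs contain such a path. *)
Lemma pi_run_big h l : (half_len h < l)%N -> pi (run_elt h l) = 0.
Proof.
have [th|th] := boolP (truncated (root h)).
  by move=> lh; rewrite run_elt_trunc ?raddf0// (leq_trans _ lh).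
elim: l => // l IH; rewrite ltnS leq_eqVlt => /orP[/eqP <-|/IH e]; last first.
  by rewrite [run_elt _ _]/= piM e mulr0.
rewrite [run_elt _ _]/= iter_len /half_elt (insubT (fun h => ~~ truncated (root h)) th).
rewrite run_elt_len; apply/pi0 => J; apply.
rewrite (_ : bg_amult (bg_sigma _) = bg_amult (Sub h th)); first exact: BgRelB.
by rewrite /bg_amult -(sval_sigma (Sub h th)) root_rho.
Qed.

(** A path that leaves the rotation [rho] contains two consecutive arrows whose product is a
    relation of type (c). *)
Lemma basis_dichotomy (p : qpath Q) :
  pi (@Defs.cat_basis k (path_category Q) p) = 0 \/
  exists h l, runs_along h l p.
Proof.
case: p => -[v s]; elim: s v => [|a s IH] v w.
  right; case: v w => e pe w; case/existsP: (pe) => h /eqP eh; exists h, 0%N.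
  by rewrite /runs_along /= andbT; apply/eqP/val_inj.
have /andP[/eqP va w'] : (qtgt (q := Q) a == v) && is_walk (Q := Q) (qsrc (q := Q) a) s by exact: w.
have [e|[h [l r]]] := IH _ w'.
  left; rewrite (arrow_basis w w').
  rewrite piM.
  transitivity (pi (elt a) * 0); [congr (_ * _)|]; [exact: e|exact: mulr0].
case: l r => [|l] /andP[/= /eqP e1].
  move=> /eqP; case: s w w' IH => // w w' IH _; right; exists (sval a), 1%N.
  by rewrite /runs_along /= -va !eqxx.
case: s w w' IH => // b s w w' IH; rewrite /= eqseq_cons => /andP[/eqP eb es].
have [bs|bs] := eqVneq b (bg_sigma a).
  right; exists h, l.+2; rewrite /runs_along /= !eqseq_cons es -eb bs.
  by rewrite -va sval_sigma !eqxx.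
left; case/andP: (w') => /eqP ab w''; rewrite (arrow_basis w w') (arrow_basis w' w'').
rewrite mulrA piM.
by rewrite pi_relC ?mul0r.
Qed.

Hypothesis char2 : (2%:R : k) != 0.

(** In a sum over half-edges the idempotent of each edge occurs twice. The full cycles at the two
    ends are different elements of the path algebra, so at this stage they keep weight 1. *)
Definition half_weight l : k := if l == 0%N then 2%:R^-1 else 1.

Lemma run_coef_trunc h l x : truncated (root h) -> (0 < l)%N -> run_coef h l x = 0.
Proof.
move=> th; case: l => // l _.
elim/cat_alg_ind: x => [|c u v IH IH'|p]; first exact: run_coef0.
  by rewrite run_coefP IH IH' mulr0 addr0.
rewrite run_coef_basis; case: (boolP (runs_along _ _ _)) => // /andP[_].
case: (val p).2 => //= a s; rewrite eqseq_cons => /andP[/eqP e _].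
by have := valP a; rewrite -[val a]/(sval a) e root_iter th.
Qed.

Lemma edge_indicator g h :
  ((g == h) || (g == iota_ h))%:R = (g == h)%:R + (g == iota_ h)%:R :> k.
Proof.
have [->|] := eqVneq g h; last by rewrite add0r.
by rewrite eq_sym (negPf (rg_iota_neq h)) addr0.
Qed.

Definition run_expansion x : quotient I := \sum_h \sum_(l < (half_len h).+1)
  kcst (half_weight l * run_coef h l x) * pi (run_elt h l).

Lemma run_elt_iota h : run_elt (iota_ h) 0 = run_elt h 0.
Proof. by rewrite /= edge_of_iota. Qed.

Lemma kcst_halves (B : pzAlgType k) (u : B) :
  kcst (2%:R^-1 * (true%:R + false%:R)) * u +
    (kcst (2%:R^-1 * (false%:R + true%:R)) * u + 0) = u.
Proof.
rewrite !addr0 add0r mulr1 -mulrDl -kcstD -mulr2n -(mulr_natr 2%:R^-1) mulVf//.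
by rewrite kcst1 mul1r.
Qed.

Lemma kcst_id (B : pzAlgType k) (u : B) : kcst (1 * true%:R) * u + 0 = u.
Proof. by rewrite addr0 mulr1 kcst1 mul1r. Qed.

Lemma weighted_sumP (B : pzAlgType k) c (f g : H -> nat -> k) (e : H -> nat -> B) :
  \sum_h \sum_(l < (half_len h).+1)
    kcst (half_weight l * (c * f h l + g h l)) * e h l =
  kcst c * (\sum_h \sum_(l < (half_len h).+1)
    kcst (half_weight l * f h l) * e h l) +
  \sum_h \sum_(l < (half_len h).+1) kcst (half_weight l * g h l) * e h l.
Proof.
rewrite mulr_sumr -big_split; apply: eq_bigr => h _.
rewrite mulr_sumr -big_split; apply: eq_bigr => l _ /=.
by rewrite mulrDr kcstD mulrDl mulrCA (kcstM _ c) mulrA.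
Qed.

Lemma run_expansion_run h l : run_expansion (run_elt h l) = pi (run_elt h l).
Proof.
case: l => [|l].
  transitivity (\sum_g kcst (2%:R^-1 * ((g == h)%:R + (g == iota_ h)%:R)) *
      pi (run_elt g 0)).
    apply: eq_bigr => g _; rewrite big_ord_recl big1 => [|i _].
      by rewrite addr0 run_coef_run_elt0 eqxx edge_indicator.
    by rewrite run_coef_run_elt0 mulr0 kcst0 mul0r.
  rewrite (bigD1 h)// (bigD1 (iota_ h)) ?rg_iota_neq// big1 => [|g /andP[gh gi]].
    rewrite run_elt_iota !eqxx (negPf (rg_iota_neq h)) eq_sym.
    by rewrite (negPf (rg_iota_neq h)); apply: kcst_halves.
  by rewrite (negPf gh) (negPf gi) addr0 mulr0 kcst0 mul0r.
have [th|th] := boolP (truncated (root h)).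
  rewrite run_elt_trunc// pi_zero /run_expansion big1// => g _.
  by rewrite big1// => j _; rewrite run_coef0 mulr0 kcst0 mul0r.
rewrite /run_expansion (bigD1 h)//= [X in _ + X]big1 => [|g gh]; last first.
  rewrite big1// => j _.
  by rewrite (@run_coef_run_elt h l.+1)// (negPf gh) andbF mulr0 kcst0 mul0r.
have [lh|hl] := ltnP l (half_len h); last first.
  rewrite -/(run_elt h l.+1) pi_run_big// big1 ?addr0// => j _.
  rewrite (@run_coef_run_elt h l.+1)//; case: eqP => [e|_].
    by move: (ltn_ord j); rewrite e ltnS ltnNge hl.
  by rewrite mulr0 kcst0 mul0r.
rewrite addr0 (bigD1 (Ordinal (lh : (l.+1 < (half_len h).+1)%N)))// big1 => [|j jl].
  rewrite (@run_coef_run_elt h l.+1)// !eqxx; exact: kcst_id.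
rewrite (@run_coef_run_elt h l.+1)//; case: eqP => [e|_].
  by case/eqP: jl; apply: val_inj.
by rewrite mulr0 kcst0 mul0r.
Qed.

Lemma pi_expand x : pi x = run_expansion x.
Proof.
elim/cat_alg_ind: x => [|c u v IH IH'|p].
- rewrite pi_zero /run_expansion big1// => h _; rewrite big1// => l _.
  by rewrite run_coef0 mulr0 kcst0 mul0r.
- transitivity (kcst c * run_expansion u + run_expansion v).
    by rewrite -IH -IH' -kcst_cat piD piM.
  apply: etrans (esym (weighted_sumP c (fun h l => run_coef h l u)
    (fun h l => run_coef h l v) (fun h l => pi (run_elt h l)))) _.
  apply: eq_bigr => h _; apply: eq_bigr => l _.
  by rewrite run_coefP.
have [[h [l r]]|np] := pselect (exists h l, runs_along h l p).
  by rewrite (basis_run r) run_expansion_run.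
have [e|//] := basis_dichotomy p.
rewrite [LHS]e /run_expansion big1// => h _; rewrite big1// => l _.
rewrite run_coef_basis (_ : runs_along h l p = false) ?mulr0 ?kcst0 ?mul0r//.
by apply/negP => r; apply: np; exists h, l.
Qed.

Lemma double_eq0 (B : pzAlgType k) (u : B) : u + u = 0 -> u = 0.
Proof.
move=> e; rewrite -[u]mul1r -kcst1 -(mulVf char2) kcstM -mulrA.
have -> : (2%:R : k) = 1 + 1 by rewrite -[1 + 1]/(2%:R).
by rewrite kcstD kcst1 mulrDl mul1r e mulr0.
Qed.

(** With [gen_ideal_vanish] this identifies the ideal as a zero set, which is the linear
    independence of the basis of A. After expansion only full cycles remain, and relation (a) lets
    them cancel in pairs. *)
Lemma vanish_gen_ideal x : coef_vanish x -> I x.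
Proof.
move=> [x0 x1]; apply/pi0; rewrite pi_expand.
pose T h := kcst (run_coef h (half_len h) x) * pi (run_elt h (half_len h)).
have -> : run_expansion x = \sum_h T h.
  apply: eq_bigr => h _; rewrite big_ord_recr big1 /= => [|l _]; last first.
    by rewrite x0 ?mulr0 ?kcst0 ?mul0r.
  by rewrite add0r /half_weight eqn0Ngt half_len_gt0 mul1r.
(* Adding the sum to its reindexing by [iota] brings the two ends of each edge together. *)
apply: double_eq0.
rewrite {2}(reindex_inj (@iota_inj G)) -big_split big1// => h _ /=.
rewrite /T; have [th|th] := boolP (truncated (root h)).
  have e := x1 h; rewrite run_coef_trunc ?half_len_gt0// add0r in e.
  by rewrite e run_coef_trunc ?half_len_gt0// !kcst0 !mul0r addr0.
have [ti|ti] := boolP (truncated (root (iota_ h))).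
  have e := x1 h; rewrite (run_coef_trunc _ ti) ?half_len_gt0// addr0 in e.
  by rewrite e run_coef_trunc ?half_len_gt0// !kcst0 !mul0r addr0.
by rewrite -pi_run_len// -mulrDl -kcstD x1 kcst0 mul0r.
Qed.

End IdealCoordinates.

(* For a half-edge h, [coord h l] is the coefficient of the path of length l that
   starts along h and follows rho, for l < N h := m (r h) * val (r h);
   [soc_coord h] is the coefficient of the socle element of the edge of h, namely
   of the common value of the paths of full length N at the two ends of that
   edge; [basis_elt h l] is the corresponding basis element, with l = 0 for the
   idempotent and l = N h for the socle element of the edge of h.  Truncated
   vertices need no special treatment: there N h = 1. *)
Record coordinates (G : brauerGraph) (k : fieldType) (A : pzAlgType k) :=
  Coordinates {
  coord : rg_half G -> nat -> A -> k;
  soc_coord : rg_half G -> A -> k;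
  basis_elt : rg_half G -> nat -> A;
  coordD : forall h l x y, coord h l (x + y) = coord h l x + coord h l y;
  coordZ : forall h l c x, coord h l (kcst c * x) = c * coord h l x;
  soc_coordD : forall h x y, soc_coord h (x + y) = soc_coord h x + soc_coord h y;
  soc_coordZ : forall h c x, soc_coord h (kcst c * x) = c * soc_coord h x;
  coord_big : forall h l x, (half_len h <= l)%N -> coord h l x = 0;
  coord1 : forall h l, coord h l 1 = (l == 0%N)%:R;
  coord_iota : forall h x, coord (rg_iota h) 0 x = coord h 0 x;
  soc_coord_iota : forall h x, soc_coord (rg_iota h) x = soc_coord h x;
  coordM : forall h l x y, (l < half_len h)%N -> coord h l (x * y) =
    \sum_(a < l.+1) coord (iter a (rg_rho G) h) (l - a) x * coord h a y;
  soc_coordM : forall h x y, soc_coord h (x * y) =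
    \sum_(a < (half_len h).+1)
      coord (iter a (rg_rho G) h) (half_len h - a) x * coord h a y +
    \sum_(a < (half_len (rg_iota h)).+1)
      coord (iter a (rg_rho G) (rg_iota h)) (half_len (rg_iota h) - a) x *
      coord (rg_iota h) a y +
    (coord h 0 x * soc_coord h y + soc_coord h x * coord h 0 y);
  coord_inj : forall x, (forall h l, coord h l x = 0) ->
    (forall h, soc_coord h x = 0) -> x = 0;
  coord_basis : forall h l g j, (l <= half_len h)%N -> coord g j (basis_elt h l) =
    (if l == 0%N then (j == 0%N) && ((g == h) || (g == rg_iota h))
     else (l != half_len h) && ((j == l) && (g == h)))%:R;
  soc_coord_basis : forall h l g, (l <= half_len h)%N ->
    soc_coord g (basis_elt h l) =
    ((l == half_len h) && ((g == h) || (g == rg_iota h)))%:R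
}.

(** * Descent of coefficients to coordinates on a quotient *)

Section Lift.
Variables (G : brauerGraph) (k : fieldType) (K : pzAlgType k) (I : ideal K).
Notation H := (rg_half G).
Notation iota_ := (@rg_iota G).
Notation rho := (rg_rho G).
Variables (F : H -> nat -> K -> k) (P : H -> nat -> K).
Hypothesis FD : forall h l x y, F h l (x + y) = F h l x + F h l y.
Hypothesis FZ : forall h l c x, F h l (kcst c * x) = c * F h l x.
Hypothesis F1 : forall h l, F h l 1 = (l == 0%N)%:R.
Hypothesis F_iota : forall h x, F (iota_ h) 0 x = F h 0 x.
Hypothesis FM : forall h l x y, F h l (x * y) =
    \sum_(a < l.+1) F (iter a rho h) (l - a) x * F h a y.
Hypothesis FI : forall x, I x <->
  (forall h l, (l < half_len h)%N -> F h l x = 0) /\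
  (forall h, F h (half_len h) x + F (iota_ h) (half_len (iota_ h)) x = 0).
Hypothesis F_basis : forall h l g j, (l <= half_len h)%N -> (j < half_len g)%N ->
  F g j (P h l) =
    (if l == 0%N then (j == 0%N) && ((g == h) || (g == iota_ h))
     else (l != half_len h) && ((j == l) && (g == h)))%:R.
Hypothesis F_soc_basis : forall h l g, (l <= half_len h)%N ->
  F g (half_len g) (P h l) + F (iota_ g) (half_len (iota_ g)) (P h l) =
    ((l == half_len h) && ((g == h) || (g == iota_ h)))%:R.

Let FB h l x y : F h l (x - y) = F h l x - F h l y.
Proof. by rewrite FD -mulN1r -(rmorphN1 (@kcst k K)) FZ mulN1r. Qed.

(** Elements of I can have nonzero coefficients of length N, opposite at the two ends of an edge.
    Hence the quotient keeps the coefficients below N and, from length N, only the sum [sF], which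
    becomes the socle coordinate. *)
Let cF h l (u : quotient I) : k :=
  if (l < half_len h)%N then F h l (repr u)%qT else 0.
Let sF h (u : quotient I) : k :=
  F h (half_len h) (repr u)%qT + F (iota_ h) (half_len (iota_ h)) (repr u)%qT.

Let reprI x : I ((repr (quot_pi I x))%qT - x).
Proof. by apply/quot_piP; rewrite quot_reprK. Qed.

Let cFE h l x : cF h l (quot_pi I x) = if (l < half_len h)%N then F h l x else 0.
Proof.
rewrite /cF; case: ifP => // lh; have /FI[e _] := reprI x.
by apply/eqP; rewrite -subr_eq0 -FB e.
Qed.

Let sFE h x : sF h (quot_pi I x) =
  F h (half_len h) x + F (iota_ h) (half_len (iota_ h)) x.
Proof.
rewrite /sF; have /FI[_ e] := reprI x.
by apply/eqP; rewrite -subr_eq0 opprD addrACA -!FB e.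
Qed.

Let sum_ends n (f : nat -> k) : (0 < n)%N ->
  \sum_(a < n.+1) f a = f 0%N + \sum_(a < n.-1) f a.+1 + f n.
Proof.
by case: n => // n _; rewrite big_ord_recl big_ord_recr /= addrA.
Qed.

(** The extreme terms a = 0 and a = N involve full-length coefficients, which [cF] replaces by 0;
    they are added back separately and make up the idempotent-times-socle part of [soc_coordM]. *)
Let convE h (x y : K) : \sum_(a < (half_len h).+1)
   cF (iter a rho h) (half_len h - a) (quot_pi I x) * cF h a (quot_pi I y)
  + (F h 0 x * F h (half_len h) y + F h (half_len h) x * F h 0 y) =
  F h (half_len h) (x * y).
Proof.
rewrite FM (sum_ends (fun a => cF (iter a rho h) (half_len h - a) (quot_pi I x) *
  cF h a (quot_pi I y))) ?half_len_gt0//.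
rewrite (sum_ends (fun a => F (iter a rho h) (half_len h - a) x * F h a y)) ?half_len_gt0//.
rewrite !subn0 !subnn iter_len !cFE /= ltnn mul0r add0r half_len_gt0 mulr0 addr0.
rewrite addrC -addrA [X in _ + X]addrC addrA addrC.
rewrite addrA [X in _ = X]addrAC; congr (_ + _ + _); apply: eq_bigr => a _.
have an : (a.+1 < half_len h)%N by have := ltn_ord a; rewrite -ltnS prednK ?half_len_gt0.
by rewrite !cFE -iterS half_len_iter an ltn_subrL half_len_gt0.
Qed.

Let quotD (x y : K) : quot_pi I x + quot_pi I y = quot_pi I (x + y).
Proof. exact: esym (raddfD (quot_pi I) x y). Qed.
Let quotM (x y : K) : quot_pi I x * quot_pi I y = quot_pi I (x * y).
Proof. exact: esym (rmorphM (quot_pi I) x y). Qed.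
Let quotZ c (x : K) : kcst c * quot_pi I x = quot_pi I (kcst c * x).
Proof. exact: esym (rmorphM (quot_pi I) (kcst c) x). Qed.

Definition lift_coordinates : coordinates G (quotient I).
Proof.
exists cF sF (fun h l => quot_pi I (P h l)).
- move=> h l; elim/quot_piW => x; elim/quot_piW => y; rewrite quotD !cFE FD.
  by case: ifP; rewrite ?addr0.
- move=> h l c; elim/quot_piW => x; rewrite quotZ !cFE FZ.
  by case: ifP; rewrite ?mulr0.
- move=> h; elim/quot_piW => x; elim/quot_piW => y; rewrite quotD !sFE !FD.
  by rewrite addrACA.
- by move=> h c; elim/quot_piW => x; rewrite quotZ !sFE !FZ mulrDr.
- by move=> h l x lh; rewrite /cF ltnNge lh.
- move=> h l; rewrite (cFE h l 1) F1; case: ifP => // /negbT.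
  by case: l => //; rewrite half_len_gt0.
- by move=> h; elim/quot_piW => x; rewrite !cFE !half_len_gt0 F_iota.
- by move=> h; elim/quot_piW => x; rewrite !sFE rg_iotaK addrC.
- move=> h l; elim/quot_piW => x; elim/quot_piW => y lh; rewrite quotM cFE lh FM.
  apply: eq_bigr => a _; rewrite !cFE half_len_iter.
  by rewrite (leq_ltn_trans (leq_subr _ _) lh) (leq_ltn_trans _ lh) // -ltnS.
- move=> h; elim/quot_piW => x; elim/quot_piW => y; rewrite quotM sFE -!convE.
  rewrite addrACA; congr (_ + _); rewrite !cFE !sFE !half_len_gt0.
  by rewrite !F_iota mulrDr mulrDl addrACA.
- elim/quot_piW => x e1 e2; rewrite -[0](raddf0 (quot_pi I)); apply/quot_piP.
  rewrite subr0; apply/FI; split=> [h l lh|h]; last by rewrite -sFE e2.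
  by have := e1 h l; rewrite cFE lh.
- move=> h l g j lh; rewrite cFE; case: ltnP => jg; first exact: F_basis.
  case: l lh => [|l] lh /=.
    by case: j jg => //=; rewrite leqNgt half_len_gt0.
  case: (l.+1 =P half_len h) => //= /eqP nl; case: eqP => //= jl.
  by case: eqP => // gh; move: nl; rewrite eqn_leq lh -jl -gh jg.
- by move=> h l g lh; rewrite sFE F_soc_basis.
Defined.

End Lift.

Section Instances.
Variables (G : brauerGraph) (k : fieldType).
Hypothesis char2 : (2%:R : k) != 0.
Notation H := (rg_half G).
Notation iota_ := (@rg_iota G).
Notation rho := (rg_rho G).
Notation root := (@rg_root G).
Notation kQ := (cat_alg k (path_category (bg_quiver G))).

(** A truncated end has no full cycle, so the socle element of its edge is taken at the other
    end. *)
Definition run_basis (h : H) l : kQ :=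
  if (l < half_len h)%N then run_elt k h l
  else if truncated (root h) then run_elt k (iota_ h) (half_len (iota_ h))
  else run_elt k h (half_len h).

Lemma coordinates_general : ~~ single_truncated_edge G ->
  coordinates G (quotient (gen_ideal (@bg_rel G k))).
Proof.
move=> ns; have nt (h : H) : (1 < half_len h)%N -> ~~ truncated (root h).
  by rewrite truncated_len; case: (half_len h) => [|[]].
(* The socle element is the full cycle at an end that carries arrows; such an end exists by
   [both_truncated]. *)
have top (h : H) : exists2 h', (h' == h) || (h' == iota_ h) &
    ~~ truncated (root h') /\ run_basis h (half_len h) = run_elt k h' (half_len h').
  rewrite /run_basis ltnn; case: ifP => th; last first.
    by exists h; rewrite ?eqxx ?th.
  exists (iota_ h); rewrite ?eqxx ?orbT//; split=> //.
  by apply: contra ns; apply: both_truncated.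
apply: (@lift_coordinates _ _ _ _ (@run_coef G k) run_basis).
- exact: run_coefD.
- exact: run_coefZ.
- exact: run_coef1.
- exact: run_coef_iota.
- exact: run_coefM.
- by move=> x; split=> [/gen_ideal_vanish|]; [case|apply: vanish_gen_ideal].
- move=> h l g j; rewrite leq_eqVlt => /orP[/eqP ->|lh] jg.
    have [h' hh [th ->]] := top h.
    rewrite eqn0Ngt half_len_gt0 eqxx /= run_coef_run_elt ?half_len_gt0//.
    by case: eqP => //= e; case: eqP => // gh; move: jg; rewrite e gh ltnn.
  rewrite /run_basis lh; case: l lh => [|l] lh; first by rewrite run_coef_run_elt0.
  rewrite run_coef_run_elt ?nt//; last exact: leq_trans lh.
  by rewrite (ltn_eqF lh).
- move=> h l g; rewrite leq_eqVlt => /orP[/eqP ->|lh].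
    have [h' hh [th ->]] := top h.
    rewrite !run_coef_run_elt ?half_len_gt0// eqxx /=.
    have e g' : (half_len g' == half_len h') && (g' == h') = (g' == h').
      by case: eqP => // -; rewrite ?andbF//; case: eqP => // ->.
    rewrite !e (inv_eq (@rg_iotaK G)) -edge_indicator//.
    congr (nat_of_bool _)%:R; rewrite -!edge_of_eq; case/orP: hh => /eqP->//.
    by rewrite edge_of_iota.
  rewrite (ltn_eqF lh) /= /run_basis lh; case: l lh => [|l] lh.
    by rewrite !run_coef_run_elt0 !eqn0Ngt !half_len_gt0 addr0.
  rewrite !run_coef_run_elt ?nt//; try exact: leq_trans lh.
  suff e g' : (half_len g' == l.+1) && (g' == h) = false by rewrite !e addr0.
  apply/negP => /andP[/eqP e /eqP gh].
  by move: lh; rewrite -e gh ltnn.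
Qed.


Definition low_vanish (p : {poly k}) : Prop := p`_0 = 0 /\ p`_1 = 0.

Lemma low_vanish0 : low_vanish 0.
Proof. by rewrite /low_vanish !coef0. Qed.

Lemma low_vanishD p q : low_vanish p -> low_vanish q -> low_vanish (p + q).
Proof. by move=> [p0 p1] [q0 q1]; rewrite /low_vanish !coefD p0 p1 q0 q1 addr0. Qed.

Lemma low_vanishMr p q : low_vanish q -> low_vanish (q * p).
Proof.
move=> [q0 q1]; rewrite /low_vanish !coefM big_ord1 !big_ord_recl big_ord0 /=.
by rewrite q0 q1 !mul0r !addr0.
Qed.

Lemma low_vanishMl p q : low_vanish q -> low_vanish (p * q).
Proof. by rewrite mulrC; apply: low_vanishMr. Qed.

Lemma gen_ideal_dualP (p : {poly k}) :
  gen_ideal (@dual_number_rel k) p <-> low_vanish p.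
Proof.
split=> [/(_ (Ideal low_vanish0 low_vanishD low_vanishMl low_vanishMr))|[p0 p1] J HJ].
  by apply=> _ []; rewrite /= /low_vanish !coefXn.
have -> : p = drop_poly 2 p * 'X^2.
  rewrite -[LHS](poly_take_drop 2) [take_poly 2 p](_ : _ = 0) ?add0r//.
  by apply/polyP => i; rewrite coef_take_poly coef0; case: i => [|[|i]].
by apply: (@idealMl _ _ J); apply: HJ.
Qed.

Lemma coordinates_single : single_truncated_edge G ->
  coordinates G (quotient (gen_ideal (@dual_number_rel k))).
Proof.
move=> se; have [H2 N1] := single_edge_half se.
(* Both half-edges read the same coefficient of X, so the socle coordinate of p is twice that
   coefficient, and the basis element with coordinate 1 is X/2. *)
apply: (@lift_coordinates _ _ _ _ (fun _ l (p : {poly k}) => p`_l)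
  (fun _ l => if l == 0%N then 1 else (2%:R^-1 : k) *: 'X)).
- by move=> h l x y; rewrite coefD.
- by move=> h l c x; rewrite coefCM.
- by move=> h l; rewrite coef1.
- by [].
- move=> h l x y; rewrite coefM (reindex_inj rev_ord_inj); apply: eq_bigr => a _ /=.
  by rewrite subSS subKn// -ltnS.
- move=> p; rewrite gen_ideal_dualP /low_vanish; split=> [[p0 p1]|[e1 e2]].
    split=> [h l|h]; first by rewrite N1 ltnS leqn0 => /eqP ->.
    by rewrite !N1 p1 addr0.
  have [h _] : exists h : H, h \in H.
    by apply/card_gt0P; case/and3P: se => /eqP ->.
  split; first by apply: (e1 h); rewrite N1.
  have := e2 h; rewrite !N1 -mulr2n -mulr_natr => /eqP.
  by rewrite mulf_eq0 (negPf char2) orbF => /eqP.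
- move=> h l g j; rewrite !N1 ltnS leqn0 => l1 /eqP ->.
  case: l l1 => [|[|]] //= _; first by rewrite coef1 H2.
  by rewrite coefZ coefX mulr0.
- move=> h l g; rewrite !N1; case: l => [|[|]] //= _.
    by rewrite coef1 addr0.
  rewrite coefZ coefX mulr1 H2 -mulr2n -(mulr_natr 2%:R^-1) mulVf//.
Qed.

Lemma brauer_coordinates : coordinates G (brauer_graph_algebra G k).
Proof.
rewrite /brauer_graph_algebra; case: (boolP (single_truncated_edge G)) => se.
  exact: coordinates_single.
exact: coordinates_general.
Qed.

End Instances.

(** * The projective center of a symmetric algebra *)

Section Casimir.
Variables (k : fieldType) (A E : pzAlgType k) (T : A -> A -> E).
Hypothesis TDl : forall a a' b, T (a + a') b = T a b + T a' b.
Hypothesis TDr : forall a b b', T a (b + b') = T a b + T a b'.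
Hypothesis TZl : forall c a b, T (kcst c * a) b = kcst c * T a b.
Hypothesis TZr : forall c a b, T a (kcst c * b) = kcst c * T a b.
Hypothesis TM : forall a b a' b', T a b * T a' b' = T (a * a') (b' * b).
Variables (t : A -> k) (J : finType) (b b' : J -> A).
Hypothesis expand_l : forall x, x = \sum_j kcst (t (b' j * x)) * b j.
Hypothesis expand_r : forall x, x = \sum_j kcst (t (x * b j)) * b' j.

Lemma tens_suml I r (P : pred I) (F : I -> A) y :
  T (\sum_(i <- r | P i) F i) y = \sum_(i <- r | P i) T (F i) y.
Proof.
apply: (big_morph (T^~ y)) => [u v|]; first exact: TDl.
by apply: (addrI (T 0 y)); rewrite -TDl !addr0.
Qed.

Lemma tens_sumr I r (P : pred I) (F : I -> A) x :
  T x (\sum_(i <- r | P i) F i) = \sum_(i <- r | P i) T x (F i).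
Proof.
apply: (big_morph (T x)) => [u v|]; first exact: TDr.
by apply: (addrI (T x 0)); rewrite -TDr !addr0.
Qed.

Definition casimir : E := \sum_j T (b j) (b' j).

(** Both sides are the sum of t(b'_i a b_j) b_i ⊗ b'_j: on the left a b_j is expanded in the family
    b, on the right b'_i a in the family b'. *)
Lemma casimirC a : T a 1 * casimir = T 1 a * casimir.
Proof.
rewrite /casimir !mulr_sumr.
transitivity (\sum_j \sum_i kcst (t (b' i * (a * b j))) * T (b i) (b' j)).
  apply: eq_bigr => j _; rewrite TM mulr1 {1}[a * b j]expand_l tens_suml.
  by apply: eq_bigr => i _; rewrite TZl.
rewrite exchange_big; apply: eq_bigr => i _ /=.
rewrite TM mul1r [b' i * a]expand_r tens_sumr.
by apply: eq_bigr => j _; rewrite TZr mulrA.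
Qed.

Hypothesis T_ind : forall P : E -> Prop, P 0 ->
  (forall c u v, P u -> P v -> P (kcst c * u + v)) ->
  (forall a b, P (T a b)) -> forall u, P u.
Variable act : E -> A -> A.
Hypothesis act0 : forall x, act 0 x = 0.
Hypothesis actP : forall c u v x, act (kcst c * u + v) x = kcst c * act u x + act v x.
Hypothesis actT : forall a b x, act (T a b) x = a * x * b.

(** So right multiplication of x ⊗ 1 by the Casimir element is a bimodule map from A to the
    enveloping algebra. Followed by the action on d, it is multiplication by the sum of the b_j d
    b'_j. *)
Lemma casimir_act u x : T (act u x) 1 * casimir = u * (T x 1 * casimir).
Proof.
elim/T_ind: u => [|c u v IHu IHv|a a'].
- have T0 : T 0 1 = 0 by apply: (addrI (T 0 1)); rewrite -TDl !addr0.
  by rewrite act0 T0 !mul0r.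
- by rewrite actP TDl TZl !mulrDl -!mulrA IHu IHv.
have e : T (a * x) a' = T (a * x) 1 * T 1 a' by rewrite TM !mulr1.
by rewrite actT mulrA TM mul1r e -(mulrA (T (a * x) 1)) -casimirC mulrA TM mul1r.
Qed.

Lemma casimir_linear u x y :
  T (act u x + y) 1 * casimir = u * (T x 1 * casimir) + T y 1 * casimir.
Proof. by rewrite TDl mulrDl casimir_act. Qed.

Lemma act_casimir x d : act (T x 1 * casimir) d = x * \sum_j b j * d * b' j.
Proof.
rewrite mulr_sumr /casimir mulr_sumr.
have actD u v y : act (u + v) y = act u y + act v y.
  by have := actP 1 u v y; rewrite !kcst1 !mul1r.
rewrite (big_morph (act^~ d) (fun u v => actD u v d) (act0 d)).
by apply: eq_bigr => j _; rewrite TM actT mulr1 !mulrA.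
Qed.

End Casimir.

(** * Endomorphisms of A that factor through a projective bimodule *)

Section Tensors.
Variables (k : fieldType) (A : pzAlgType k).
Notation Ae := (env_alg A).
Notation pi := (quot_pi (gen_ideal (@tensor_rel k A A^c))).

Definition tens (a b : A) : Ae := pi (pure a (b : A^c)).

Lemma tens_rel x y : tensor_rel (x - y) -> pi x = pi y.
Proof. by move=> r; apply/quot_piP => I; apply. Qed.

Lemma tensDl a a' b : tens (a + a') b = tens a b + tens a' b.
Proof.
apply: etrans (raddfD pi (pure a (b : A^c)) (pure a' (b : A^c))).
exact/tens_rel/TensorDl.
Qed.

Lemma tensDr a b b' : tens a (b + b') = tens a b + tens a b'.
Proof.
apply: etrans (raddfD pi (pure a (b : A^c)) (pure a (b' : A^c))).
exact/tens_rel/TensorDr.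
Qed.

Lemma tensZl c a b : tens (kcst c * a) b = kcst c * tens a b.
Proof.
apply: etrans (rmorphM pi (kcst c) (pure a (b : A^c))).
by rewrite kcst_cat; apply/tens_rel/TensorZl.
Qed.

Lemma tensZr c a b : tens a (kcst c * b) = kcst c * tens a b.
Proof.
apply: etrans (rmorphM pi (kcst c) (pure a (b : A^c))).
rewrite kcst_cat kcstC; apply/tens_rel.
exact: (TensorZr c a (b : A^c)).
Qed.

Lemma tensM a b a' b' : tens a b * tens a' b' = tens (a * a') (b' * b).
Proof.
apply: etrans (esym (rmorphM pi (pure a (b : A^c)) (pure a' (b' : A^c)))) _.
by rewrite {1}/GRing.mul/= cat_mul_basis /cat_basis_mul eqxx.
Qed.

Lemma tens_act a b (x : A) : (tens a b *: (x : regular_bimod A)) = a * x * b.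
Proof. by apply: etrans (bimod_actE _ _) _; apply: pre_act_pure. Qed.

Lemma tens_ind (P : Ae -> Prop) : P 0 ->
  (forall c u v, P u -> P v -> P (kcst c * u + v)) ->
  (forall a b, P (tens a b)) -> forall u, P u.
Proof.
move=> P0 PD Pt; elim/quot_piW; elim/cat_alg_ind=> [|c u v Pu Pv|[a b]].
- by rewrite (raddf0 pi).
- have -> : pi (c *: u + v) = kcst c * pi u + pi v.
    apply: etrans (raddfD pi _ _) _; congr (_ + _); rewrite -kcst_cat.
    exact: (rmorphM pi (kcst c) u).
  exact: PD.
- exact: Pt.
Qed.

Lemma tens1 : tens 1 1 = 1.
Proof.
congr (pi _); rewrite /GRing.one/= /cat_one (big_pred1 tt) //; by case.
Qed.

Lemma kcst_tens c : (kcst c : Ae) = tens (kcst c) 1.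
Proof.
have e : tens (kcst c) 1 = kcst c * tens 1 1.
  by apply: etrans (tensZl c 1 1); rewrite mulr1.
rewrite e tens1; exact: esym (mulr1 _).
Qed.

Lemma kcst_act c (x : A) : (kcst c : Ae) *: (x : regular_bimod A) = kcst c * x.
Proof. by rewrite kcst_tens tens_act mulr1. Qed.

Lemma projective_regular (R : pzRingType) : projective (R^o : lmodType R).
Proof.
move=> M N g f surj; have [m gm] := surj (f 1).
have l : linear (fun u : R^o => (u : R) *: m).
  by move=> c x y; rewrite scalerDl scalerA.
exists (mk_linear l) => x; rewrite /= linearZ /= gm -linearZ.
by congr (f _); apply: mulr1.
Qed.

Variables (t : A -> k) (J : finType) (bs bs' : J -> A).
Hypothesis expand_l : forall x, x = \sum_j kcst (t (bs' j * x)) * bs j.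
Hypothesis expand_r : forall x, x = \sum_j kcst (t (x * bs j)) * bs' j.

Lemma trace_proj_center (z : center A) d :
  val z = \sum_j bs j * d * bs' j -> proj_center_pred z.
Proof.
move=> zE; pose c : Ae := casimir tens bs bs'.
have cC a : tens a 1 * c = tens 1 a * c.
  exact: (casimirC tensDl tensDr tensZl tensZr tensM expand_l expand_r).
have act0 x : (0 : Ae) *: (x : regular_bimod A) = 0 by apply: scale0r.
have actP e (u v : Ae) (x : regular_bimod A) :
    (kcst e * u + v) *: x = kcst e * (u *: x : A) + (v *: x).
  apply: etrans (scalerDl _ _ _) _; congr (_ + _).
  apply: etrans (esym (scalerA _ _ _)) _; exact: kcst_act.
have linl : linear (fun x : regular_bimod A => (tens x 1 * c : Ae^o)).
  move=> u x y; exact: (casimir_linear tensDl tensDr tensZl tensZr tensM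
    expand_l expand_r tens_ind act0 actP tens_act).
have linr : linear (fun u : Ae^o => (u : Ae) *: (d : regular_bimod A)).
  move=> u x y; apply: etrans (scalerDl _ _ _) _; congr (_ + _).
  exact: esym (scalerA _ _ _).
exists (Ae^o : lmodType Ae); split; first exact: projective_regular.
exists (mk_linear linl), (mk_linear linr) => x.
apply: etrans (_ : x * \sum_j bs j * d * bs' j = _).
  rewrite -zE /center_endo; exact/centralP/(valP z).
apply: esym; exact: (act_casimir tensM bs bs' act0 actP tens_act x d).
Qed.

Hypothesis tD : forall x y, t (x + y) = t x + t y.
Hypothesis tZ : forall c x, t (kcst c * x) = c * t x.
Hypothesis tC : forall x y, t (x * y) = t (y * x).

(* The map a (x) b |-> t (b y) a.  On an element w with (a (x) 1) w = (1 (x) a) w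
   it is right multiplication of y by a fixed element, and this determines the
   product of the two tensor factors of w. *)
Definition contract y (w : cat_alg k (pair_monoid A A^c)) : A :=
  malg_ext (fun p : A * A^c => (kcst (t ((p.2 : A) * y)) * p.1 : scaled_alg A)) w.

Lemma contractP y c u v :
  contract y (c *: u + v) = kcst c * contract y u + contract y v.
Proof. by rewrite /contract linearP. Qed.

Lemma contract0 y : contract y 0 = 0.
Proof. by rewrite /contract linear0. Qed.

Lemma contract_pure y a b : contract y (pure a b) = kcst (t ((b : A) * y)) * a.
Proof. by rewrite /contract malg_extU scale1r. Qed.

Lemma contractD y u v : contract y (u + v) = contract y u + contract y v.
Proof. by have := contractP y 1 u v; rewrite scale1r kcst1 mul1r. Qed.

Lemma contractZ y c u : contract y (c *: u) = kcst c * contract y u.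
Proof. by have := contractP y c u 0; rewrite contract0 !addr0. Qed.

Lemma contractB y u v : contract y (u - v) = contract y u - contract y v.
Proof.
by rewrite contractD -scaleN1r contractZ (rmorphN1 (@kcst k A)) mulN1r.
Qed.

Lemma contract_pureM y a (b : A) w :
  contract y (pure a (b : A^c) * w) = a * contract (b * y) w.
Proof.
elim/cat_alg_ind: w => [|c u v IH IH'|[a' b']].
- by rewrite mulr0 !contract0 mulr0.
- rewrite cat_mulPr [LHS]contractP [in RHS]contractP.
  transitivity (kcst c * (a * contract (b * y) u) + a * contract (b * y) v).
    by congr (_ * _ + _); [apply: IH | apply: IH'].
  by rewrite mulrDr !mulrA kcstC.
rewrite {1}/GRing.mul/= cat_mul_basis /cat_basis_mul eqxx.
rewrite (contract_pure _ (a * a') ((b : A^c) * b')) (contract_pure _ a' b').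
by rewrite [(b : A^c) * b']/((b' : A) * b : A) !mulrA kcstC.
Qed.

Lemma contract_Mpure y a (b : A) w :
  contract y (w * pure a (b : A^c)) = contract (y * b) w * a.
Proof.
elim/cat_alg_ind: w => [|c u v IH IH'|[a' b']].
- by rewrite mul0r !contract0 mul0r.
- rewrite cat_mulPl [LHS]contractP [in RHS]contractP.
  transitivity (kcst c * (contract (y * b) u * a) + contract (y * b) v * a).
    by congr (_ * _ + _); [apply: IH | apply: IH'].
  by rewrite mulrDl !mulrA.
rewrite {1}/GRing.mul/= cat_mul_basis /cat_basis_mul eqxx.
rewrite (contract_pure _ (a' * a) ((b' : A^c) * b)) (contract_pure _ a' b').
by rewrite [(b' : A^c) * b]/(b * (b' : A) : A) -[b * _ * y]mulrA tC !mulrA.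
Qed.

(** Multiplying w by a pure tensor replaces y by b y or y b, so asking this for all y gives a
    two-sided ideal, through which [contract] descends to the tensor product. Stability on the right
    rests on the symmetry of t. *)
Let dead w := forall y, contract y w = 0.
Let dead0 : dead 0. Proof. by move=> y; apply: contract0. Qed.
Let deadD u v : dead u -> dead v -> dead (u + v).
Proof. by move=> du dv y; rewrite contractD du dv addr0. Qed.
Let deadMl u w : dead w -> dead (u * w).
Proof.
move=> dw; elim/cat_alg_ind: u => [|c u v IH IH'|[a b]] y.
- by rewrite mul0r contract0.
- rewrite cat_mulPl contractP -[RHS]addr0 -{1}[0 in RHS](mulr0 (kcst c)).
  by congr (_ * _ + _); [apply: IH | apply: IH'].
by rewrite (contract_pureM y a (b : A)) dw mulr0.
Qed.
Let deadMr u w : dead w -> dead (w * u).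
Proof.
move=> dw; elim/cat_alg_ind: u => [|c u v IH IH'|[a b]] y.
- by rewrite mulr0 contract0.
- rewrite cat_mulPr contractP -[RHS]addr0 -{1}[0 in RHS](mulr0 (kcst c)).
  by congr (_ * _ + _); [apply: IH | apply: IH'].
by rewrite (contract_Mpure y a (b : A)) dw mul0r.
Qed.

Lemma contract_rel w : gen_ideal (@tensor_rel k A A^c) w -> dead w.
Proof.
move/(_ (Ideal dead0 deadD deadMl deadMr)); apply=> _ [a a' b|a b b'0|c a b|c a b] y;
  rewrite /= contractB ?contractD ?contractZ !contract_pure.
- by rewrite mulrDr subrr.
- by rewrite mulrDl tD kcstD mulrDl subrr.
- by rewrite !mulrA kcstC subrr.
- rewrite [X in t (X * _)]/GRing.mul/= -(kcstC c (b : A)) -mulrA tZ.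
  by rewrite kcstM mulrA subrr.
Qed.

Definition ctr y (u : Ae) : A := contract y (repr u)%qT.

Lemma ctrE y w : ctr y (pi w) = contract y w.
Proof.
apply/eqP; rewrite -subr_eq0 -contractB; apply/eqP/contract_rel.
by apply/quot_piP; rewrite quot_reprK.
Qed.

Lemma ctrMl y a u : ctr y (tens a 1 * u) = a * ctr y u.
Proof.
elim/quot_piW: u => w.
have -> : tens a 1 * pi w = pi (pure a (1 : A^c) * w).
  exact: esym (rmorphM pi _ _).
by rewrite !ctrE contract_pureM mul1r.
Qed.

Lemma ctrMr y a u : ctr y (tens 1 a * u) = ctr (a * y) u.
Proof.
elim/quot_piW: u => w.
have -> : tens 1 a * pi w = pi (pure 1 (a : A^c) * w).
  exact: esym (rmorphM pi _ _).
by rewrite !ctrE contract_pureM mul1r.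
Qed.

(** The action on 1 multiplies the two tensor factors; expanding the second one in the family b'
    leaves exactly the contractions against the b_j. *)
Lemma act1_contract (u : Ae) :
  u *: (1 : regular_bimod A) = \sum_j ctr (bs j) u * bs' j :> A.
Proof.
elim/quot_piW: u => w; apply: etrans (bimod_actE _ _) _.
under eq_bigr do rewrite ctrE.
elim/cat_alg_ind: w => [|c u v IH IH'|[a a']].
- by rewrite pre_act0 big1// => j _; rewrite contract0 mul0r.
- rewrite pre_actD pre_actZ IH IH' mulr_sumr -big_split; apply: eq_bigr => j _.
  by rewrite contractP mulrDl mulrA.
rewrite (pre_act_pure a a') mulr1 [a' in LHS](expand_r (a' : A)) mulr_sumr.
by apply: eq_bigr => j _; rewrite (contract_pure _ a a') mulrA kcstC.
Qed.

Lemma proj_center_trace (z : center A) :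
  proj_center_pred z -> exists d, val z = \sum_j bs j * d * bs' j.
Proof.
move=> [P [projP [g [h zE]]]].
have lin1 : linear (fun u : Ae^o => (u : Ae) *: (1 : regular_bimod A)).
  move=> u x y; apply: etrans (scalerDl _ _ _) _; congr (_ + _).
  exact: esym (scalerA _ _ _).
(* Projectivity of P lifts h along the surjection from the enveloping algebra to A given by the
   action on 1. *)
have [f fE] : exists f : {linear P -> Ae^o}, forall x,
    mk_linear lin1 (f x) = h x.
  apply: projP => y; exists (tens y 1).
  by apply: etrans (tens_act _ _ _) _; rewrite !mulr1.
pose w : Ae := f (g 1).
have fg (u : Ae) : u * w = f (g (u *: (1 : regular_bimod A))).
  rewrite (linearZZ g); exact: esym (linearZZ f u (g 1)).
have wl a : tens a 1 * w = f (g a).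
  by rewrite fg tens_act !mulr1.
have wr a : tens 1 a * w = f (g a).
  by rewrite fg tens_act !mul1r.
(* Since (a ⊗ 1) w = (1 ⊗ a) w for all a, contracting w against b_j amounts to multiplying the
   contraction against 1 by b_j on the left. *)
exists (ctr 1 w).
transitivity (w *: (1 : regular_bimod A)).
  by rewrite [RHS](fE (g 1)) -zE /center_endo mulr1.
rewrite act1_contract; apply: eq_bigr => j _; congr (_ * _).
by rewrite -[bs j in LHS]mulr1 -ctrMr wr -wl ctrMl.
Qed.

End Tensors.

(** * Balancing functions on the edges *)

Section CharZero.
Variables (k : fieldType) (char0 : [pchar k] =i pred0).

Lemma intr_eq0_char0 (z : int) : ((z%:~R : k) == 0) = (z == 0).
Proof.
have n0 n : ((n%:R : k) == 0) = (n == 0%N) by have /pcharf0P -> := char0.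
by case: z => n; rewrite ?NegzE ?rmorphN ?oppr_eq0 /= n0.
Qed.

(** Allows unreduced fractions, which reduces the morphism properties of [ratr] to those of the
    integers; characteristic 0 keeps the denominators invertible. *)
Lemma ratr_frac (a b : int) : b != 0 ->
  ratr (a%:Q / b%:Q) = a%:~R / b%:~R :> k.
Proof.
move=> b0; rewrite /ratr; set q := a%:Q / b%:Q.
have dq0 : (denq q)%:~R != 0 :> k by rewrite intr_eq0_char0 denq_eq0.
have bk0 : b%:~R != 0 :> k by rewrite intr_eq0_char0.
have e : numq q * b = a * denq q.
  apply: (@intr_inj rat); rewrite !rmorphM /= numqE mulrAC -/q /q.
  by rewrite divfK // intr_eq0.
apply: (mulIf dq0); rewrite divfK // mulrAC; apply: (mulIf bk0).
by rewrite divfK // -!rmorphM e.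
Qed.

Lemma ratrD_char0 (p q : rat) : ratr (p + q) = ratr p + ratr q :> k.
Proof.
have d0 (x : rat) : (denq x)%:~R != 0 :> rat by rewrite intr_eq0 denq_eq0.
have dk (x : rat) : (denq x)%:~R != 0 :> k by rewrite intr_eq0_char0 denq_eq0.
rewrite -{1}(divq_num_den p) -{1}(divq_num_den q) addf_div //.
rewrite -!rmorphM -rmorphD /= ratr_frac ?mulf_neq0 ?denq_eq0 //.
by rewrite rmorphD /= !rmorphM /= -addf_div.
Qed.

Lemma ratrM_char0 (p q : rat) : ratr (p * q) = ratr p * ratr q :> k.
Proof.
have dk (x : rat) : (denq x)%:~R != 0 :> k by rewrite intr_eq0_char0 denq_eq0.
rewrite -{1}(divq_num_den p) -{1}(divq_num_den q) mulf_div -!rmorphM /=.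
by rewrite ratr_frac ?mulf_neq0 ?denq_eq0 // !rmorphM /= -mulf_div.
Qed.

Lemma ratr_nat_char0 n : ratr n%:R = n%:R :> k.
Proof.
have := @ratr_frac n 1 isT; rewrite !rmorph1 !divr1 -!pmulrn; exact.
Qed.

Lemma ratr_sum_char0 (I : finType) (P : pred I) (F : I -> rat) :
  ratr (\sum_(i | P i) F i) = \sum_(i | P i) ratr (F i) :> k.
Proof.
by apply: (big_morph (@ratr k) ratrD_char0); apply: (ratr_nat_char0 0).
Qed.

End CharZero.

(* Over an ordered field, D *m B x = 0 follows from x^T B^T D B x = 0; this is why
   the matrices are taken over rat before passing to k. *)
Lemma gram_submx (m n : nat) (B : 'M[rat]_(m, n)) (d : 'I_m -> nat) :
  (forall i, (0 < d i)%N) ->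
  (B <= B^T *m (diag_mx (\row_i (d i)%:R) *m B))%MS.
Proof.
move=> d0; rewrite submxE; set D := diag_mx _; set K := cokermx _.
have e : K^T *m (B^T *m (D *m B)) *m K = 0.
  by rewrite -mulmxA mulmx_coker mulmx0.
apply/eqP/matrixP => i j; rewrite [RHS]mxE.
set M := B *m K; have eM : M^T *m (D *m M) = 0.
  by rewrite /M trmx_mul -[LHS]mulmxA -e !mulmxA.
clearbody M.
have : (M^T *m (D *m M)) j j = 0 by rewrite eM mxE.
rewrite mxE; under eq_bigr => l _ do rewrite mxE mul_diag_mx !mxE mulrCA.
move/psumr_eq0P => /(_ (fun l _ => mulr_ge0 (ler0n _ _) (sqr_ge0 _)) i isT) /eqP.
by rewrite mulf_eq0 pnatr_eq0 eqn0Ngt d0 /= mulf_eq0 orbb => /eqP.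
Qed.

(** Let B be the incidence matrix with entries [b v h], where a loop counts twice, and M the
    diagonal matrix of the m v. The edge sums of f form the vector f B, and [gram_submx] gives B = C
    B^T M B, so f B = (f C) B^T M B. The vector f C is [c0]; adding its composite with i makes it a
    function on edges and turns its products with B^T into sums over the h at each vertex. *)
Lemma edge_sums_balanced (k : fieldType) (char0 : [pchar k] =i pred0)
    (V H : finType) (r : H -> V) (i : H -> H) (m : V -> nat) (f : V -> k) :
  involutive i -> (forall v, (0 < m v)%N) ->
  exists c : H -> k, (forall h, c (i h) = c h) /\
    let D v := (m v)%:R * \sum_(h | r h == v) c h in
    forall g, f (r g) + f (r (i g)) = D (r g) + D (r (i g)).
Proof.
move=> iK m0.
pose b (v : V) h : nat := ((r h == v) + (r (i h) == v))%N.
pose B : 'M[rat]_(#|V|, #|H|) := \matrix_(v, h) (b (enum_val v) (enum_val h))%:R.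
have /submxP[C CE] := @gram_submx _ _ B (fun v => m (enum_val v)) (fun v => m0 _).
pose C' v h : k := ratr (C (enum_rank v) (enum_rank h)).
have CE' v g : (b v g)%:R = \sum_h C' v h * \sum_w (b w h)%:R * ((m w)%:R * (b w g)%:R).
  have := congr1 (fun M : 'M[rat]_(#|V|, #|H|) => ratr (M (enum_rank v) (enum_rank g)) : k) CE.
  rewrite mxE !enum_rankK ratr_nat_char0// => ->.
  rewrite mxE ratr_sum_char0// (reindex enum_rank); last exact/onW_bij/enum_rank_bij.
  apply: eq_bigr => h _; rewrite ratrM_char0//; congr (_ * _).
  rewrite mxE ratr_sum_char0// (reindex enum_rank); last exact/onW_bij/enum_rank_bij.
  apply: eq_bigr => w _; rewrite mul_diag_mx !mxE !enum_rankK.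
  by rewrite !ratrM_char0// !ratr_nat_char0.
have sumb (F : V -> k) g : \sum_w F w * (b w g)%:R = F (r g) + F (r (i g)).
  rewrite /b; under eq_bigr do rewrite natrD mulrDr.
  rewrite big_split /=; suff s1 v : \sum_w F w * (v == w)%:R = F v by rewrite !s1.
  rewrite (bigD1 v) //= eqxx mulr1 big1 ?addr0// => w.
  by rewrite eq_sym => /negPf->; rewrite mulr0.
pose c0 h := \sum_v f v * C' v h.
exists (fun h => c0 h + c0 (i h)); split=> [h|D g]; first by rewrite iK addrC.
rewrite -!sumb; under eq_bigr do rewrite CE' mulr_sumr.
rewrite exchange_big /=.
transitivity (\sum_h c0 h * \sum_w (b w h)%:R * ((m w)%:R * (b w g)%:R)).
  by apply: eq_bigr => h _; rewrite /c0 mulr_suml; apply: eq_bigr => v _; rewrite mulrA.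
under [LHS]eq_bigr do rewrite mulr_sumr.
rewrite exchange_big /=.
apply: eq_bigr => w _; rewrite /D big_split /= [X in _ + X](reindex_inj (inv_inj iK)) /=.
under [X in _ + X]eq_bigr do rewrite iK.
rewrite (big_mkcond (fun h => r h == w)) (big_mkcond (fun h => r (i h) == w)) -big_split /=.
rewrite mulr_sumr mulr_suml; apply: eq_bigr => h _.
rewrite mulrA mulrCA !mulrA; congr (_ * _); rewrite -mulrA; congr (_ * _).
by rewrite /b natrD mulrDr; do 2 case: eqP => _; rewrite ?mulr1 ?mulr0.
Qed.

(** * The trace form and the projective center of A *)

Section FlatSums.
Variables (G : brauerGraph) (V : nmodType).
Notation H := (rg_half G).
Notation rho := (rg_rho G).
Implicit Types (g h : H) (f : H -> nat -> V).

Definition max_len : nat := \max_(h : H) half_len h.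

(** One index type for pairs (h, a) with a at most N h; the surplus pairs must contribute 0. *)
Definition flat_index : finType := (H * 'I_max_len.+1)%type.

Lemma leq_max_len h : (half_len h <= max_len)%N.
Proof. exact: leq_bigmax. Qed.

Lemma sum_flat f : \sum_h \sum_(a < (half_len h).+1) f h a =
  \sum_(p : flat_index | (p.2 <= half_len p.1)%N) f p.1 p.2.
Proof.
rewrite -(pair_big_dep xpredT (fun h (a : 'I_max_len.+1) => (a <= half_len h)%N)
  (fun h (a : 'I_max_len.+1) => f h a)) /=.
apply: eq_bigr => h _; rewrite (big_ord_widen max_len.+1)//.
by rewrite ltnS leq_max_len.
Qed.

Lemma sum_flat_all f : (forall h a, (half_len h < a)%N -> f h a = 0) ->
  \sum_(p : flat_index) f p.1 p.2 = \sum_h \sum_(a < (half_len h).+1) f h a.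
Proof.
move=> f0; rewrite sum_flat [RHS]big_mkcond; apply: eq_bigr => p _.
by case: leqP => // /f0.
Qed.

(** Passes from a run to the complementary run of the full cycle, which starts where the first one
    stops. *)
Definition flat_swap (p : flat_index) : flat_index :=
  (iter p.2 rho p.1, inord (half_len p.1 - p.2)).

Lemma flat_swap2 (p : flat_index) : (flat_swap p).2 = (half_len p.1 - p.2)%N :> nat.
Proof.
by rewrite /= inordK// ltnS (leq_trans (leq_subr _ _)) ?leq_max_len.
Qed.

Lemma flat_swapK (p : flat_index) : (p.2 <= half_len p.1)%N -> flat_swap (flat_swap p) = p.
Proof.
move=> lp; rewrite {1}/flat_swap flat_swap2 /= -iterD subnK// iter_len.
by rewrite half_len_iter subKn//; case: p {lp} => h a /=; rewrite inord_val.
Qed.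

Lemma sum_swap f : \sum_h \sum_(a < (half_len h).+1) f h a =
  \sum_h \sum_(a < (half_len h).+1) f (iter a rho h) (half_len h - a)%N.
Proof.
rewrite (sum_flat f) (sum_flat (fun h a => f (iter a rho h) (half_len h - a)%N)).
rewrite (reindex_onto flat_swap flat_swap); last by move=> p /flat_swapK.
apply: eq_big => [p|p _]; last by rewrite flat_swap2.
rewrite flat_swap2 half_len_iter leq_subr.
apply/eqP/idP => [e|/flat_swapK//].
by rewrite -e flat_swap2 /= !half_len_iter leq_subr.
Qed.

End FlatSums.

Section CoordinateAlgebra.
Variables (G : brauerGraph) (k : fieldType) (char0 : [pchar k] =i pred0).
Variables (A : pzAlgType k) (cA : coordinates G A).
Notation H := (rg_half G).
Notation iota_ := (@rg_iota G).
Notation rho := (rg_rho G).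
Notation root := (@rg_root G).
Notation N := (@half_len G).
Notation κ := (coord cA).
Notation τ := (soc_coord cA).
Notation P := (basis_elt cA).
Implicit Types (g h : H) (l j a : nat) (x y z : A).

Lemma two_neq0 : (2%:R : k) != 0.
Proof. by have /pcharf0P -> := char0. Qed.

Lemma half_half : (2%:R^-1 : k) + 2%:R^-1 = 1.
Proof. by rewrite -mulr2n -(mulr_natr 2%:R^-1) mulVf// two_neq0. Qed.

Lemma coord0 h l : κ h l 0 = 0.
Proof. by have := coordZ cA h l 0 0; rewrite mulr0 mul0r. Qed.

Lemma soc_coord0 h : τ h 0 = 0.
Proof. by have := soc_coordZ cA h 0 0; rewrite mulr0 mul0r. Qed.

Lemma coord_sum h l I r (Q : pred I) (F : I -> A) :
  κ h l (\sum_(i <- r | Q i) F i) = \sum_(i <- r | Q i) κ h l (F i).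
Proof. exact: (big_morph _ (coordD cA h l) (coord0 h l)). Qed.

Lemma soc_coord_sum h I r (Q : pred I) (F : I -> A) :
  τ h (\sum_(i <- r | Q i) F i) = \sum_(i <- r | Q i) τ h (F i).
Proof. exact: (big_morph _ (soc_coordD cA h) (soc_coord0 h)). Qed.

Lemma coordN h l x : κ h l (- x) = - κ h l x.
Proof. by rewrite -mulN1r -(rmorphN1 (@kcst k A)) coordZ mulN1r. Qed.

Lemma soc_coordN h x : τ h (- x) = - τ h x.
Proof. by rewrite -mulN1r -(rmorphN1 (@kcst k A)) soc_coordZ mulN1r. Qed.

Lemma coord_ext x y : (forall h l, (l < N h)%N -> κ h l x = κ h l y) ->
  (forall h, τ h x = τ h y) -> x = y.
Proof.
move=> e1 e2; apply/eqP; rewrite -subr_eq0; apply/eqP/(coord_inj (c0 := cA)).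
  move=> h l; rewrite coordD coordN; have [lh|hl] := ltnP l (N h).
    by rewrite e1// subrr.
  by rewrite !coord_big// subrr.
by move=> h; rewrite soc_coordD soc_coordN e2 subrr.
Qed.

Definition conv h x y : k :=
  \sum_(a < (N h).+1) κ (iter a rho h) (N h - a) x * κ h a y.

Lemma soc_coord_mul h x y : τ h (x * y) = conv h x y + conv (iota_ h) x y +
  (κ h 0 x * τ h y + τ h x * κ h 0 y).
Proof. exact: soc_coordM. Qed.

(** This is the sum over edges, each of them having two half-edges. *)
Definition tr x : k := 2%:R^-1 * \sum_h τ h x.

Lemma trD x y : tr (x + y) = tr x + tr y.
Proof.
by rewrite /tr -mulrDr -big_split; congr (_ * _); apply: eq_bigr => h _; apply: soc_coordD.
Qed.

Lemma trZ c x : tr (kcst c * x) = c * tr x.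
Proof.
rewrite /tr; under eq_bigr do rewrite soc_coordZ; by rewrite -mulr_sumr mulrCA.
Qed.

Lemma sum_iota (f : H -> k) : \sum_h f (iota_ h) = \sum_h f h.
Proof. by rewrite [RHS](reindex_inj (@iota_inj G)). Qed.

Lemma trM x y : tr (x * y) = \sum_h conv h x y +
  2%:R^-1 * \sum_h (κ h 0 x * τ h y + τ h x * κ h 0 y).
Proof.
rewrite /tr; under eq_bigr do rewrite soc_coord_mul.
rewrite big_split big_split /= (sum_iota (fun h => conv h x y)) mulrDr; congr (_ + _).
by rewrite mulrDr -mulrDl half_half mul1r.
Qed.

(** A convolution term cuts a full cycle into two complementary runs; [sum_swap] interchanges them
    and thereby the two factors. *)
Lemma trC x y : tr (x * y) = tr (y * x).
Proof.
rewrite !trM; congr (_ + _ * _); last first.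
  by apply: eq_bigr => h _; rewrite addrC mulrC [X in _ + X]mulrC.
rewrite [RHS](sum_swap (fun h a => κ (iter a rho h) (N h - a) y * κ h a x)).
apply: eq_bigr => h _; apply: eq_bigr => a _.
have ah : (a <= N h)%N by rewrite -ltnS.
by rewrite -iterD half_len_iter subKn// subnK// iter_len mulrC.
Qed.

Lemma edge_mem_sum h (f : H -> k) :
  \sum_g ((g == h) || (g == iota_ h))%:R * f g = f h + f (iota_ h).
Proof.
rewrite (bigD1 h)//= (bigD1 (iota_ h)) ?rg_iota_neq//= big1 => [|g /andP[gh gi]].
  by rewrite !eqxx orbT !mul1r addr0.
by rewrite (negPf gh) (negPf gi) mul0r.
Qed.

Lemma conv_basis g h l x : (0 < l < N h)%N ->
  conv g (P h l) x = (g == iter l rho h)%:R * κ g (N g - l) x.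
Proof.
case/andP=> l0 lh; rewrite /conv.
have cb (a : 'I_(N g).+1) : κ (iter a rho g) (N g - a) (P h l) =
    ((N g - a == l)%N && (iter a rho g == h))%:R.
  rewrite coord_basis; last exact: ltnW.
  by rewrite eqn0Ngt l0 (ltn_eqF lh).
under eq_bigr do rewrite cb.
have [e|ne] := eqVneq g (iter l rho h).
  have Ng : N g = N h by rewrite e half_len_iter.
  have la : (N g - l < (N g).+1)%N by rewrite ltnS leq_subr.
  rewrite mul1r (bigD1 (Ordinal la))//= big1 ?addr0 => [|a na].
    rewrite subKn; last by rewrite Ng ltnW.
    by rewrite eqxx {2}e -iterD subnK Ng ?iter_len ?eqxx ?mul1r// ltnW.
  case: eqP => [ea|]; last by rewrite mul0r.
  case/eqP: na; apply: val_inj; rewrite /= -ea subKn//.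
  by rewrite -ltnS.
rewrite mul0r big1// => a _; case: eqP => [ea|]; last by rewrite mul0r.
case: eqP => [eh|]; last by rewrite mul0r.
case/eqP: ne; rewrite -eh -ea -iterD subnK ?iter_len//.
by rewrite -ltnS.
Qed.

Lemma conv_basis0 g h x : conv g (P h 0) x = 0.
Proof.
rewrite /conv big1// => a _; rewrite coord_basis//=.
case: eqP => [/eqP|]; last by rewrite mul0r.
by rewrite subn_eq0 => na; rewrite [κ g a x]coord_big ?mulr0.
Qed.

Lemma conv_basisN g h x : conv g (P h (N h)) x = 0.
Proof.
rewrite /conv big1// => a _; rewrite coord_basis//=.
by rewrite eqn0Ngt half_len_gt0 eqxx mul0r.
Qed.

Lemma soc_basis_lt h l g : (l < N h)%N -> τ g (P h l) = 0.
Proof. by move=> lh; rewrite soc_coord_basis ?(ltn_eqF lh)// ltnW. Qed.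

Lemma coord0_basis h l g : (0 < l <= N h)%N -> κ g 0 (P h l) = 0.
Proof.
by case: l => // l /andP[_ lh]; rewrite coord_basis//= andbF.
Qed.

(** Pairing with a basis element extracts the single coordinate of the complementary run, so the
    basis is dual to itself under complementation. *)
Lemma tr_basisM h l x : (l <= N h)%N ->
  tr (P h l * x) = if l == 0%N then τ h x else κ (iter l rho h) (N h - l) x.
Proof.
rewrite trM; case: (posnP l) => [->|l0] /=.
  move=> _; rewrite big1 ?add0r => [|g _]; last exact: conv_basis0.
  under eq_bigr => g _.
    rewrite soc_basis_lt ?half_len_gt0// mul0r addr0 coord_basis//=; over.
  by rewrite edge_mem_sum soc_coord_iota mulrDr -mulrDl half_half mul1r.
rewrite leq_eqVlt => /orP[/eqP ->|lh].
  rewrite big1 ?add0r => [|g _]; last exact: conv_basisN.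
  under eq_bigr => g _.
    rewrite coord0_basis ?half_len_gt0 ?leqnn// mul0r add0r.
    rewrite soc_coord_basis// eqxx /=; over.
  rewrite edge_mem_sum coord_iota mulrDr -mulrDl half_half mul1r.
  by rewrite subnn iter_len.
under eq_bigr do rewrite conv_basis ?l0 ?lh//.
rewrite (bigD1 (iter l rho h))//= eqxx mul1r half_len_iter big1 => [|g /negPf->].
  rewrite big1 ?mulr0 ?addr0// => g _.
  have c0 : κ g 0 (P h l) = 0 by apply: coord0_basis; rewrite l0 ltnW.
  by rewrite c0 (soc_basis_lt _ lh) !mul0r addr0.
by rewrite mul0r.
Qed.

End CoordinateAlgebra.

(** * Dual families for the trace form and the image of the trace map *)

Section Trace.
Variables (G : brauerGraph) (k : fieldType) (char0 : [pchar k] =i pred0).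
Variables (A : pzAlgType k) (cA : coordinates G A).
Notation H := (rg_half G).
Notation iota_ := (@rg_iota G).
Notation rho := (rg_rho G).
Notation root := (@rg_root G).
Notation N := (@half_len G).
Notation κ := (coord cA).
Notation τ := (soc_coord cA).
Notation P := (basis_elt cA).
Notation tr := (tr cA).
Implicit Types (g h : H) (l j a : nat) (x y z d : A).

(* Both ends of an edge contribute its idempotent and its socle element to the
   family indexed by (h, l), whence the weight 1/2 at l = 0 and l = N h. *)
Definition weight h l : k := if (N h < l)%N then 0 else
  if (l == 0%N) || (l == N h) then 2%:R^-1 else 1.

Lemma weight0 h : weight h 0 = 2%:R^-1.
Proof. by rewrite /weight. Qed.

Lemma weightN h : weight h (N h) = 2%:R^-1.
Proof. by rewrite /weight ltnn eqxx orbT. Qed.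

Lemma weight_mid h l : (0 < l < N h)%N -> weight h l = 1.
Proof. by case/andP=> l0 lh; rewrite /weight ltnNge ltnW// eqn0Ngt l0 (ltn_eqF lh). Qed.

Lemma weight_swap h l : (l <= N h)%N -> weight (iter l rho h) (N h - l) = weight h l.
Proof.
rewrite leq_eqVlt => /orP[/eqP->|lh]; first by rewrite subnn weight0 weightN.
case: (posnP l) => [->|l0]; first by rewrite subn0 weightN weight0.
rewrite !weight_mid ?l0 ?lh// half_len_iter subn_gt0 lh ltn_subrL l0.
exact: half_len_gt0.
Qed.

Definition frame (p : flat_index G) : A := P p.1 p.2.
(** The dual of a run is its complement in the full cycle; the weight 0 beyond N h discards the
    surplus indices. *)
Definition coframe (p : flat_index G) : A :=
  kcst (weight p.1 p.2) * P (iter p.2 rho p.1) (N p.1 - p.2).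

Definition dual_coord h l x : k := if l == N h then τ h x else κ h l x.

Lemma tr_coframe h l x : (l <= N h)%N ->
  tr (P (iter l rho h) (N h - l) * x) = dual_coord h l x.
Proof.
move=> lh; rewrite tr_basisM//; last by rewrite half_len_iter leq_subr.
rewrite half_len_iter subKn// -!iterD subnK// iter_len /dual_coord.
rewrite subn_eq0 [(N h <= l)%N](_ : _ = (l == N h)); last by rewrite eqn_leq lh.
by case: eqP => // ->; rewrite iter_len.
Qed.

Lemma sum_coord_basis h (c : nat -> k) g j : (j < N g)%N ->
  \sum_(a < (N h).+1) weight h a * (c a * κ g j (P h a)) =
  if j == 0%N then 2%:R^-1 * ((g == h) || (g == iota_ h))%:R * c 0%N
  else (g == h)%:R * c j.
Proof.
move=> jg; have cb (a : 'I_(N h).+1) : κ g j (P h a) =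
    (if a == 0%N :> nat then (j == 0%N) && ((g == h) || (g == rg_iota h))
     else (a != N h :> nat) && ((j == a) && (g == h)))%:R.
  by rewrite coord_basis// -ltnS.
under eq_bigr do rewrite cb; case: eqP => [->|/eqP j0].
  rewrite big_ord_recl /= weight0 big1 ?addr0 => [|a _].
    by rewrite mulrAC mulrA.
  by rewrite /= andbF !mulr0.
have [<-|gh] := eqVneq g h; last first.
  rewrite mul0r big1// => a _; rewrite !andbF.
  by case: ifP; rewrite !mulr0.
have jl : (j < (N g).+1)%N by exact: ltnW.
rewrite (bigD1 (Ordinal jl))//= big1 ?addr0 => [|a na].
  rewrite (negPf j0) eqxx (ltn_eqF jg) /= mulr1 weight_mid ?mul1r// lt0n j0.
  by rewrite jg.
case: (j =P a) => [ja|_]; last by rewrite andbF if_same !mulr0.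
by case/eqP: na; apply: val_inj.
Qed.

Lemma frame_expand_aux x :
  x = \sum_h \sum_(a < (N h).+1) kcst (weight h a * dual_coord h a x) * P h a.
Proof.
apply: (coord_ext (cA := cA)) => [g j jg|g].
- rewrite coord_sum; under eq_bigr => h _.
    rewrite coord_sum; under eq_bigr do rewrite coordZ -mulrA.
    rewrite (sum_coord_basis h (fun a => dual_coord h a x) jg); over.
  case: eqP => [j0|_].
    under eq_bigr do rewrite -mulrA -edge_of_eq eq_sym edge_of_eq.
    rewrite -mulr_sumr edge_mem_sum.
    have dc0 h : dual_coord h 0 x = κ h 0 x.
      by rewrite /dual_coord eq_sym eqn0Ngt half_len_gt0.
    rewrite !dc0.
    by rewrite coord_iota mulrDr -mulrDl half_half// mul1r j0.
  rewrite (bigD1 g)//= eqxx mul1r big1 ?addr0 => [|h]; last first.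
    by rewrite eq_sym => /negPf->; rewrite mul0r.
  by rewrite /dual_coord (ltn_eqF jg).
rewrite soc_coord_sum; under eq_bigr => h _.
  rewrite soc_coord_sum big_ord_recr /= big1 => [|a _]; last first.
    by rewrite soc_coordZ soc_basis_lt ?mulr0.
  rewrite add0r soc_coordZ soc_coord_basis// weightN /dual_coord eqxx /=.
  rewrite -edge_of_eq eq_sym edge_of_eq -mulrA [_ * _%:R]mulrC; over.
rewrite -mulr_sumr edge_mem_sum soc_coord_iota.
by rewrite mulrDr -mulrDl half_half// mul1r.
Qed.

Lemma frame_expand_l x : x = \sum_p kcst (tr (coframe p * x)) * frame p.
Proof.
rewrite {1}[x]frame_expand_aux.
rewrite -(sum_flat_all (f := fun h a => kcst (weight h a * dual_coord h a x) * P h a)).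
  apply: eq_bigr => p _; congr (kcst _ * _).
  rewrite /coframe -mulrA trZ; have [lp|lp] := leqP p.2 (N p.1).
    by rewrite tr_coframe.
  by rewrite /weight lp !mul0r.
by move=> h a ha; rewrite /weight ha mul0r kcst0 mul0r.
Qed.

Lemma frame_expand_r x : x = \sum_p kcst (tr (x * frame p)) * coframe p.
Proof.
rewrite (sum_flat_all (f := fun h a => kcst (tr (x * P h a)) *
  (kcst (weight h a) * P (iter a rho h) (N h - a)))); last first.
  by move=> h a ha; rewrite /weight ha kcst0 mul0r mulr0.
rewrite (sum_swap (fun h a => kcst (tr (x * P h a)) *
  (kcst (weight h a) * P (iter a rho h) (N h - a)))) {1}[x]frame_expand_aux.
apply: eq_bigr => h _; apply: eq_bigr => a _.
have ah : (a <= N h)%N by rewrite -ltnS.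
rewrite trC// tr_coframe// weight_swap// half_len_iter subKn// -iterD subnK// iter_len.
by rewrite mulrA -kcstM mulrC [_ * weight _ _]mulrC.
Qed.

Definition trace_map d : A := \sum_p frame p * d * coframe p.

Lemma trace_mapP (z : center A) :
  proj_center_pred z <-> exists d, val z = trace_map d.
Proof.
split=> [|[d zd]].
  exact: (proj_center_trace frame_expand_r (trD cA) (trZ cA) (trC char0 cA)).
exact: (trace_proj_center frame_expand_l frame_expand_r zd).
Qed.

Lemma conv_socl g x y : (forall h l, κ h l x = 0) -> conv cA g x y = 0.
Proof. by move=> x0; rewrite /conv big1// => a _; rewrite x0 mul0r. Qed.

Lemma conv_socr g x y : (forall h l, κ h l y = 0) -> conv cA g x y = 0.
Proof. by move=> y0; rewrite /conv big1// => a _; rewrite y0 mulr0. Qed.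

Lemma coordM_socl x y : (forall h l, κ h l x = 0) ->
  (forall h l, κ h l (x * y) = 0) /\ forall h, τ h (x * y) = τ h x * κ h 0 y.
Proof.
move=> x0; split=> [h l|h]; last first.
  by rewrite soc_coord_mul !conv_socl// x0 mul0r !add0r.
have [lh|hl] := ltnP l (N h); last exact: coord_big.
by rewrite coordM// big1// => a _; rewrite x0 mul0r.
Qed.

Lemma coordM_socr x y : (forall h l, κ h l y = 0) ->
  (forall h l, κ h l (x * y) = 0) /\ forall h, τ h (x * y) = κ h 0 x * τ h y.
Proof.
move=> y0; split=> [h l|h]; last first.
  by rewrite soc_coord_mul !conv_socr// y0 mulr0 !add0r addr0.
have [lh|hl] := ltnP l (N h); last exact: coord_big.
by rewrite coordM// big1// => a _; rewrite y0 mulr0.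
Qed.

Lemma coord_basisN g l h : κ g l (P h (N h)) = 0.
Proof. by rewrite coord_basis// eqn0Ngt half_len_gt0 eqxx. Qed.

Lemma soc_coord_basisN g h : τ g (P h (N h)) = ((g == h) || (g == iota_ h))%:R.
Proof. by rewrite soc_coord_basis// eqxx. Qed.

Lemma coord0_basis0 g h : κ g 0 (P h 0) = ((g == h) || (g == iota_ h))%:R.
Proof. by rewrite coord_basis. Qed.

Lemma coordM_basis g a d h l : (0 < l < N h)%N -> (a < N g)%N ->
  κ g a (d * P h l) = (g == h)%:R * (if (l <= a)%N then κ (iter l rho g) (a - l) d else 0).
Proof.
case/andP=> l0 lh ag; rewrite coordM//.
under eq_bigr do rewrite coord_basis 1?ltnW// eqn0Ngt l0 (ltn_eqF lh) /=.
case: (leqP l a) => [la|al]; last first.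
  rewrite mulr0 big1// => i _; case: eqP => [e|_]; last by rewrite mulr0.
  by move: (ltn_ord i); rewrite e ltnS leqNgt al.
have la' : (l < a.+1)%N by [].
rewrite (bigD1 (Ordinal la'))//= eqxx mulrC big1 ?addr0// => i ni.
case: eqP => [e|_]; last by rewrite mulr0.
by case/eqP: ni; apply: val_inj.
Qed.

Lemma edge_indicator_scale g h (c : H -> k) : c (iota_ h) = c h ->
  ((g == h) || (g == iota_ h))%:R * c g = ((g == h)%:R + (iota_ g == h)%:R) * c h.
Proof.
move=> ch; rewrite (inv_eq (@rg_iotaK G)); have [->|_] := eqVneq g h.
  by rewrite eq_sym (negPf (rg_iota_neq h)) addr0.
by rewrite add0r; case: eqP => [->|_]; rewrite ?mul0r ?ch.
Qed.

(** The lengths of the two outer factors already add up to N, so d contributes only its idempotent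
    coefficient at the edge of h, where the complementary run ends; the result is a multiple of the
    socle element at the other junction. *)
Lemma coord_frame_term d h l : (l <= N h)%N ->
  let z := P h l * d * P (iter l rho h) (N h - l) in
  (forall g j, κ g j z = 0) /\
  forall g, τ g z = ((g == iter l rho h)%:R + (iota_ g == iter l rho h)%:R) * κ h 0 d.
Proof.
case: (posnP l) => [-> _|l0]; rewrite ?subn0.
  have [z1 z2] := @coordM_socr (P h 0 * d) _ (fun g j => coord_basisN g j h).
  split=> // g; rewrite z2 soc_coord_basisN coordM ?half_len_gt0//.
  rewrite big_ord1 subnn coord0_basis0 mulrAC -natrM mulnb andbb.
  by rewrite (edge_indicator_scale _ (c := fun g => κ g 0 d)) ?coord_iota.
rewrite leq_eqVlt => /orP[/eqP->|lh].
  rewrite subnn iter_len.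
  have [z1 z2] := @coordM_socl _ d (fun g j => coord_basisN g j h).
  have [z3 z4] := @coordM_socl _ (P h 0) z1.
  split=> // g; rewrite z4 z2 soc_coord_basisN coord0_basis0 mulrAC -natrM mulnb andbb.
  by rewrite (edge_indicator_scale _ (c := fun g => κ g 0 d)) ?coord_iota.
set h' := iter l rho h; set l' := (N h - l)%N.
have l'b : (0 < l' < N h')%N.
  by rewrite subn_gt0 lh half_len_iter ltn_subrL l0 half_len_gt0.
have h'h : iter l' rho h' = h by rewrite -iterD subnK ?iter_len// ltnW.
have lb : (0 < l < N h)%N by rewrite l0.
have yE g a := @coordM_basis g a d h' l' l'b.
rewrite -mulrA; set y := d * _ in yE *; split=> [g j|g].
  have [jg|gj] := ltnP j (N g); last exact: coord_big.
  rewrite coordM// big1// => a _; rewrite coord_basis; last exact: ltnW.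
  rewrite eqn0Ngt l0 (ltn_eqF lh) /=; case: eqP => [e1|_]; last by rewrite mul0r.
  rewrite yE; last by rewrite (leq_ltn_trans _ jg)// -ltnS.
  case: (g =P h') => [e2|_]; last by rewrite mul0r mulr0.
  have ej : (l + a = j)%N by rewrite -e1 subnK// -ltnS.
  rewrite leqNgt (_ : (a < l')%N) ?mulr0// /l' ltn_subRL ej.
  by move: jg; rewrite e2 half_len_iter.
have c0 : κ g 0 (P h l) = 0 by apply: coord0_basis; rewrite l0 ltnW.
rewrite soc_coord_mul c0 (soc_basis_lt _ _ lh) !mul0r !addr0 !conv_basis//.
have e g' : (g' == h')%:R * κ g' (N g' - l) y = (g' == h')%:R * κ h 0 d.
  case: (g' =P h') => [->|_]; last by rewrite !mul0r.
  rewrite yE ?ltn_subrL ?l0 ?half_len_gt0// eqxx half_len_iter.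
  by rewrite leqnn subnn h'h mul1r.
by rewrite !e mulrDl.
Qed.

Lemma trace_coord d g j : κ g j (trace_map d) = 0.
Proof.
rewrite coord_sum big1// => p _; rewrite /frame /coframe.
rewrite mulrA -kcstC -mulrA coordZ; have [lp|lp] := leqP p.2 (N p.1).
  by have [-> _] := coord_frame_term d lp; rewrite mulr0.
by rewrite /weight lp mul0r.
Qed.

Lemma trace_soc_coord d g : τ g (trace_map d) =
  \sum_h \sum_(a < (N h).+1) weight h a *
    (((g == iter a rho h)%:R + (iota_ g == iter a rho h)%:R) * κ h 0 d).
Proof.
rewrite -(sum_flat_all (f := fun h a => weight h a *
    (((g == iter a rho h)%:R + (iota_ g == iter a rho h)%:R) * κ h 0 d))); last first.
  by move=> h a ha; rewrite /weight ha mul0r.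
rewrite soc_coord_sum; apply: eq_bigr => p _; rewrite /frame /coframe.
rewrite mulrA -kcstC -mulrA soc_coordZ; have [lp|lp] := leqP p.2 (N p.1).
  by have [_ ->] := coord_frame_term d lp.
by rewrite /weight lp !mul0r.
Qed.

Lemma periodic_sum m n (f : nat -> k) : (forall a, f (n + a)%N = f a) ->
  \sum_(a < m * n) f a = m%:R * \sum_(a < n) f a.
Proof.
move=> fp; elim: m => [|m IH]; first by rewrite big_ord0 mul0r.
rewrite mulSn big_split_ord /=; under [X in _ + X]eq_bigr do rewrite fp.
by rewrite IH mulrS mulrDl mul1r.
Qed.

Lemma weight_count g h : \sum_(a < (N h).+1) weight h a * (g == iter a rho h)%:R =
  (bg_mult (root h))%:R * (root h == root g)%:R.
Proof.
(* The indices a = 0 and a = N h both sit at h with weight 1/2 and merge into one, leaving a plain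
   count of visits during m turns around the vertex. *)
transitivity (\sum_(a < N h) (g == iter a rho h)%:R : k).
  pose z := Ordinal (half_len_gt0 h).
  rewrite big_ord_recr /= weightN iter_len (bigD1 z)//= weight0 [RHS](bigD1 z)//=.
  rewrite addrAC -mulrDl half_half// mul1r; congr (_ + _).
  apply: eq_bigr => a na; rewrite weight_mid ?mul1r// ltn_ord andbT lt0n.
  by apply: contra na => /eqP a0; apply/eqP/val_inj.
rewrite half_lenE (@periodic_sum _ _ (fun a => (g == iter a rho h)%:R)); last first.
  by move=> a; rewrite addnC iterD iter_val.
congr (_ * _); rewrite eq_sym; case: root_eqP => [[l ln ->]|ng].
  rewrite (bigD1 (Ordinal ln))//= eqxx big1 ?addr0// => a /eqP na.
  case: eqP => // e; case: na; apply: val_inj; apply: esym.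
  exact: (iter_rho_inj_lt ln (ltn_ord a) e).
by rewrite big1// => a _; case: eqP => // e; case: ng; exists a.
Qed.

Lemma trace_soc_coord_sum d g :
  let D v := (bg_mult v)%:R * \sum_(h | root h == v) κ h 0 d in
  τ g (trace_map d) = D (root g) + D (root (iota_ g)).
Proof.
move=> D; rewrite trace_soc_coord.
have e g' : \sum_h \sum_(a < (N h).+1) weight h a * (g' == iter a rho h)%:R * κ h 0 d =
    D (root g').
  rewrite /D mulr_sumr [RHS]big_mkcond; apply: eq_bigr => h _.
  rewrite -mulr_suml weight_count; case: eqP => [->|_]; first by rewrite mulr1.
  by rewrite mulr0 mul0r.
rewrite -!e -big_split; apply: eq_bigr => h _.
by rewrite -big_split; apply: eq_bigr => a _; rewrite /= mulrDl mulrDr !mulrA.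
Qed.

Lemma proj_center_coord (z : center A) g j :
  proj_center_pred z -> κ g j (val z) = 0.
Proof. by move/trace_mapP => [d ->]; apply: trace_coord. Qed.

Lemma proj_center_soc (z : center A) (f : rg_vertex G -> k) :
  (forall g j, κ g j (val z) = 0) ->
  (forall g, τ g (val z) = f (root g) + f (root (iota_ g))) ->
  proj_center_pred z.
Proof.
move=> z0 zf; apply/trace_mapP.
have [c [ci cf]] := edge_sums_balanced char0 (@rg_root G) f (@rg_iotaK G) (@bg_mult_gt0 G).
(* The combination of edge idempotents with coefficients c; the two half-edges of an edge contribute
   half each. *)
pose d : A := \sum_h kcst (2%:R^-1 * c h) * P h 0.
have dc g : κ g 0 d = c g.
  rewrite coord_sum; under eq_bigr => h _.
    rewrite coordZ coord0_basis0 -edge_of_eq eq_sym edge_of_eq -mulrA.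
    rewrite [c h * _]mulrC; over.
  by rewrite -mulr_sumr edge_mem_sum ci mulrDr -mulrDl half_half// mul1r.
exists d; apply: (coord_ext (cA := cA)) => [g j _|g].
  by rewrite z0 trace_coord.
rewrite trace_soc_coord_sum zf cf.
by congr (_ * _ + _ * _); apply: eq_bigr => h _; rewrite dc.
Qed.

End Trace.

(** * The center of A *)

Section CenterCoordinates.
Variables (G : brauerGraph) (k : fieldType) (char0 : [pchar k] =i pred0).
Variables (A : pzAlgType k) (cA : coordinates G A).
Notation H := (rg_half G).
Notation V := (rg_vertex G).
Notation iota_ := (@rg_iota G).
Notation rho := (rg_rho G).
Notation root := (@rg_root G).
Notation N := (@half_len G).
Notation n := (@half_val G).
Notation κ := (coord cA).
Notation τ := (soc_coord cA).
Notation P := (basis_elt cA).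
Implicit Types (g h : H) (l j a i : nat) (x y : A) (v w : V).

Lemma basis_coordM g a d h l : (0 < l < N h)%N -> (a < N g)%N ->
  κ g a (P h l * d) = if (l <= a)%N then (iter (a - l) rho g == h)%:R * κ g (a - l) d
                      else 0.
Proof.
case/andP=> l0 lh ag; rewrite coordM//.
under eq_bigr do rewrite coord_basis 1?ltnW// eqn0Ngt l0 (ltn_eqF lh) /=.
case: (leqP l a) => [la|al]; last first.
  rewrite big1// => i _; case: eqP => [e|_]; last by rewrite mul0r.
  by move: al; rewrite -e ltnNge leq_subr.
have la' : (a - l < a.+1)%N by rewrite ltnS leq_subr.
rewrite (bigD1 (Ordinal la'))//= subKn// eqxx big1 ?addr0// => i ni.
case: eqP => [e|_]; last by rewrite mul0r.
by case/eqP: ni; apply: val_inj; rewrite /= -e subKn// -ltnS.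
Qed.

Section Central.
Variable z : A.
Hypothesis zC : z \in @central k A.

(** Compare the coefficients at h of length i + 1 in z times the arrow of h and in the reversed
    product: the second is nonzero only if i steps of [rho] lead back to h. Length N - 1 escapes
    this argument, which leaves room for the closed paths of that length. *)
Lemma central_shift h i : (i.+1 < N h)%N ->
  κ (rho h) i z = (n h %| i)%:R * κ h i z.
Proof.
move=> ih; have lh : (0 < 1 < N h)%N by rewrite (leq_ltn_trans _ ih).
have := congr1 (κ h i.+1) (centralP _ zC (P h 1)).
by rewrite coordM_basis// basis_coordM// eqxx mul1r /= !subn1 /= iter_rho_eq.
Qed.

Lemma central_supp h i : (i.+1 < N h)%N -> ~~ (n h %| i)%N -> κ h i z = 0.
Proof.
move=> ih ni; have e : rho (rho^-1 h)%g = h by rewrite permKV.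
have ne : n (rho^-1 h)%g = n h by rewrite -[in RHS]e (half_val_iter 1).
have Ne : N (rho^-1 h)%g = N h by rewrite -[in RHS]e (half_len_iter 1).
have := @central_shift (rho^-1 h)%g i; rewrite e ne Ne => /(_ ih) ->.
by rewrite (negPf ni) mul0r.
Qed.

Lemma central_rho h j : (j * n h < N h)%N -> κ (rho h) (j * n h) z = κ h (j * n h) z.
Proof.
move=> jh; have [lt|] := ltnP (j * n h).+1 (N h).
  by rewrite central_shift// dvdn_mull// mul1r.
(* In the remaining case n divides both N and N - 1, so n = 1 and [rho] fixes h. *)
move=> ge; have e : N h = (j * n h).+1 by apply/eqP; rewrite eqn_leq ge jh.
suff -> : rho h = h by [].
apply/eqP; rewrite (iter_rho_eq 1); have : (n h %| N h)%N by rewrite half_lenE dvdn_mull.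
by rewrite e -addn1 dvdn_addr// dvdn_mull.
Qed.

Lemma central_root g h j : root g = root h -> (j * n h < N h)%N ->
  κ g (j * n h) z = κ h (j * n h) z.
Proof.
move/eqP/root_eqP=> [l _ ->] jh; elim: l => //= l <-.
by have := @central_rho (iter l rho h) j; rewrite half_val_iter half_len_iter; apply.
Qed.

Lemma central_const g h : κ g 0 z = κ h 0 z.
Proof.
apply: (@half_const G k (fun h => κ h 0 z)) => {g}h; first exact: coord_iota.
by have := @central_rho h 0; rewrite mul0n half_len_gt0; apply.
Qed.

End Central.

(** One turn around v from each of its half-edges; only for m_v > 1 is this shorter than N and not a
    socle element. *)
Definition vertex_elt v : A := \sum_(h | root h == v) P h (n h).

Lemma lt_val_len h : (n h < N h)%N = (1 < bg_mult (root h))%N.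
Proof. by rewrite half_lenE -{1}[n h]mul1n ltn_pmul2r// half_val_gt0. Qed.

Section VertexElement.
Variable v : V.
Hypothesis mv : (1 < bg_mult v)%N.

Lemma vertex_elt_coord g j :
  κ g j (vertex_elt v) = ((root g == v) && (j == n g)%N)%:R.
Proof.
have [jg|gj] := ltnP j (N g); last first.
  rewrite coord_big//; case: eqP => //= e; case: eqP => // jn.
  by move: gj; rewrite jn leqNgt lt_val_len e mv.
rewrite coord_sum; under eq_bigr => h /eqP hv.
  rewrite coord_basis; last by rewrite ltnW// lt_val_len hv.
  rewrite eqn0Ngt half_val_gt0 /= (ltn_eqF (_ : n h < N h)%N) ?lt_val_len ?hv//=; over.
case: (eqVneq (root g) v) => [gv|gv] /=.
  rewrite (bigD1 g) ?gv ?eqxx//= andbT big1 ?addr0// => h /andP[_].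
  by rewrite eq_sym => /negPf->; rewrite andbF.
rewrite big1// => h hv; case: (eqVneq g h) => [e|_]; last by rewrite andbF.
by rewrite e hv in gv.
Qed.

Lemma vertex_elt_soc g : τ g (vertex_elt v) = 0.
Proof.
rewrite soc_coord_sum big1// => h /eqP hv.
by rewrite soc_basis_lt// lt_val_len hv.
Qed.

Lemma vertex_coordM g j x : (j < N g)%N -> κ g j (vertex_elt v * x) =
  ((root g == v) && (n g <= j)%N)%:R * κ g (j - n g) x.
Proof.
move=> jg; rewrite coordM//; under eq_bigr do rewrite vertex_elt_coord root_iter half_val_iter.
case: (leqP (n g) j) => [nj|jn]; last first.
  rewrite andbF mul0r big1// => a _; case: (_ =P n g) => [e|_]; last by rewrite andbF mul0r.
  by move: jn; rewrite -e ltnNge leq_subr.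
have lt : (j - n g < j.+1)%N by rewrite ltnS leq_subr.
rewrite (bigD1 (Ordinal lt))//= subKn// eqxx big1 ?addr0// => a na.
case: (_ =P n g) => [e|_]; last by rewrite andbF mul0r.
by case/eqP: na; apply: val_inj; rewrite /= -e subKn// -ltnS.
Qed.

Lemma coordM_vertex g j x : (j < N g)%N -> κ g j (x * vertex_elt v) =
  ((root g == v) && (n g <= j)%N)%:R * κ g (j - n g) x.
Proof.
move=> jg; rewrite coordM//; under eq_bigr do rewrite vertex_elt_coord mulrC.
case: (leqP (n g) j) => [nj|jn]; last first.
  rewrite andbF mul0r big1// => a _; case: (_ =P n g) => [e|_]; last by rewrite andbF mul0r.
  by move: (ltn_ord a); rewrite e ltnS leqNgt jn.
rewrite (bigD1 (Ordinal (nj : (n g < j.+1)%N)))//= eqxx iter_val big1 ?addr0// => a na.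
case: (_ =P n g) => [e|_]; last by rewrite andbF mul0r.
by case/eqP: na; apply: val_inj.
Qed.

Lemma conv_vertex g x : conv cA g (vertex_elt v) x =
  (root g == v)%:R * κ g (N g - n g) x.
Proof.
rewrite /conv; under eq_bigr do rewrite vertex_elt_coord root_iter half_val_iter.
have nN : (n g <= N g)%N by rewrite half_lenE leq_pmull// bg_mult_gt0.
have lt : (N g - n g < (N g).+1)%N by rewrite ltnS leq_subr.
rewrite (bigD1 (Ordinal lt))//= subKn// eqxx andbT big1 ?addr0// => a na.
case: (_ =P n g) => [e|_]; last by rewrite andbF mul0r.
by case/eqP: na; apply: val_inj; rewrite /= -e subKn// -ltnS.
Qed.

Lemma vconv_vertex g x : conv cA g x (vertex_elt v) =
  (root g == v)%:R * κ g (N g - n g) x.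
Proof.
rewrite /conv; under eq_bigr do rewrite vertex_elt_coord mulrC.
have nN : (n g < (N g).+1)%N by rewrite ltnS half_lenE leq_pmull// bg_mult_gt0.
rewrite (bigD1 (Ordinal nN))//= eqxx andbT iter_val big1 ?addr0// => a na.
case: (_ =P n g) => [e|_]; last by rewrite andbF mul0r.
by case/eqP: na; apply: val_inj.
Qed.

Lemma vertex_coord0 g : κ g 0 (vertex_elt v) = 0.
Proof. by rewrite vertex_elt_coord [(0 == _)%N]eq_sym eqn0Ngt half_val_gt0 andbF. Qed.

Lemma vertex_socM g x : τ g (vertex_elt v * x) =
  (root g == v)%:R * κ g (N g - n g) x +
  (root (iota_ g) == v)%:R * κ (iota_ g) (N (iota_ g) - n (iota_ g)) x.
Proof.
by rewrite soc_coord_mul vertex_coord0 vertex_elt_soc !mul0r !addr0 !conv_vertex.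
Qed.

Lemma vertex_central : vertex_elt v \in @central k A.
Proof.
apply/centralP => x; apply: (coord_ext (cA := cA)) => [g j jg|g].
  by rewrite vertex_coordM// coordM_vertex.
rewrite vertex_socM soc_coord_mul vertex_coord0 vertex_elt_soc !mulr0 !addr0.
by rewrite !vconv_vertex.
Qed.

Lemma vertex_exp_coord g j e : (j < N g)%N ->
  κ g j (vertex_elt v ^+ e.+1) = ((root g == v) && (j == e.+1 * n g)%N)%:R.
Proof.
elim: e j => [|e IH] j jg; first by rewrite expr1 mul1n vertex_elt_coord.
rewrite exprS vertex_coordM// IH; last by rewrite (leq_ltn_trans (leq_subr _ _)).
rewrite -natrM mulnb; congr (nat_of_bool _)%:R; case: eqP => //= _.
rewrite [(e.+2 * _)%N]mulSn; case: leqP => [nj|jn] /=.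
  by rewrite -(eqn_add2l (n g)) subnKC.
by apply/esym/negP => /eqP e'; move: jn; rewrite e' ltnNge leq_addr.
Qed.

End VertexElement.

Lemma vertex_orth v w : (1 < bg_mult v)%N -> (1 < bg_mult w)%N -> v != w ->
  vertex_elt v * vertex_elt w = 0.
Proof.
move=> mv mw vw; have z g j : (root g == v)%:R * κ g j (vertex_elt w) = 0.
  rewrite vertex_elt_coord//; case: eqP => [->|_]; last by rewrite mul0r.
  by rewrite (negPf vw) mulr0.
apply: (coord_ext (cA := cA)) => [g j jg|g].
  rewrite vertex_coordM// coord0; case: (_ <= _)%N; last by rewrite andbF mul0r.
  by rewrite andbT z.
by rewrite vertex_socM// !z soc_coord0 addr0.
Qed.

(* The classes of these central elements generate the socle of the stable
   center (unless the latter is k): they are the combinations of X_v^(m_v - 1)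
   (m_v > 1), of closed paths of length N - 1, and of socle elements. *)
Definition small z : Prop := (forall h, κ h 0 z = 0) /\
  (forall h l, (l.+1 < N h)%N -> l != (N h - n h)%N -> κ h l z = 0).

Section SmallProduct.
Variables z u : A.
Hypotheses (zC : z \in @central k A) (uC : u \in @central k A).
Hypotheses (zs : small z) (u0 : forall h, κ h 0 u = 0).

(** For a > 1 smallness of z kills the term unless a = n < N, which forces m > 1. For a = 1
    centrality of u kills it unless n = 1 or N = 2. The second hypothesis rules out these
    exceptions. *)
Lemma small_term h a : (0 < a < N h)%N ->
  (if (1 < bg_mult (root h))%N then a != n h else N h != 2) ->
  κ (iter a rho h) (N h - a) z * κ h a u = 0.
Proof.
case/andP=> a0 aN; have [a2|a1] := ltnP 1 a.
  case: (boolP (N h - a == N h - n h)%N) => [e|ne _]; last first.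
    case: zs => _ /(_ (iter a rho h) (N h - a)%N) ->; rewrite ?mul0r// half_len_iter.
      by move: aN a2; clear; lia.
    by rewrite half_val_iter.
  have nN : (n h <= N h)%N by rewrite half_lenE leq_pmull// bg_mult_gt0.
  have an : a = n h by move: e aN nN => /eqP; clear; lia.
  by rewrite an eqxx -lt_val_len -an aN.
have e1 : a = 1%N by lia.
rewrite {}e1 in aN *; have N1 := aN.
move=> cond; have [N2|] := ltnP 2 (N h).
  have [n1|n1] := boolP (n h %| 1)%N; last by rewrite (central_supp uC)// mulr0.
  move: cond; rewrite -lt_val_len; move: n1; rewrite dvdn1 => /eqP ->.
  by rewrite N1 eqxx.
move=> N2; have {N1 N2} e2 : N h = 2 by lia.
move: cond; rewrite e2 /=; case: ifP => // m1.
have := half_lenE h; rewrite e2; have := half_val_gt0 h; move: m1.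
by case: (n h) => [|[|x]]//; nia.
Qed.

Lemma conv_single h x y a0 : κ h 0 y = 0 -> (0 < a0 < N h)%N ->
  (forall a, (0 < a < N h)%N -> a != a0 -> κ (iter a rho h) (N h - a) x * κ h a y = 0) ->
  conv cA h x y = κ (iter a0 rho h) (N h - a0) x * κ h a0 y.
Proof.
move=> y0 /andP[a00 a0N] t0; have lt : (a0 < (N h).+1)%N by exact: ltnW.
rewrite /conv (bigD1 (Ordinal lt))//= big1 ?addr0// => a na.
have [aN|aN] := ltnP a (N h).
  case: (posnP a) => [->|agt]; first by rewrite y0 mulr0.
  by apply: t0; rewrite ?agt//; apply: contra na => /eqP e; apply/eqP/val_inj.
by rewrite [κ h a y]coord_big// mulr0.
Qed.

Lemma conv_none h x y : κ h 0 y = 0 ->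
  (forall a, (0 < a < N h)%N -> κ (iter a rho h) (N h - a) x * κ h a y = 0) ->
  conv cA h x y = 0.
Proof.
move=> y0 t0; rewrite /conv big1// => a _; have [aN|aN] := ltnP a (N h).
  case: (posnP a) => [->|agt]; first by rewrite y0 mulr0.
  by apply: t0; rewrite agt.
by rewrite [κ h a y]coord_big// mulr0.
Qed.

Lemma small_term_sym h a : (0 < a < N h)%N ->
  (if (1 < bg_mult (root h))%N then a != (N h - n h)%N else N h != 2) ->
  κ (iter a rho h) (N h - a) u * κ h a z = 0.
Proof.
move=> aN cond; have := @small_term (iter a rho h) (N h - a).
have aN' : (a <= N h)%N by case/andP: aN => _ /ltnW.
rewrite half_len_iter half_val_iter root_iter -iterD subnK// iter_len subKn// mulrC.
apply.
  by move: aN; clear; lia.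
case: ifP cond => // m1 aNn; have := lt_val_len h; rewrite m1 => nN.
apply: contra aNn => /eqP e; apply/eqP; move: aN nN e; clear; lia.
Qed.

Lemma iter_len_sub_val h : iter (N h - n h) rho h = h.
Proof. by apply/eqP; rewrite iter_rho_eq dvdn_sub// half_lenE dvdn_mull. Qed.

Lemma small_conv h : conv cA h z u =
  if (1 < bg_mult (root h))%N then κ h (N h - n h) z * κ h (n h) u
  else if N h == 2 then κ (rho h) 1 z * κ h 1 u else 0.
Proof.
case: ifP => m1.
  rewrite (conv_single (a0 := n h)) ?iter_val ?half_val_gt0 ?lt_val_len ?m1// => a aN ne.
  by apply: small_term => //; rewrite m1.
case: ifP => [/eqP e2|/negbT N2].
  by rewrite (conv_single (a0 := 1%N)) ?e2// => -[|[|a]].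
by apply: conv_none => // a aN; apply: small_term => //; rewrite m1.
Qed.

Lemma small_conv_sym h : conv cA h u z =
  if (1 < bg_mult (root h))%N then κ h (N h - n h) z * κ h (n h) u
  else if N h == 2 then κ (rho h) 1 u * κ h 1 z else 0.
Proof.
have z0 := zs.1 h; case: ifP => m1.
  have nN : (n h < N h)%N by rewrite lt_val_len.
  have n0 := half_val_gt0 h.
  rewrite (conv_single (a0 := (N h - n h)%N)) ?iter_len_sub_val//.
  - by rewrite subKn 1?ltnW// mulrC.
  - by move: n0 nN; clear; lia.
  - by move=> a aN ne; apply: small_term_sym => //; rewrite m1.
case: ifP => [/eqP e2|/negbT N2].
  by rewrite (conv_single (a0 := 1%N)) ?e2// => -[|[|a]].
by apply: conv_none => // a aN; apply: small_term_sym => //; rewrite m1.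
Qed.

(** As u has no constant term, z enters with length below N - 1, hence with length N - n; then u
    enters with a length strictly between 0 and n, where central elements have coefficient 0. *)
Lemma small_coordM h j : κ h j (z * u) = 0.
Proof.
have [jN|] := ltnP j (N h); last exact: coord_big.
rewrite coordM// big1// => a _; have aj : (a <= j)%N by rewrite -ltnS.
case: (posnP a) => [->|a0]; first by rewrite u0 mulr0.
case: (boolP (j - a == N h - n h)%N) => [/eqP e|ne]; last first.
  case: zs => _ /(_ (iter a rho h) (j - a)%N) ->; rewrite ?mul0r// half_len_iter.
    by move: jN aj a0; clear; lia.
  by rewrite half_val_iter.
have [n1|n1] := boolP (1 < bg_mult (root h))%N; last first.
  have -> : (j - a = 0)%N.
    rewrite e half_lenE; case: (bg_mult (root h)) n1 (bg_mult_gt0 (root h)) => [|[|]]// _ _.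
    by rewrite mul1n subnn.
  by rewrite zs.1 mul0r.
have nN : (n h < N h)%N by rewrite lt_val_len.
have an : (a < n h)%N by move: e jN nN aj; clear; lia.
rewrite (central_supp uC) ?mulr0//; first by move: an nN; clear; lia.
by apply/negP => /dvdn_leq; rewrite a0 leqNgt an => /(_ isT).
Qed.

(* When m_v = 1 and val v = 2, [conv h z u] is not a function of the vertex of h,
   but its symmetrization is. *)
Definition sym_conv h : k := 2%:R^-1 * (conv cA h z u + conv cA h u z).

(** For m > 1 only lengths divisible by n occur, and [central_rho] applies to both factors. For m =
    1 and N = 2 the rotation interchanges the two convolutions. *)
Lemma sym_conv_rho h : sym_conv (rho h) = sym_conv h.
Proof.
rewrite /sym_conv !small_conv !small_conv_sym root_rho.
rewrite (half_len_iter 1) (half_val_iter 1); case: ifP => m1.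
  have nN : (n h < N h)%N by rewrite lt_val_len.
  have e : (N h - n h = (bg_mult (root h)).-1 * n h)%N.
    by rewrite half_lenE -subn1 mulnBl mul1n.
  rewrite e (central_rho zC); last by rewrite -e ltn_subrL half_val_gt0 half_len_gt0.
  by have := @central_rho _ uC h 1; rewrite !mul1n => ->.
case: ifP => [/eqP e2|//]; congr (_ * _).
have -> : rho (rho h) = h by have := iter_len h; rewrite e2.
by rewrite addrC mulrC [X in _ + X]mulrC.
Qed.

End SmallProduct.

Lemma small_mul_proj (z u : center A) : small (val z) -> (forall h, κ h 0 (val u) = 0) ->
  proj_center_pred (z * u).
Proof.
move=> zs u0; have zC := valP z; have uC := valP u.
have valM : val (z * u) = val z * val u by rewrite rmorphM.
pose F := sym_conv (val z) (val u).
(* As [F] is constant on [rho]-orbits, it is a function of the vertex, read off at a chosen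
   half-edge. *)
pose f v : k := F (sval (cid (root_surj v))).
have Ff h : F h = f (root h).
  rewrite /f; case: cid => g /= /esym/eqP/root_eqP[l _ ->].
  by elim: l => //= l <-; apply: sym_conv_rho.
have z0 := zs.1.
apply: (@proj_center_soc _ _ char0 _ cA _ f) => [g j|g].
  by rewrite valM; apply: small_coordM.
have half c : c = 2%:R^-1 * (c + c) :> k.
  by rewrite mulrDr -mulrDl half_half// mul1r.
(* Centrality lets zu be replaced by the mean of zu and uz, which produces the symmetrized
   convolutions. *)
rewrite -!Ff valM [LHS]half {2}(centralP _ zC) !soc_coord_mul !z0 !u0 !mul0r !mulr0 !addr0.
by rewrite /F /sym_conv -mulrDr addrACA.
Qed.

End CenterCoordinates.

(** * The stable center modulo its socle *)

Section QuotientIso.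
Variables (k : pzRingType) (K B : pzAlgType k) (I : ideal K) (f : {rmorphism K -> B}).
Hypothesis f_kcst : forall c, f (kcst c) = kcst c.
Hypothesis f_surj : forall b, exists x, f x = b.
Hypothesis f_ker : forall x, f x = 0 <-> I x.

Let lift (b : B) : K := sval (cid (f_surj b)).
Let liftK b : f (lift b) = b. Proof. exact: svalP (cid (f_surj b)). Qed.

Definition quotient_lift (b : B) : quotient I := quot_pi I (lift b).

Lemma quotient_liftP b x : f x = b -> quotient_lift b = quot_pi I x.
Proof. by move=> fx; apply/quot_piP/f_ker; rewrite rmorphB liftK fx subrr. Qed.

Lemma quotient_liftB : zmod_morphism quotient_lift.
Proof.
move=> a b; rewrite (quotient_liftP (x := lift a - lift b)).
  exact: (raddfB (quot_pi I)).
by rewrite rmorphB !liftK.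
Qed.

Lemma quotient_liftM : monoid_morphism quotient_lift.
Proof.
split=> [|a b]; first by rewrite (quotient_liftP (x := 1)) ?rmorph1.
rewrite (quotient_liftP (x := lift a * lift b)).
  exact: (rmorphM (quot_pi I)).
by rewrite rmorphM !liftK.
Qed.

HB.instance Definition _ :=
  GRing.isZmodMorphism.Build B (quotient I) quotient_lift quotient_liftB.
HB.instance Definition _ :=
  GRing.isMonoidMorphism.Build B (quotient I) quotient_lift quotient_liftM.

Lemma quotient_alg_iso : alg_iso B (quotient I).
Proof.
exists quotient_lift; split=> [c|].
  exact: (quotient_liftP (f_kcst c)).
have inv (u : quotient I) : {b | quotient_lift b = u}.
  by exists (f (repr u)%qT); rewrite (quotient_liftP (x := (repr u)%qT)) ?quot_reprK.
exists (fun u => sval (inv u)) => [b|u]; last exact: svalP (inv u).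
have := svalP (inv (quotient_lift b)) => /quot_piP/f_ker.
by rewrite rmorphB !liftK => /eqP; rewrite subr_eq0 => /eqP.
Qed.

End QuotientIso.

Section Kernel.
Variables (k : pzRingType) (K B : pzAlgType k) (f : {rmorphism K -> B}).

Lemma kernel0 : f 0 = 0. Proof. exact: raddf0. Qed.
Lemma kernelD p q : f p = 0 -> f q = 0 -> f (p + q) = 0.
Proof. by move=> fp fq; rewrite raddfD /= fp fq addr0. Qed.
Lemma kernelMl p q : f q = 0 -> f (p * q) = 0.
Proof. by move=> fq; rewrite rmorphM /= fq mulr0. Qed.
Lemma kernelMr p q : f q = 0 -> f (q * p) = 0.
Proof. by move=> fq; rewrite rmorphM /= fq mul0r. Qed.

Definition kernel : ideal K :=
  Ideal (ideal_pred := fun p => f p = 0) kernel0 kernelD kernelMl kernelMr.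

Lemma gen_ideal_kernel (S : K -> Prop) p :
  (forall s, S s -> f s = 0) -> gen_ideal S p -> f p = 0.
Proof. by move=> fS /(_ kernel); apply. Qed.

Lemma kernelB p q : f (p - q) = 0 -> f p = 0 -> f q = 0.
Proof.
by rewrite raddfB /= => e fp; move: e; rewrite fp sub0r => /eqP; rewrite oppr_eq0 => /eqP.
Qed.

End Kernel.

(** * Socles of commutative algebras *)

Section CommutativeSocle.
Variables (k : fieldType) (B : pzAlgType k).
Hypothesis mulC : forall x y : B, x * y = y * x.

(** For a minimal ideal L, the ideal n L is 0 or L; in the second case L = n^e L = 0. *)
Lemma nilpotent_socle (n x : B) e : n ^+ e = 0 -> socle_pred x -> n * x = 0.
Proof.
move=> ne xs; apply: (xs (fun x => n * x = 0)).
  split=> [|u v nu nv|a u nu]; first by rewrite mulr0.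
    by rewrite mulrDr nu nv addr0.
  by rewrite mulrA [n * a]mulC -mulrA nu mulr0.
move=> L [[L0 LD LM] _ Lmin] y Ly.
have lN : left_ideal (fun v => exists2 u, L u & v = n * u).
  split=> [|_ _ [u Lu ->] [v Lv ->]|a _ [u Lu ->]].
  - by exists 0; rewrite ?mulr0.
  - by exists (u + v); rewrite ?mulrDr//; apply: LD.
  - by exists (a * u); [apply: LM|rewrite mulrA [a * n]mulC mulrA].
have [|N0|LN] := Lmin _ lN; first by move=> _ [u Lu ->]; apply: LM.
  by apply: N0; exists y.
have deep i : exists2 u, L u & y = n ^+ i * u.
  elim: i => [|i [u Lu ->]]; first by exists y; rewrite ?expr0 ?mul1r.
  by have [w Lw ->] := LN u Lu; exists w; rewrite // exprSr mulrA.
by have [u _ ->] := deep e; rewrite ne mul0r mulr0.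
Qed.

(** The multiples of x by scalars form an ideal of dimension at most 1, which is minimal unless x =
    0. *)
Lemma line_socle (x : B) :
  (forall b : B, exists c : k, b * x = kcst c * x) -> socle_pred x.
Proof.
move=> line; have [->|x0] := eqVneq x 0; first exact: socle0.
move=> N _ /(_ (fun y => exists c, y = kcst c * x)); apply; last first.
  by exists 1; rewrite kcst1 mul1r.
have lx : left_ideal (fun y => exists c : k, y = kcst c * x).
  split=> [|_ _ [c ->] [d ->]|a _ [c ->]].
  - by exists 0; rewrite kcst0 mul0r.
  - by exists (c + d); rewrite kcstD mulrDl.
  - by have [d e] := line (a * kcst c); exists d; rewrite mulrA.
split=> //; first by exists x => //; exists 1; rewrite kcst1 mul1r.
move=> M [_ _ MM] ML; have [[y [My y0]]|none] := pselect (exists y, M y /\ y != 0).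
  right=> _ [d ->]; have [c yE] := ML y My.
  have c0 : c != 0 by apply: contraNneq y0 => c0; rewrite yE c0 kcst0 mul0r.
  rewrite -[d](mulfVK c0) kcstM -mulrA -yE; exact: MM.
by left=> y My; apply/eqP; apply/negPn/negP => y0; apply: none; exists y.
Qed.

End CommutativeSocle.

Section StableCenter.
Variables (G : brauerGraph) (k : fieldType) (char0 : [pchar k] =i pred0).
Variables (A : pzAlgType k) (cA : coordinates G A).
Notation H := (rg_half G).
Notation V := (rg_vertex G).
Notation N := (@half_len G).
Notation κ := (coord cA).
Notation Z := (center A).
Notation Zst := (stable_center A).
Notation st := (quot_pi (proj_center A)).
Implicit Types (z u : Z).

Lemma coord_kcst h l c : κ h l (kcst c) = c * (l == 0%N)%:R.
Proof. by have := coordZ cA h l c 1; rewrite mulr1 coord1. Qed.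

Lemma st_mulC (x y : Zst) : x * y = y * x.
Proof.
elim/quot_piW: x => x; elim/quot_piW: y => y.
apply: etrans (esym (rmorphM st x y)) _; rewrite center_mulC.
exact: (rmorphM st y x).
Qed.

Lemma st0 z : st z = 0 <-> proj_center_pred z.
Proof.
have e := quot_piP (proj_center A) z 0; rewrite subr0 in e.
by apply: iff_trans e; rewrite (raddf0 st).
Qed.

Lemma center_split z : exists c u, z = kcst c + u /\ forall h, κ h 0 (val u) = 0.
Proof.
(* The empty graph is not excluded by the definition; without half-edges the condition on u is
   vacuous. *)
have zC := valP z; have [[h0 _]|none] := pselect (exists h : H, True); last first.
  exists 0, z; split=> [|h]; first by rewrite kcst0 add0r.
  by case: none; exists h.
exists (κ h0 0 (val z)), (z - kcst (κ h0 0 (val z))); split=> [|h].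
  by rewrite addrC subrK.
rewrite raddfB coordD coordN (central_const cA zC h h0) (coord_kcst h 0).
by rewrite mulr1 subrr.
Qed.

Lemma small_socle z : small cA (val z) -> socle_pred (st z).
Proof.
move=> zs; apply: line_socle => b; elim/quot_piW: b => w.
have [c [u [-> u0]]] := center_split w; exists c.
have p : st (u * z) = 0.
  by apply/st0; rewrite center_mulC; exact: (small_mul_proj char0 zs u0).
have -> : st (kcst c + u) * st z = st (kcst c * z) + st (u * z).
  apply: etrans (esym (rmorphM st _ _)) _; rewrite mulrDl.
  exact: (raddfD st).
rewrite p; apply: etrans (addr0 _) _; exact: (rmorphM st).
Qed.

End StableCenter.
Local Notation "{ 'mpoly' T [ n ] }" := (mpoly n T) : type_scope.

Section Evaluation.
Variables (k : fieldType) (K : pzAlgType k) (n : nat) (X : 'I_n -> K).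
Hypothesis mulC : commutative (@GRing.mul K).
Hypothesis K1 : (1 : K) != 0.

Lemma mpoly_eval_ex : exists f : {rmorphism {mpoly k[n]} -> K},
  (forall c, f (kcst c) = kcst c) /\ forall i, f 'X_i = X i.
Proof.
(* [mmap] evaluates in a nonzero ring, while algebras here may be 0; the two hypotheses supply the
   missing structure on K. *)
pose S : comNzRingType := HB.pack (PzAlgebra.sort K)
  (GRing.PzSemiRing_isNonZero.Build K K1) (GRing.PzRing_hasCommutativeMul.Build K mulC).
pose e : k -> S := @kcst k K.
pose eR : {rmorphism k -> S} := HB.pack e
  (GRing.isZmodMorphism.Build k S e (raddfB (@kcst k K)))
  (GRing.isMonoidMorphism.Build k S e (conj (rmorph1 (@kcst k K)) (rmorphM (@kcst k K)))).
pose ev : {mpoly k[n]} -> K := mmap eR (X : 'I_n -> S).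
have evB : zmod_morphism ev by move=> p q; apply: (raddfB (mmap eR (X : 'I_n -> S))).
have evM : monoid_morphism ev.
  split; first exact: (rmorph1 (mmap eR (X : 'I_n -> S))).
  exact: (rmorphM (mmap eR (X : 'I_n -> S))).
pose F : {rmorphism {mpoly k[n]} -> K} := HB.pack ev
  (GRing.isZmodMorphism.Build {mpoly k[n]} K ev evB)
  (GRing.isMonoidMorphism.Build {mpoly k[n]} K ev evM).
exists F; split=> [c|i].
  exact: (mmapC _ eR).
by change (mmap eR (X : 'I_n -> S) 'X_i = X i :> S); rewrite mmapX mmap1U.
Qed.

End Evaluation.

(** * Normal forms modulo the fan relations *)

Section FanNormalForm.
Variables (k : fieldType) (n : nat) (m : 'I_n -> nat).
Notation I := (gen_ideal (@fan_rel k n m)).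

(** The exponents run from 1 to m_i - 2, since X_i^(m_i - 1) is a relation; the range is empty for
    m_i = 2. *)
Definition fan_form (c0 : k) (c : 'I_n -> nat -> k) : {mpoly k[n]} :=
  kcst c0 + \sum_i \sum_(j < m i - 2) kcst (c i j) * 'X_i ^+ j.+1.

Lemma fan_formD c0 c d0 d : fan_form c0 c + fan_form d0 d =
  fan_form (c0 + d0) (fun i j => c i j + d i j).
Proof.
rewrite /fan_form kcstD addrACA; congr (_ + _).
rewrite -big_split; apply: eq_bigr => i _; rewrite -big_split; apply: eq_bigr => j _.
by rewrite /= kcstD mulrDl.
Qed.

Lemma fan_formZ a c0 c : kcst a * fan_form c0 c =
  fan_form (a * c0) (fun i j => a * c i j).
Proof.
rewrite /fan_form mulrDr kcstM mulr_sumr; congr (_ + _).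
apply: eq_bigr => i _; rewrite mulr_sumr; apply: eq_bigr => j _.
by rewrite kcstM mulrA.
Qed.

Lemma fan_normal_form (p : {mpoly k[n]}) : exists c0 c, I (p - fan_form c0 c).
Proof.
have zero : fan_form 0 (fun _ _ => 0) = 0.
  rewrite /fan_form kcst0 add0r big1// => i _.
  by rewrite big1// => j _; rewrite ?kcst0 mul0r.
rewrite [p]mpolyE; elim/big_rec: _ => [|mm q _ [c0 [c Iq]]].
  by exists 0, (fun _ _ => 0); rewrite zero subr0; apply: ideal0.
suff [d0 [d Id]] : exists d0 d, I ('X_[mm] - fan_form d0 d).
  exists (p@_mm * d0 + c0), (fun i j => p@_mm * d i j + c i j).
  rewrite -fan_formD -fan_formZ opprD addrACA; apply: idealD => //.
  rewrite -mul_mpolyC -mulrBr; exact: idealMl.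
have inI q' : I q' -> exists d0 d, I (q' - fan_form d0 d).
  by exists 0, (fun _ _ => 0); rewrite zero subr0.
have [/existsP[i /existsP[j /and3P[ij i0 j0]]]|none] :=
  boolP [exists i, exists j, [&& i != j, mm i != 0 & mm j != 0]]%N.
  apply: inI; rewrite mpolyXE_id (bigD1 i)//= (bigD1 j) 1?eq_sym//= mulrA.
  apply: gen_idealMr; rewrite -(prednK (n := mm i)) ?lt0n// -(prednK (n := mm j)) ?lt0n//.
  rewrite !exprS mulrACA; apply: gen_idealMr => J; apply.
  exact: FanMul.
have [/existsP[i i0]|all0] := boolP [exists i, mm i != 0]%N; last first.
  exists 1, (fun _ _ => 0); rewrite mpolyXE_id big1 => [|i _].
    rewrite (_ : fan_form _ _ = 1) ?subrr; first exact: ideal0.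
    rewrite -[RHS]addr0 -zero /fan_form kcst0 add0r kcst1; by [].
  move/existsPn/(_ i): all0; rewrite negbK => /eqP ->; exact: expr0.
have e : 'X_[mm] = 'X_i ^+ mm i :> {mpoly k[n]}.
  rewrite mpolyXE_id (bigD1 i)//= big1 ?mulr1// => j ji.
  move/existsPn/(_ i)/existsPn/(_ j): none; rewrite eq_sym ji i0 /= negbK => /eqP->.
  exact: expr0.
rewrite e; have [big|small] := leqP (m i - 1) (mm i).
  by apply: inI; rewrite -(subnK big) exprD; apply: gen_idealMl => J; apply; apply: FanPow.
exists 0, (fun i' j => ((i' == i) && (j.+1 == mm i))%:R).
rewrite (_ : fan_form 0 _ = 'X_i ^+ mm i) ?subrr; first exact: ideal0.
rewrite /fan_form kcst0 add0r (bigD1 i)//= [X in _ + X]big1 ?addr0 => [|i' ii]; last first.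
  by rewrite big1// => j _; rewrite (negPf ii) kcst0 mul0r.
have lt : ((mm i).-1 < m i - 2)%N by move: small i0; clear; lia.
rewrite (bigD1 (Ordinal lt))//= eqxx prednK ?lt0n// eqxx kcst1 mul1r big1 ?addr0 => [//|j nj].
case: eqP => [ej|_]; last by rewrite andbF kcst0 mul0r.
by case/eqP: nj; apply: val_inj; rewrite /= -ej.
Qed.

End FanNormalForm.

Lemma bijective_kcst_iso (k : fieldType) (B : pzAlgType k) :
  (forall b : B, exists c : k, b = kcst c) ->
  (forall c : k, kcst c = 0 :> B -> c = 0) -> alg_iso B k^o.
Proof.
move=> surj inj; pose g (b : B) : k^o := sval (cid (surj b)).
have gK b : kcst (g b : k) = b by apply: esym; apply: (svalP (cid (surj b))).
have kB (c d : k) : kcst (c - d) = kcst c - kcst d :> B by exact: (raddfB (@kcst k B)).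
have kI (c d : k) : kcst c = kcst d :> B -> c = d.
  move=> e; apply/eqP; rewrite -subr_eq0; apply/eqP/inj.
  by rewrite kB e subrr.
have gB : zmod_morphism g.
  by move=> a b; apply: kI; rewrite kB !gK.
have gM : monoid_morphism g.
  split=> [|a b]; apply: kI; first by rewrite gK kcst1.
  by rewrite kcstM !gK.
pose F : {rmorphism B -> k^o} := HB.pack g
  (GRing.isZmodMorphism.Build B k^o g gB) (GRing.isMonoidMorphism.Build B k^o g gM).
exists F; split=> [c|]; first by apply: kI; apply: gK.
by exists (fun c : k^o => kcst (c : k)) => [b|c]; [apply: gK|apply: kI; apply: gK].
Qed.

Lemma kcst_reg (k : fieldType) (B : pzAlgType k) (c : k) (x : B) :
  c != 0 -> kcst c * x = 0 -> x = 0.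
Proof. by move=> c0 e; rewrite -[x]mul1r -kcst1 -(mulVf c0) kcstM -mulrA e mulr0. Qed.

(** * The two cases of the theorem *)

Section Final.
Variables (G : brauerGraph) (k : fieldType) (char0 : [pchar k] =i pred0).
Variables (A : pzAlgType k) (cA : coordinates G A).
Notation H := (rg_half G).
Notation V := (rg_vertex G).
Notation root := (@rg_root G).
Notation N := (@half_len G).
Notation n := (@half_val G).
Notation κ := (coord cA).
Notation Z := (center A).
Notation Zst := (stable_center A).
Notation st := (quot_pi (proj_center A)).
Notation B := (quotient (socle Zst)).
Notation pi := (quot_pi (socle Zst)).
Implicit Types (z u : Z).

Lemma pi0_socle (x : Zst) : pi x = 0 <-> socle_pred x.
Proof.
have e := quot_piP (socle Zst) x 0; rewrite subr0 in e.
by apply: iff_trans e; rewrite (raddf0 pi).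
Qed.

(** Here n = N, so every central element without constant term is small, and the radical of the
    stable center has square 0 and lies in the socle. If it is nonzero, the quotient is k; otherwise
    the stable center consists of scalars and is its own socle. *)
Lemma stable_quotient_mult_free : multiplicity_free G ->
  alg_iso B k^o \/ (forall b : B, b = 0).
Proof.
move=> mf; have nN h : n h = N h by rewrite half_lenE mf mul1n.
have small_rad u : (forall h, κ h 0 (val u) = 0) -> small cA (val u).
  move=> u0; split=> // h l lh l0; rewrite (central_supp cA (valP u) lh)//.
  move: l0; rewrite nN subnn -lt0n => l0.
  by apply/negP => /dvdn_leq; rewrite l0 leqNgt ltnW// => /(_ isT).
have [[z [z0 zst]]|none] := pselect (exists z, (forall h, κ h 0 (val z) = 0) /\ st z <> 0).
  left; apply: bijective_kcst_iso => [b|c c0].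
    elim/quot_piW: b => x; elim/quot_piW: x => w.
    have [c [u [-> u0]]] := center_split cA w; exists c.
    have /pi0_socle p := small_socle char0 (small_rad u u0).
    have -> : st (kcst c + u) = st (kcst c) + st u by apply: (raddfD st).
    have -> : pi (st (kcst c) + st u) = pi (st (kcst c)) + pi (st u) by apply: (raddfD pi).
    by rewrite p; apply: addr0.
  (* A nonzero scalar in the socle would annihilate the nilpotent class of z, forcing that class to
     be 0. *)
  apply/eqP/negPn/negP => cn0; apply: zst.
  have zz : st z ^+ 2 = 0.
    have zz0 : st (z * z) = 0.
      by apply/st0; exact: (small_mul_proj char0 (small_rad z z0) z0).
    exact: etrans (esym (rmorphM st z z)) zz0.
  have c0' : socle_pred (kcst c : Zst) by apply/pi0_socle.
  apply: (kcst_reg cn0); apply: etrans (kcstC c (st z)) _.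
  exact: (nilpotent_socle (@st_mulC k A) zz c0').
right=> b; elim/quot_piW: b => x; apply/pi0_socle.
suff one : socle_pred (1 : Zst).
  by rewrite -[x](mulr1 x); apply: socleMl.
apply: line_socle => y; elim/quot_piW: y => w.
have [c [u [-> u0]]] := center_split cA w; exists c.
have su : st u = 0 by apply/eqP/negPn/negP => /eqP su; apply: none; exists u.
have -> : st (kcst c + u) = st (kcst c) + st u by apply: (raddfD st).
by rewrite su; congr (_ * _); apply: addr0.
Qed.

Variables (r r' : nat) (le_r'r : (r' <= r)%N) (x : 'I_r -> V).
Hypothesis x_bij : bijective x.
Hypothesis mult_gt1 : forall i : 'I_r, (i < r')%N -> (1 < bg_mult (x i))%N.
Hypothesis mult_eq1 : forall i : 'I_r, (r' <= i)%N -> bg_mult (x i) = 1%N.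

Let v_ (i : 'I_r') : V := x (widen_ord le_r'r i).
Let m_ i : nat := bg_mult (v_ i).

Lemma mult_v i : (1 < m_ i)%N.
Proof. by apply: mult_gt1; apply: (ltn_ord i). Qed.

Lemma v_inj : injective v_.
Proof.
move=> i j /(bij_inj x_bij) e; apply: val_inj.
by have := congr1 val e.
Qed.

Lemma v_surj (v : V) : (1 < bg_mult v)%N -> exists i, v = v_ i.
Proof.
have [y yK xK] := x_bij; move=> mv; have [ly|ly] := ltnP (y v) r'.
  by exists (Ordinal ly); rewrite /v_ -[LHS]xK; congr x; apply: val_inj.
by move: mv; rewrite -(xK v) mult_eq1.
Qed.

Definition vertex_center (i : 'I_r') : Z :=
  exist _ (vertex_elt cA (v_ i)) (vertex_central cA (mult_v i)).

Lemma val_mul z u : val (z * u) = val z * val u.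
Proof. by rewrite rmorphM. Qed.

Lemma val_exp z e : val (z ^+ e) = val z ^+ e.
Proof. by elim: e => // e IH; rewrite !exprS val_mul IH. Qed.

Definition center_form (c0 : k) (c : 'I_r' -> nat -> k) : Z :=
  kcst c0 + \sum_i \sum_(j < m_ i - 2) kcst (c i j) * vertex_center i ^+ j.+1.

Lemma val_center_form c0 c : val (center_form c0 c) =
  kcst c0 + \sum_i \sum_(j < m_ i - 2) kcst (c i j) * vertex_elt cA (v_ i) ^+ j.+1.
Proof.
rewrite /center_form raddfD; congr (_ + _).
rewrite raddf_sum; apply: eq_bigr => i _; rewrite raddf_sum; apply: eq_bigr => j _.
by apply: etrans (val_mul _ _) _; rewrite val_exp.
Qed.

Lemma center_form_coord c0 c g l : (l < N g)%N -> κ g l (val (center_form c0 c)) =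
  c0 * (l == 0%N)%:R + \sum_i \sum_(j < m_ i - 2)
     c i j * ((root g == v_ i) && (l == j.+1 * n g)%N)%:R.
Proof.
move=> lg; rewrite val_center_form coordD coord_kcst coord_sum; congr (_ + _).
apply: eq_bigr => i _; rewrite coord_sum; apply: eq_bigr => j _.
by rewrite coordZ vertex_exp_coord//; apply: mult_v.
Qed.

Lemma center_form_coord0 c0 c g : κ g 0 (val (center_form c0 c)) = c0.
Proof.
rewrite center_form_coord ?half_len_gt0// mulr1 big1 ?addr0// => i _.
rewrite big1// => j _; rewrite [(0 == _)%N]eq_sym muln_eq0 /=.
by rewrite eqn0Ngt half_val_gt0 andbF mulr0.
Qed.

Lemma center_form_coord_val c0 c g i j : root g = v_ i -> (j < m_ i - 2)%N ->
  κ g (j.+1 * n g) (val (center_form c0 c)) = c i j.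
Proof.
move=> gi ji; have lg : (j.+1 * n g < N g)%N.
  rewrite half_lenE ltn_pmul2r ?half_val_gt0// gi -/(m_ i).
  by move: ji; clear; lia.
rewrite center_form_coord// muln_eq0 /= eqn0Ngt half_val_gt0 mulr0 add0r.
rewrite (bigD1 i)//= [X in _ + X]big1 => [|i' ii]; last first.
  rewrite big1// => j' _; rewrite gi (inj_eq v_inj) eq_sym (negPf ii) mulr0.
  by [].
rewrite (bigD1 (Ordinal ji))//= gi !eqxx mulr1 big1 ?addr0// => j' nj.
rewrite eqn_pmul2r ?half_val_gt0// eqSS eq_sym [_ == _](_ : _ = false) ?mulr0//.
exact/negbTE.
Qed.

Lemma center_form_coord_zero c0 c g l : (0 < l < N g)%N ->
  (forall i j, (j < m_ i - 2)%N -> root g = v_ i -> l <> (j.+1 * n g)%N) ->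
  κ g l (val (center_form c0 c)) = 0.
Proof.
case/andP=> l0 lg nl; rewrite center_form_coord// eqn0Ngt l0 mulr0 add0r.
rewrite big1// => i _; rewrite big1// => j _; case: eqP => [gi|_]; last by rewrite mulr0.
by case: eqP => [/(nl i j (ltn_ord j) gi)|_]; rewrite ?mulr0.
Qed.

(** The coefficients are read at one chosen half-edge [hv i] of each vertex; by [central_root] the
    choice does not matter. *)
Lemma form_small z : exists c0 c, small cA (val (z - center_form c0 c)).
Proof.
have zC := valP z.
have [[g0 _]|none] := pselect (exists h : H, True); last first.
  by exists 0, (fun _ _ => 0); split=> h; case: none; exists h.
pose hv i := sval (cid (root_surj (v_ i))).
have hvE i : root (hv i) = v_ i by exact: svalP (cid (root_surj (v_ i))).
exists (κ g0 0 (val z)), (fun i j => κ (hv i) (j.+1 * n (hv i)) (val z)).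
have B0 h l y : κ h l (val (z - y)) = κ h l (val z) - κ h l (val y).
  by rewrite raddfB coordD coordN.
have first h : κ h 0 (val (z - center_form (κ g0 0 (val z))
    (fun i j => κ (hv i) (j.+1 * n (hv i)) (val z)))) = 0.
  by rewrite B0 center_form_coord0 (central_const cA zC h g0) subrr.
split=> // h l lh ll; have lN : (l < N h)%N by exact: ltnW.
case: (posnP l) => [-> //|l0]; rewrite B0.
have [/dvdnP[e le]|nl] := boolP (n h %| l)%N; last first.
  rewrite (central_supp cA zC)// center_form_coord_zero ?subrr ?l0//.
  by move=> i j _ _ e; rewrite e dvdn_mull in nl.
case: e le => [|e] le; first by rewrite le in l0.
(* The e + 1 turns stay below N - 1 and are not N - n, so at least two turns are missing; such
   lengths are covered by the form. *)
have em : (e.+2 < bg_mult (root h))%N.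
  rewrite ltnNge leq_eqVlt ltnS; apply/negP => /orP[/eqP me|me].
    by move: ll; rewrite le half_lenE me mulSn addKn eqxx.
  have := leq_mul me (leqnn (n h)); rewrite -half_lenE -le leqNgt.
  by rewrite (ltnW lh).
have [i hi] := v_surj (leq_ltn_trans (isT : 1 <= e.+2)%N em).
have ei : (e < m_ i - 2)%N by move: em; rewrite hi -/(m_ i); clear; lia.
rewrite le (center_form_coord_val _ _ hi ei).
have nn : n (hv i) = n h by apply: eq_half_val; rewrite hvE hi.
have e1 := @central_root _ _ _ cA _ zC (hv i) h e.+1.
by rewrite nn e1 ?subrr ?hvE// -le.
Qed.

Lemma vertex_pow_small i : small cA (val (vertex_center i ^+ (m_ i - 1))).
Proof.
have mi := mult_v i; have -> : (m_ i - 1 = (m_ i - 2).+1)%N by move: mi; clear; lia.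
have c g l : (l < N g)%N -> κ g l (val (vertex_center i ^+ (m_ i - 2).+1)) =
    ((root g == v_ i) && (l == (m_ i - 2).+1 * n g)%N)%:R.
  by move=> lg; rewrite val_exp vertex_exp_coord.
split=> [h|h l lh ll]; rewrite c ?half_len_gt0//; last exact: ltnW.
  by rewrite [(0 == _)%N]eq_sym muln_eq0 /= eqn0Ngt half_val_gt0 andbF.
case: eqP => //= hi; case: eqP => // le; move: ll; rewrite half_lenE hi -/(m_ i).
rewrite le -subSn ?mi// subSS mulnBl mul1n; by rewrite eqxx.
Qed.

(** The power m_i has length N and lies in the socle of A; one more factor kills it. *)
Lemma st_vertex_nilpotent i : st (vertex_center i) ^+ (m_ i).+1 = 0.
Proof.
have e : vertex_center i ^+ (m_ i).+1 = 0.
  apply: val_inj; rewrite val_exp /=.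
  have mi := mult_v i; have [e mE] : exists e, m_ i = e.+1.
    by exists (m_ i).-1; rewrite (prednK (ltnW mi)).
  have c g l : κ g l (vertex_elt cA (v_ i) ^+ m_ i) = 0.
    have [lg|gl] := ltnP l (N g); last exact: coord_big.
    rewrite mE vertex_exp_coord//; case: eqP => //= gi; case: eqP => // le.
    by move: lg; rewrite le half_lenE gi -mE ltnn.
  rewrite exprS; apply: (coord_ext (cA := cA)) => [g l lg|g].
    by rewrite vertex_coordM// c mulr0 coord0.
  by rewrite vertex_socM// !c !mulr0 addr0 soc_coord0.
by apply: etrans (esym (rmorphXn st _ _)) _; rewrite e; apply: (raddf0 st).
Qed.

(** The nilpotent X_v annihilates the socle, so X_v times the form lies in the projective center and
    has no coordinates below length N. Multiplication by X_v adds one turn to each term, and from at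
    most m_v - 2 turns this still stays below N, so every coefficient is detected. *)
Lemma center_form_socle c0 c : (0 < r')%N -> socle_pred (st (center_form c0 c)) ->
  c0 = 0 /\ forall i j, (j < m_ i - 2)%N -> c i j = 0.
Proof.
move=> r0 soc; have key i g l : root g = v_ i -> (n g + l < N g)%N ->
    κ g l (val (center_form c0 c)) = 0.
  move=> gi lg; have p0 : st (vertex_center i * center_form c0 c) = 0.
    apply: etrans (rmorphM st _ _) _.
    exact: (nilpotent_socle (@st_mulC k A) (st_vertex_nilpotent i) soc).
  have /(proj_center_coord char0 cA g (n g + l)) := iffLR (st0 _) p0.
  rewrite val_mul vertex_coordM//; last exact: mult_v.
  by rewrite gi eqxx leq_addr addKn mul1r.
split=> [|i j ji].
  have [g gi] := root_surj (v_ (Ordinal r0)).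
  rewrite -(center_form_coord0 c0 c g); apply: (key _ _ _ gi).
  by rewrite addn0 lt_val_len gi; apply: mult_v.
have [g gi] := root_surj (v_ i).
rewrite -(center_form_coord_val c0 c gi ji); apply: (key _ _ _ gi).
rewrite half_lenE gi -/(m_ i) -mulSn ltn_pmul2r ?half_val_gt0//.
by move: ji; clear; lia.
Qed.

(** Surjectivity is [form_small]. For the kernel it suffices to treat normal forms, whose
    coefficients vanish by [center_form_socle]; their independence modulo the relations is thus read
    off in the stable center. *)
Lemma stable_quotient_fan : ~ multiplicity_free G -> alg_iso B (fan_alg k m_).
Proof.
move=> nmf; have [v mv] : exists v : V, (1 < bg_mult v)%N.
  have [//|none] := pselect (exists v : V, (1 < bg_mult v)%N).
  case: nmf => v; apply/eqP; rewrite eqn_leq bg_mult_gt0 andbT leqNgt.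
  by apply/negP => mv; apply: none; exists v.
have r0 : (0 < r')%N.
  by have [i _] := v_surj mv; apply: leq_ltn_trans (ltn_ord i).
have [h hv] := root_surj v.
have Z1 : (1 : Z) != 0.
  apply/eqP => /(congr1 (fun z : Z => κ h 0 (val z))) /=.
  by rewrite coord0 coord1 eqxx => /eqP; rewrite oner_eq0.
have [ev [evc evX]] := mpoly_eval_ex vertex_center (@center_mulC k A) Z1.
have ev_form c0 c : ev (fan_form m_ c0 c) = center_form c0 c.
  rewrite raddfD /=; congr (_ + _); first exact: evc.
  rewrite raddf_sum; apply: eq_bigr => i _; rewrite raddf_sum; apply: eq_bigr => j _.
  apply: etrans (rmorphM ev _ _) _; congr (_ * _); first exact: evc.
  by apply: etrans (rmorphXn ev _ _) _; rewrite evX.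
pose f : {rmorphism {mpoly k[r']} -> B} := [the {rmorphism _ -> _} of pi \o (st \o ev)].
have fE p : f p = pi (st (ev p)) by [].
have ker p : gen_ideal (fan_rel m_) p -> f p = 0.
  apply: gen_ideal_kernel.
  move=> _ [i|i j ij]; rewrite fE.
    have -> : ev ('X_i ^+ (m_ i - 1)) = vertex_center i ^+ (m_ i - 1).
      by apply: etrans (rmorphXn ev _ _) _; rewrite evX.
    apply/pi0_socle; exact: (small_socle char0 (vertex_pow_small i)).
  have -> : ev ('X_i * 'X_j) = 0.
    apply: etrans (rmorphM ev _ _) _; rewrite !evX; apply: val_inj.
    apply: etrans (val_mul _ _) _; apply: vertex_orth; try exact: mult_v.
    by rewrite (inj_eq v_inj).
  by apply/pi0_socle; rewrite (raddf0 st); apply: socle0.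
apply: (quotient_alg_iso (f := f)) => [c|b|p].
- by rewrite fE evc.
- elim/quot_piW: b => x0; elim/quot_piW: x0 => z.
  have [c0 [c sm]] := form_small z; exists (fan_form m_ c0 c).
  rewrite fE ev_form; apply: esym; apply/quot_piP.
  have <- : st (z - center_form c0 c) = st z - st (center_form c0 c).
    exact: (raddfB st).
  exact: (small_socle char0 sm).
split=> [fp|]; last exact: ker.
have [c0 [c Ip]] := fan_normal_form m_ p.
have fq : f (fan_form m_ c0 c) = 0.
  exact: kernelB (ker _ Ip) fp.
have [c00 cij] : c0 = 0 /\ forall i j, (j < m_ i - 2)%N -> c i j = 0.
  by apply: center_form_socle r0 _; apply/pi0_socle; rewrite -ev_form.
rewrite (_ : fan_form m_ c0 c = 0) ?subr0 // in Ip.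
rewrite /fan_form c00 kcst0 add0r big1// => i _; rewrite big1// => j _.
by rewrite cij// kcst0 mul0r.
Qed.

End Final.

Theorem proposition3p4 (k : closedFieldType) (char0 : [pchar k] =i pred0)
    (G : brauerGraph) (r r' : nat) (le_r'r : (r' <= r)%N)
    (x : 'I_r -> rg_vertex G) (x_bij : bijective x)
    (mult_gt1 : forall i : 'I_r, (i < r')%N -> (1 < bg_mult (x i))%N)
    (mult_eq1 : forall i : 'I_r, (r' <= i)%N -> bg_mult (x i) = 1%N) :
  let A := brauer_graph_algebra G k in
  let Zst := stable_center A in
  let B := quotient (socle Zst) in
  (~ multiplicity_free G ->
     alg_iso B (fan_alg k (fun i : 'I_r' => bg_mult (x (widen_ord le_r'r i)))))
  /\
  (multiplicity_free G -> alg_iso B k^o \/ (forall b : B, b = 0)).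
Proof.
have cA := brauer_coordinates G (two_neq0 char0).
move=> A Zst B; split=> [nmf|mf].
  exact: (stable_quotient_fan char0 cA le_r'r x_bij mult_gt1 mult_eq1 nmf).
exact: (stable_quotient_mult_free char0 cA mf).
Qed.
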